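(* Let $\epsilon,\delta\in(0,1)$ and set $$T=\frac{dK\log\frac{2\sqrt{2K}\,H}{\epsilon}}{\log\frac53},\qquad n_{\mathrm{eval}}=\frac{32H^2}{\epsilon^2}\log\frac{4T}{\delta},\qquad n=\frac{1800\,d^2KH^2}{\epsilon^2}\log\frac{8dKT}{\delta}$$ (rounded up to integers where sample counts are needed). If Algorithm A (described in the context) is run with these values of $n_{\mathrm{eval}}$ and $n$, then with probability at least $1-\delta$ it terminates after using at most $$\widetilde{O}\Big(\frac{d^3K^2H^2}{\epsilon^2}\log\frac{dKH}{\delta}\Big)$$ trajectories in total from $M^*$ and returns a policy $\hat\pi$ with $$v^{\hat\pi}_{M^*}\ \ge\ v^*-\epsilon-(3\sqrt{dK}+2)H\theta .$$
   Context: **MDPs.** An episodic MDP $M=(\mathcal S,\mathcal A,P,R,H,P_1)$ has state space $\mathcal S$, action space $\mathcal A$ (arbitrarily large), transition kernel $P:\mathcal S\times\mathcal A\to\Delta(\mathcal S)$, reward distribution $R:\mathcal S\times\mathcal A\to\Delta([0,1])$, horizon $H$, initial state distribution $P_1$. A policy is a map $\pi:\mathcal S\times[H]\to\mathcal A$; a trajectory is $(s_1,a_1,r_1,\dots,s_H,a_H,r_H)$ with $s_1\sim P_1$, $a_h=\pi(s_h,h)$, $r_h\sim R(\cdot|s_h,a_h)$, $s_{h+1}\sim P(\cdot|s_h,a_h)$. $V^\pi_{M,h}(s)=\mathbb E[\sum_{h'=h}^H r_{h'}\mid s_h=s]$ under $\pi$ in $M$, and $v^\pi_M=\mathbb E_{s\sim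 P_1}[V^\pi_{M,1}(s)]$; value functions at step $H+1$ are $0$. $\pi_M$ denotes an optimal policy of $M$ (assumed to exist) and $v_M$ its value. $M^*$ is the unknown true environment (kernel $P^*$, reward $R^*$), and $v^*=v_{M^*}$. **Linear model class.** Given are $K$ base MDPs $M_1,\dots,M_K$ (with kernels $P^k$, rewards $R^k$) sharing $\mathcal S,\mathcal A,H,P_1$ with $M^*$, and a feature map $\phi:\mathcal S\times\mathcal A\to\Delta_{d-1}$ (the probability simplex in $\mathbb R^d$). Let $\mathcal W=\mathcal W_0=\{W\in[0,1]^{K\times d}:\sum_{i=1}^K W_{ij}=1\ \forall j\in[d]\}$. For $W\in\mathcal W$, $M(W)$ is the MDP (same $\mathcal S,\mathcal A,H,P_1$) with $P^W(\cdot|s,a)=\sum_k[W\phi(s,a)]_kP^k(\cdot|s,a)$ and $R^W(\cdot|s,a)=\sum_k[W\phi(s,a)]_kR^k(\cdot|s,a)$. $\pi_W=\pi_{M(W)}$, $v_W=v_{M(W)}$, $V_{W,h}=V^{\pi_W}_{M(W),h}$. The approximation error is $$\theta=\min_{W\in\mathcal W}\sup_{(s,a)}\big(\|P^*(\cdot|s,a)-P^W(\cdot|s,a)\|_1+\|R^*(\cdot|s,a)-R^W(\cdot|s,a)\|_1\big).$$ Standing assumption: the total reward $\sum_{h=1}^Hr_h$ lies in $[0,1]$ almost surely in all MDPs of interest ($M^*$, $M_k$, $M(W)$) under all policies; in particular all value functions take values in $[0,1]$. **Algorithm A.** Input: the base models, $\phi$, $\epsilon,\delta,\theta,\mathcal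 W_0$. For $t=1,2,\dots$: 1. Let $W_t\in\arg\max_{W\in\mathcal W_{t-1}}v_W$ and $\pi_t=\pi_{W_t}$; write $V_{t,h}=V_{W_t,h}$. 2. Draw $n_{\mathrm{eval}}$ independent trajectories of $\pi_t$ in $M^*$ and let $\hat v_t=\frac1{n_{\mathrm{eval}}}\sum_{i=1}^{n_{\mathrm{eval}}}\sum_{h=1}^Hr_h^{(i)}$. 3. If $v_{W_t}-\hat v_t\le\frac{3\epsilon}4+(3\sqrt{dK}+1)H\theta$, terminate and output $\pi_t$. 4. Otherwise draw $n$ fresh independent trajectories of $\pi_t$ in $M^*$ and set $\widehat Z_t=\frac1n\sum_{i=1}^n\sum_{h=1}^H\overline V_{t,h}(s_h^{(i)},a_h^{(i)})\phi(s_h^{(i)},a_h^{(i)})^\top\in\mathbb R^{K\times d}$ and $\hat y_t=\frac1n\sum_{i=1}^n\sum_{h=1}^H\big(r_h^{(i)}+V_{t,h+1}(s_{h+1}^{(i)})\big)$, where $\overline V_{t,h}(s,a)\in\mathbb R^K$ has $k$-th entry $\mathbb E_{r\sim R^k(\cdot|s,a),\,s'\sim P^k(\cdot|s,a)}[r+V_{t,h+1}(s')]$. 5. Set $\mathcal W_t=\{W\in\mathcal W_{t-1}:|\hat y_t-\langle W,\widehat Z_t\rangle|\le\frac{\epsilon}{12\sqrt{dK}}+H\theta\}$, with $\langle A,B\rangle=\mathrm{Tr}(A^\top B)$. **Notation.** $\widetilde O(g)$ means at most $g$ times an absolute constant and factors polylogarithmic in $d,K,H,1/\epsilon$; logarithmic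 factors inside $\widetilde O$ are read as at least $1$. *)

(* Defs.v *)
From HB Require Import structures.
From mathcomp Require Import all_boot all_order all_algebra.
From mathcomp Require Import all_classical all_reals all_analysis.
From mathcomp Require Import measurable_realfun.

Set Implicit Arguments.
Unset Strict Implicit.
Unset Printing Implicit Defensive.
Import Order.TTheory GRing.Theory Num.Theory.
Import numFieldNormedType.Exports.

Local Open Scope classical_set_scope.
Local Open Scope ring_scope.

(* Total variation norm of the signed measure [mu - nu], as a supremum over
   finite families of disjoint measurable sets; for discrete measures it is
   the l1 distance between the mass functions. *)
Definition l1_dist d (T : measurableType d) (R : realType)
    (mu nu : {measure set T -> \bar R}) : \bar R :=
  ereal_sup [set x | exists n (B : 'I_n -> set T),
    [/\ forall i, measurable (B i), trivIset setT B &
        x = (\sum_(i < n) `|mu (B i) - nu (B i)|)%E]].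

Record simplex_fun d (T : measurableType d) (R : realType) (n : nat) :=
  SimplexFun {
    sval_of :> T -> 'cV[R]_n;
    sfun_meas : forall i, measurable_fun [set: T] (fun x => sval_of x i ord0);
    sfun_ge0 : forall x i, 0 <= sval_of x i ord0;
    sfun_sum1 : forall x, \sum_i sval_of x i ord0 = 1 }.

Section mixture.
Context d1 d2 (X : measurableType d1) (Y : measurableType d2) (R : realType).
Variables (n : nat) (c : simplex_fun X R n) (k : 'I_n -> R.-pker X ~> Y).
Local Open Scope ereal_scope.

Definition mix_fun (x : X) (U : set Y) : \bar R :=
  \sum_(i < n) (c x i ord0)%:E * k i x U.

Let mix0 x : mix_fun x set0 = 0.
Proof. by rewrite /mix_fun big1// => i _; rewrite measure0 mule0. Qed.

Let mix_ge0 x U : 0 <= mix_fun x U.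
Proof.
by apply: sume_ge0 => i _; rewrite mule_ge0// lee_fin sfun_ge0.
Qed.

Let mix_sigma_additive x : semi_sigma_additive (mix_fun x).
Proof.
pose m i : {measure set Y -> \bar R} :=
  mscale (NngNum (sfun_ge0 c x i)) (k i x).
suff -> : mix_fun x = msum (fun j => if insub j is Some i then m i else mzero) n
  by exact: measure_semi_sigma_additive.
apply/funext => U; rewrite /msum /mix_fun; apply: eq_bigr => i _.
by rewrite valK.
Qed.

HB.instance Definition _ x := isMeasure.Build _ _ R
  (mix_fun x) (mix0 x) (mix_ge0 x) (@mix_sigma_additive x).

Definition mix : X -> {measure set Y -> \bar R} := mix_fun.

Let measurable_fun_mix U : measurable U -> measurable_fun [set: X] (mix ^~ U).
Proof.
move=> mU; apply: emeasurable_sum => i; apply: emeasurable_funM.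
  by apply/measurable_EFinP; exact: sfun_meas.
exact: measurable_kernel.
Qed.

HB.instance Definition _ := isKernel.Build _ _ _ _ _ mix measurable_fun_mix.

Let mix_prob x : mix x [set: Y] = 1.
Proof.
rewrite /mix/= /mix_fun; under eq_bigr do rewrite prob_kernel mule1.
by rewrite sumEFin sfun_sum1.
Qed.

HB.instance Definition _ := Kernel_isProbability.Build _ _ _ _ _ mix mix_prob.
End mixture.

Section kpre.
Context d1 d2 d3 (X : measurableType d1) (Y : measurableType d2)
  (Z : measurableType d3) (R : realType).
Variables (f : X -> Y) (k : R.-pker Y ~> Z).

Definition kpre (mf : measurable_fun [set: X] f) (x : X) :
  {measure set Z -> \bar R} := k (f x).

Hypothesis mf : measurable_fun [set: X] f.

Let measurable_fun_kpre U : measurable U ->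
  measurable_fun [set: X] (kpre mf ^~ U).
Proof.
by move=> mU; exact: measurableT_comp (measurable_kernel k U mU) mf.
Qed.

HB.instance Definition _ := isKernel.Build _ _ _ _ _ (kpre mf)
  measurable_fun_kpre.

Let kpre_prob x : kpre mf x [set: Z] = 1%E.
Proof. exact: prob_kernel. Qed.

HB.instance Definition _ := Kernel_isProbability.Build _ _ _ _ _
  (kpre mf) kpre_prob.
End kpre.

(* Composition of two probability kernels, the second of which also sees the
   input of the first. *)
Section kbind.
Context d1 d2 d3 (X : measurableType d1) (Y : measurableType d2)
  (Z : measurableType d3) (R : realType).
Variables (l : R.-pker X ~> Y) (k : R.-pker (X * Y) ~> Z).

Definition kbind : X -> {measure set Z -> \bar R} := mkcomp l k.

Let measurable_fun_kbind U : measurable U ->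
  measurable_fun [set: X] (kbind ^~ U).
Proof. exact: KCOMP_FINITE_KERNEL.measurable_fun_kcomp_finite. Qed.

HB.instance Definition _ := isKernel.Build _ _ _ _ _ kbind measurable_fun_kbind.

Let kbind_prob x : kbind x [set: Z] = 1%E.
Proof.
rewrite /kbind /mkcomp/= /kcomp.
under eq_integral do rewrite prob_kernel.
by rewrite integral_cst// mul1e prob_kernel.
Qed.

HB.instance Definition _ := Kernel_isProbability.Build _ _ _ _ _
  kbind kbind_prob.
End kbind.

Section mdp.
Context dS dA (S : measurableType dS) (A : measurableType dA) (R : realType).

(* The horizon and the initial distribution, shared by all the MDPs under
   consideration, are kept as separate parameters below. *)
Record mdp := Mdp {
  trans : R.-pker (S * A) ~> S;
  rew : R.-pker (S * A) ~> measurableTypeR R;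
  rew01 : forall x, rew x [set r : R | 0 <= r <= 1] = 1%E }.

(* [pi h] is the decision rule of the step number [h.+1]; only the values at
   [h < H] matter for an MDP of horizon [H]. *)
Definition policy := nat -> {mfun S >-> A}.

(* One step [(s_h, a_h, r_h)] of a trajectory. *)
Definition step : measurableType _ := (S * A * measurableTypeR R)%type.

Definition reward_of (z : step) : R := z.2.

Definition total_reward m (tau : m.-tuple step) : R :=
  \sum_(i < m) reward_of (tnth tau i).

Section trajectory_kernel.
Variables (M : mdp) (pi : policy).

Definition act h (s : S) : S * A := (s, pi h s).

Lemma measurable_act h : measurable_fun [set: S] (act h).
Proof. by apply/measurable_fun_pairP; split=> /=; [exact: measurable_id|exact: (measurable_funP (pi h))]. Qed.

Lemma measurable_act_fst h :
  measurable_fun [set: S * measurableTypeR R] (act h \o fst).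
Proof. exact: measurableT_comp (measurable_act h) measurable_fst. Qed.

Definition first_step h m
    (x : S * measurableTypeR R * S * m.-tuple step) : m.+1.-tuple step :=
  [tuple of (act h x.1.1.1, x.1.1.2) :: x.2].

Lemma measurable_first_step h m :
  measurable_fun [set: S * measurableTypeR R * S * m.-tuple step]
    (@first_step h m).
Proof.
apply: (@measurable_cons _ _ _ step _ _ snd); last exact: measurable_snd.
apply/measurable_fun_pairP; split.
  apply: (measurableT_comp (measurable_act_fst h)).
  exact: measurableT_comp measurable_fst measurable_fst.
apply: (measurableT_comp (@measurable_snd _ _ S (measurableTypeR R))).
exact: measurableT_comp measurable_fst measurable_fst.
Qed.

(* Law of the last [m] steps of a trajectory, when step number [h.+1] starts in
   [s]: with [a = pi h s], draw [r] from [rew M (s, a)] and [s'] from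
   [trans M (s, a)], then run the remaining [m.-1] steps from [s']. *)
Fixpoint traj_from (m h : nat) : R.-pker S ~> (m.-tuple step) :=
  match m with
  | 0 => kdirac (@measurable_cst _ _ S (0.-tuple step) setT [tuple])
  | m'.+1 =>
    kbind (kpre (rew M) (measurable_act h))
      (kbind (kpre (trans M) (measurable_act_fst h))
        (kbind (kpre (traj_from m' h.+1) measurable_snd)
          (kdirac (@measurable_first_step h m'))))
  end.

End trajectory_kernel.

Section values.
Variables (H : nat) (P1 : probability S R).

Definition traj_law (M : mdp) (pi : policy) (B : set (H.-tuple step)) : \bar R :=
  \int[P1]_s traj_from M pi H 0 s B.

(* [value_fun M pi h] is the value function of step number [h.+1]; it vanishes
   at [h = H]. *)
Definition value_fun (M : mdp) (pi : policy) (h : nat) (s : S) : R :=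
  \int[traj_from M pi (H - h) h s]_tau total_reward tau.

Definition value (M : mdp) (pi : policy) : R :=
  \int[P1]_s value_fun M pi 0 s.

Definition optimal (M : mdp) (pi : policy) : Prop :=
  forall pi' : policy, value M pi' <= value M pi.

Definition bounded_rewards (M : mdp) : Prop :=
  forall pi : policy,
    traj_law M pi [set tau | 0 <= total_reward tau <= 1] = 1%E /\
    forall h s, 0 <= value_fun M pi h s <= 1.

End values.

End mdp.

Arguments traj_law {dS dA S A R H}.

Record weights (R : realType) (K d : nat) := Weights {
  wmx :> 'M[R]_(K, d);
  w01 : forall i j, 0 <= wmx i j <= 1;
  wsum1 : forall j, \sum_i wmx i j = 1 }.

Section linear_class.
Context dS dA (S : measurableType dS) (A : measurableType dA) (R : realType).
Variables (K d : nat) (base : 'I_K -> mdp S A R).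
Variable phi : simplex_fun (S * A)%type R d.

Section weighted.
Variable W : weights R K d.

Let wphi (x : S * A) : 'cV[R]_K := W *m phi x.

Let wphi_meas i : measurable_fun [set: S * A] (fun x => wphi x i ord0).
Proof.
rewrite (_ : (fun _ => _) = fun x => \sum_j W i j * phi x j ord0); last first.
  by apply/funext => x; rewrite mxE.
apply: measurable_sum => j; apply: measurable_funM => //.
exact: sfun_meas.
Qed.

Let wphi_ge0 x i : 0 <= wphi x i ord0.
Proof.
rewrite mxE; apply: sumr_ge0 => j _; apply: mulr_ge0; last exact: sfun_ge0.
by have /andP[] := w01 W i j.
Qed.

Let wphi_sum1 x : \sum_i wphi x i ord0 = 1.
Proof.
under eq_bigr do rewrite mxE.
rewrite exchange_big/=; under eq_bigr do rewrite -mulr_suml wsum1 mul1r.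
exact: sfun_sum1.
Qed.

Definition weighted_features : simplex_fun (S * A)%type R K :=
  SimplexFun wphi_meas wphi_ge0 wphi_sum1.

Let mix_rew01 x : mix weighted_features (fun k => rew (base k)) x [set r : R | 0 <= r <= 1] = 1%E.
Proof.
rewrite /mix/= /mix_fun; under eq_bigr do rewrite rew01 mule1.
by rewrite sumEFin sfun_sum1.
Qed.

Definition mixed_mdp : mdp S A R :=
  @Mdp _ _ S A R (mix weighted_features (fun k => trans (base k)))
    (mix weighted_features (fun k => rew (base k))) mix_rew01.

End weighted.

Definition approx_error_at (Mstar : mdp S A R) (W : weights R K d) : \bar R :=
  ereal_sup [set (l1_dist (trans Mstar x) (trans (mixed_mdp W) x) +
                  l1_dist (rew Mstar x) (rew (mixed_mdp W) x))%E | x in setT].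

Definition is_approx_error (Mstar : mdp S A R) (theta : R) : Prop :=
  (exists W, approx_error_at Mstar W = theta%:E) /\
  (forall W, (theta%:E <= approx_error_at Mstar W)%E).

End linear_class.

Section algorithm.
Context dS dA (S : measurableType dS) (A : measurableType dA) (R : realType).
Variables (H : nat) (P1 : probability S R).
Variables (K d : nat) (base : 'I_K -> mdp S A R).
Variable phi : simplex_fun (S * A)%type R d.
(* [piW W] is the optimal policy used for [M(W)]. *)
Variable piW : weights R K d -> policy S A.
Variables (eps theta : R) (neval n : nat).

Local Notation traj := (H.-tuple (step S A R)).

Definition vW (W : weights R K d) : R :=
  value H P1 (mixed_mdp base phi W) (piW W).

Definition VW (W : weights R K d) (h : nat) (s : S) : R :=
  value_fun H (mixed_mdp base phi W) (piW W) h s.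

Definition v_hat (Y : 'I_neval -> traj) : R :=
  neval%:R^-1 * \sum_(i < neval) total_reward (Y i).

Definition stop (W : weights R K d) (Y : 'I_neval -> traj) : Prop :=
  vW W - v_hat Y <=
    3 * eps / 4 + (3 * Num.sqrt (d * K)%:R + 1) * H%:R * theta.

Definition V_bar (W : weights R K d) (h : nat) (x : S * A) : 'cV[R]_K :=
  \col_k \int[rew (base k) x]_r \int[trans (base k) x]_s' (r + VW W h.+1 s').

Definition Z_hat (W : weights R K d) (X : 'I_n -> traj) : 'M[R]_(K, d) :=
  n%:R^-1 *: \sum_(i < n) \sum_(h < H)
    (V_bar W h (tnth (X i) h).1 *m (phi (tnth (X i) h).1)^T).

(* The value of the state that follows step [h] of [tau]: no state is recorded
   after the last step, where the value function is 0. *)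
Definition next_value (W : weights R K d) (tau : traj) (h : 'I_H) : R :=
  oapp (fun j : 'I_H => VW W j (tnth tau j).1.1) 0 (insub h.+1).

Definition y_hat (W : weights R K d) (X : 'I_n -> traj) : R :=
  n%:R^-1 * \sum_(i < n) \sum_(h < H)
    (reward_of (tnth (X i) h) + next_value W (X i) h).

(* A run is described on a probability space [Omega] by, for every round
   number [t.+1], the chosen weights [W t], the evaluation trajectories [Y t]
   and the estimation trajectories [X t]. *)
Section run.
Context dO (Omega : measurableType dO) (P : probability Omega R).
Variable W : nat -> Omega -> weights R K d.
Variable Y : nat -> 'I_neval -> Omega -> traj.
Variable X : nat -> 'I_n -> Omega -> traj.

Definition stopped (t : nat) (w : Omega) : Prop := stop (W t w) (Y t ^~ w).

Fixpoint conf_set (t : nat) (w : Omega) : set (weights R K d) :=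
  match t with
  | 0 => setT
  | t'.+1 => conf_set t' w `&` [set V : weights R K d |
      `| y_hat (W t' w) (X t' ^~ w) -
         \tr (V^T *m Z_hat (W t' w) (X t' ^~ w)) |
        <= eps / (12 * Num.sqrt (d * K)%:R) + H%:R * theta]
  end.

(* Round number [t.+1] takes place: no earlier round terminated, and there are
   weights to choose from. *)
Definition started (t : nat) (w : Omega) : Prop :=
  (forall u, (u < t)%N -> ~ stopped u w) /\ conf_set t w !=set0.

(* [tau_0, ..., tau_(m-1)] are, conditionally on the sigma-algebra [F] and on
   the event [D], independent trajectories in [Mstar] of the policy of [V]. *)
Definition fresh_draws (Mstar : mdp S A R) (F : set (set Omega)) (D : set Omega)
    (V : Omega -> weights R K d) m (tau : 'I_m -> Omega -> traj) : Prop :=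
  forall (E : set Omega) (B : 'I_m -> set traj),
    F E -> E `<=` D -> (forall i, measurable (B i)) ->
    P (E `&` \bigcap_i (tau i @^-1` B i)) =
    (\int[P]_(w in E)
       (\prod_(i < m) fine (traj_law P1 Mstar (piW (V w)) (B i)))%:E)%E.

(* [F t] and [G t] gather what is known when round number [t.+1] begins, and
   after its evaluation trajectories have been drawn; they may contain the
   outcomes of internal randomization. Variables of rounds that do not take
   place are irrelevant. *)
Record algorithm_run (Mstar : mdp S A R) (F G : nat -> set (set Omega)) :
    Prop := AlgorithmRun {
  F_sigma_algebra : forall t, sigma_algebra setT (F t);
  G_sigma_algebra : forall t, sigma_algebra setT (G t);
  G_measurable : forall t, G t `<=` measurable;
  F_sub_G : forall t, F t `<=` G t;
  G_sub_F : forall t, G t `<=` F t.+1;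
  W_adapted : forall t i j, measurable_fun [set: g_sigma_algebraType (F t)]
    (fun w : g_sigma_algebraType (F t) => W t w i j);
  pi_adapted : forall t h, measurable_fun [set: g_sigma_algebraType (F t) * S]
    (fun x : g_sigma_algebraType (F t) * S => piW (W t x.1) h x.2);
  Y_adapted : forall t i, measurable_fun [set: g_sigma_algebraType (G t)]
    (Y t i : g_sigma_algebraType (G t) -> traj);
  X_adapted : forall t i, measurable_fun [set: g_sigma_algebraType (F t.+1)]
    (X t i : g_sigma_algebraType (F t.+1) -> traj);
  W_argmax : forall t w, started t w -> conf_set t w (W t w) /\
    (forall V, conf_set t w V -> vW V <= vW (W t w));
  Y_fresh : forall t, fresh_draws Mstar (F t) (started t) (W t) (Y t);
  X_fresh : forall t, fresh_draws Mstar (G t)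
    (started t `&` ~` stopped t) (W t) (X t) }.

End run.

End algorithm.

Definition rounds (R : realType) (d K H : nat) (eps : R) : R :=
  (d * K)%:R * ln (2 * Num.sqrt (2 * K%:R) * H%:R / eps) / ln (5 / 3).

Definition n_eval_of (R : realType) (d K H : nat) (eps delta : R) : nat :=
  `|Num.ceil (32 * H%:R ^+ 2 / eps ^+ 2
              * ln (4 * rounds d K H eps / delta))|%N.

Definition n_of (R : realType) (d K H : nat) (eps delta : R) : nat :=
  `|Num.ceil (1800 * d%:R ^+ 2 * K%:R * H%:R ^+ 2 / eps ^+ 2
              * ln (8 * d%:R * K%:R * rounds d K H eps / delta))|%N.

(* Logarithms under an O-tilde are read as at least 1. *)
Definition ln1 (R : realType) (x : R) : R := Num.max 1 (ln x).

(* [C] and [p] are the absolute constant and the polylogarithmic exponent. *)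
Definition sample_bound (R : realType) (C p d K H : nat) (eps delta : R) : R :=
  C%:R * ln1 ((d * K * H)%:R / eps) ^+ p *
  (d%:R ^+ 3 * K%:R ^+ 2 * H%:R ^+ 2 / eps ^+ 2 *
   ln1 ((d * K * H)%:R / delta)).

(* Main.v *)
(* Optimism: the weights [Wst] attaining the approximation error stay in the
   confidence set with high probability, so [vW (W t)] is at least the value of
   [Wst], which is within [H * theta] of the optimal value. Hence a round that
   stops returns a good policy.

   In a round that does not stop, the model of [W t] overestimates the value of
   its own policy; by a telescoping of the Bellman equations this gap is the
   expected residual of [W t] on the fresh trajectories. As the residual is
   affine in the weights and small at [Wst], the matrix [Z_hat] is strongly
   correlated with [W t - Wst], while the later candidates are confined to a
   thin slab orthogonal to it. An ellipsoid potential, the determinant of a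
   quadratic form whose unit ball contains all the remaining [V - Wst], then
   grows geometrically but stays bounded, which bounds the number of rounds.

   The deviations of the empirical means are controlled by Hoeffding's
   inequality, conditionally on the past, and a union bound over the rounds. *)
Require Import Defs.
From HB Require Import structures.
From mathcomp Require Import all_boot all_order all_algebra perm.
From mathcomp Require Import all_classical all_reals all_analysis.
From mathcomp Require Import measurable_realfun.
From mathcomp Require Import ring lra.

Set Implicit Arguments.
Unset Strict Implicit.
Unset Printing Implicit Defensive.
Import Order.TTheory GRing.Theory Num.Theory.
Import numFieldNormedType.Exports.

Local Open Scope classical_set_scope.
Local Open Scope ring_scope.

(** * Volume argument *)

(** Each update shrinks the quadratic form by a factor [a < 1], which costs [a ^+ m] in the
    determinant, with [m = d * K]. The rank-one term outweighs this because the current candidate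
    overshoots the slab by a factor of order [sqrt m]. The slab has half-width twice the confidence
    radius; this is why [sqrt (d * K)] divides [eps] in the radius and multiplies [H * theta] in the
    stopping threshold. The probabilistic obstacle is that policies, tested functions and thresholds
    are random through [W t], whereas freshness is only a product formula on boxes. The law of the
    draws is therefore made a kernel on [Omega] equipped with the sigma-algebra of the past, and the
    formula is extended to all joint events of past and draws. This requires values and residuals to
    depend measurably on the outcome, which is obtained from the Bellman equations. The argmax over
    a confidence set is used pointwise only; probabilities are taken of events given by finitely
    many measurable conditions. *)

Lemma det_rank1_update (F : comNzRingType) m (u : 'cV[F]_m) (v : 'rV[F]_m) :
  \det (1%:M + u *m v) = 1 + (v *m u) ord0 ord0.
Proof.
(* Matrix determinant lemma: conjugation by a unipotent block matrix moves the rank-one term from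
   one diagonal block to the other. *)
have E : block_mx 1%:M 0 v 1%:M *m block_mx (1%:M + u *m v) u 0 1%:M *m
    block_mx 1%:M 0 (- v) 1%:M = block_mx 1%:M u 0 (1%:M + v *m u) :> 'M[F]_(m + 1).
  rewrite !mulmx_block !mul1mx !mul0mx !mulmx0 !mulmx1 !addr0 ?mul1mx ?add0r.
  rewrite mulmxN mulmxDr mulmx1 mulmxN mulmxDl mul1mx mulmxA.
  by rewrite addrK (addrC (v *m u *m v)) subrr (addrC (v *m u)).
have := congr1 determinant E.
rewrite !det_mulmx !det_ublock !det_lblock !det1 !mul1r !mulr1 => ->.
by rewrite det_mx11 !mxE.
Qed.

Section potential.
Variable R : realFieldType.
Implicit Types m : nat.

Definition dotmx m (x y : 'rV[R]_m) : R := (x *m y^T) ord0 ord0.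
Definition qform m (A : 'M[R]_m) (x : 'rV[R]_m) : R := (x *m A *m x^T) ord0 ord0.
Definition posdef m (A : 'M[R]_m) : Prop :=
  A^T = A /\ forall x, x != 0 -> 0 < qform A x.

Lemma dotmxE m (x y : 'rV[R]_m) : dotmx x y = \sum_i x ord0 i * y ord0 i.
Proof. by rewrite /dotmx mxE; apply: eq_bigr => i _; rewrite mxE. Qed.

Lemma posdef_unit m (A : 'M[R]_m) : posdef A -> A \in unitmx.
Proof.
move=> [_ Apos]; rewrite unitmxE unitfE; apply/negP => /det0P[v v0 vA].
by have := Apos _ v0; rewrite /qform vA mul0mx mxE ltxx.
Qed.

Lemma posdef_ge0 m (A : 'M[R]_m) x : posdef A -> 0 <= qform A x.
Proof.
move=> [_ Apos]; have [->|/Apos/ltW//] := eqVneq x 0.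
by rewrite /qform !mul0mx mxE.
Qed.

Lemma qform_invmx m (A : 'M[R]_m) z : posdef A ->
  qform A (z *m invmx A) = qform (invmx A) z.
Proof.
move=> pA; have uA := posdef_unit pA; have [sA _] := pA.
by rewrite /qform -(mulmxA z) mulVmx// mulmx1 trmx_mul trmx_inv sA mulmxA.
Qed.

(** [<x, z>] is the [A]-inner product of [x] and [y = z A^-1]; the usual argument evaluates the form
    at [qform A y *: x - <x, z> *: y]. *)
Lemma posdef_CauchySchwarz m (A : 'M[R]_m) x z : posdef A ->
  dotmx x z ^+ 2 <= qform A x * qform (invmx A) z.
Proof.
move=> pA; have uA := posdef_unit pA; have [sA Apos] := pA.
pose y := z *m invmx A.
have yA : y *m A = z by rewrite /y -mulmxA mulVmx// mulmx1.
have yy : qform A y = qform (invmx A) z by rewrite qform_invmx.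
have xy : (x *m A *m y^T) ord0 ord0 = dotmx x z.
  by rewrite /y trmx_mul trmx_inv sA -mulmxA (mulmxA A) mulmxV// mul1mx.
have yx : (y *m A *m x^T) ord0 ord0 = dotmx x z.
  by rewrite yA !dotmxE -[z *m x^T]trmxK trmx_mul trmxK mxE -/(dotmx x z) dotmxE.
set b := dotmx x z in xy yx *; rewrite -yy.
have [y0|/Apos y0] := eqVneq y 0.
  have -> : b = 0 by rewrite /b /dotmx -yA y0 mul0mx trmx0 mulmx0 mxE.
  by rewrite expr0n/= mulr_ge0// posdef_ge0.
have := posdef_ge0 (qform A y *: x - b *: y) pA.
rewrite {1}/qform.
have -> : (qform A y *: x - b *: y)^T = qform A y *: x^T - b *: y^T.
  by apply/matrixP => i j; rewrite !mxE.
rewrite !mulmxBl !mulmxBr -!scalemxAr -!scalemxAl.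
set c := qform A y in y0 *; set a := qform A x.
have -> : (c *: (c *: (x *m A *m x^T)) - b *: (c *: (x *m A *m y^T)) -
    (c *: (b *: (y *m A *m x^T)) - b *: (b *: (y *m A *m y^T)))) ord0 ord0 =
    c * (a * c - b ^+ 2).
  rewrite !mxE; move: xy yx; rewrite !mxE => -> ->.
  rewrite /a /c /qform !mxE; ring.
by rewrite pmulr_rge0// subr_ge0.
Qed.

(** When [a + b * beta^2 = 1], the unit ball of the new form contains the part of the old unit ball
    inside the slab [|<x, z>| <= beta]. *)
Definition slab_update m (a b : R) (A : 'M[R]_m) (z : 'rV[R]_m) : 'M[R]_m :=
  a *: A + b *: (z^T *m z).

Lemma qform_slab_update m (a b : R) (A : 'M[R]_m) x z :
  qform (slab_update a b A z) x = a * qform A x + b * dotmx x z ^+ 2.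
Proof.
rewrite /qform mulmxDr mulmxDl -!scalemxAr -!scalemxAl (mulmxA x) -(mulmxA _ z).
rewrite mxE [X in X + _]mxE [X in _ + X]mxE; congr (_ + _ * _).
by rewrite mxE big_ord_recl big_ord0 addr0 -/(dotmx x z) -/(dotmx z x) !dotmxE
  expr2; congr (_ * _); apply: eq_bigr => i _; rewrite mulrC.
Qed.

Lemma posdef_slab_update m (a b : R) (A : 'M[R]_m) z : 0 < a -> 0 <= b ->
  posdef A -> posdef (slab_update a b A z).
Proof.
move=> a0 b0 [sA Apos]; split.
  by rewrite linearD/= !linearZ/= sA trmx_mul trmxK.
move=> x x0; rewrite qform_slab_update ltr_pwDl ?mulr_gt0 ?Apos//.
by rewrite mulr_ge0 ?sqr_ge0.
Qed.

Lemma det_slab_update m (a b : R) (A : 'M[R]_m) z : 0 < a -> posdef A ->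
  \det (slab_update a b A z) =
  a ^+ m * \det A * (1 + b / a * qform (invmx A) z).
Proof.
move=> a0 pA; have uA := posdef_unit pA.
have -> : slab_update a b A z =
    (a *: A) *m (1%:M + ((b / a) *: (invmx A *m z^T)) *m z).
  rewrite mulmxDr mulmx1 -!scalemxAl -!scalemxAr scalerA mulrC divfK ?gt_eqF//.
  by rewrite !mulmxA mulmxV// mul1mx.
rewrite det_mulmx det_rank1_update detZ; congr (_ * (_ + _)).
by rewrite -scalemxAr mxE mulmxA.
Qed.

(** Leibniz expansion and [m! <= m^m]. The bound enters the number of rounds only through its
    logarithm. *)
Lemma det_bound m (A : 'M[R]_m) (M : R) :
  (forall i j, `|A i j| <= M) -> `|\det A| <= (m%:R * M) ^+ m.
Proof.
case: m A => [|m] A AM; first by rewrite det_mx00 normr1 expr0.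
have M0 : 0 <= M by exact: le_trans (AM ord0 ord0).
apply: (@le_trans _ _ (\sum_(s : 'S_m.+1) M ^+ m.+1)).
  apply: le_trans (ler_norm_sum _ _ _) _; apply: ler_sum => s _.
  rewrite normrM normrX normrN1 expr1n mul1r normr_prod.
  have -> : M ^+ m.+1 = \prod_(i < m.+1) M by rewrite prodr_const card_ord.
  by apply: ler_prod => i _; rewrite normr_ge0/=.
rewrite sumr_const card_Sn exprMn -[leLHS]mulr_natl ler_wpM2r ?exprn_ge0//.
rewrite -natrX ler_nat {AM M0}.
rewrite -ffactnn ffact_prod.
have -> : (m.+1 ^ m.+1 = \prod_(i < m.+1) m.+1)%N by rewrite prod_nat_const card_ord.
by apply: leq_prod => i _; rewrite leq_subr.
Qed.

Lemma Bernoulli_le (x : R) n : -1 <= x -> 1 + n%:R * x <= (1 + x) ^+ n.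
Proof.
move=> x1; elim: n => [|n IH]; first by rewrite mul0r addr0 expr0.
have x0 : 0 <= 1 + x by lra.
rewrite exprS; apply: le_trans (ler_wpM2l x0 IH).
rewrite -natr1; have := sqr_ge0 x; have : (0 : R) <= n%:R by [].
move: (n%:R) => k k0; rewrite expr2 => xx; have := mulr_ge0 k0 xx; lra.
Qed.

(** Bernoulli gives [(1 - y)^(m-1) >= 1/2 + y], and [(1/2 + y) (17/8 - y) >= 17/16] for
    [0 <= y <= 1/2]. The [9/8] is [9/4 * y * m], the relative gain of the rank-one term. *)
Lemma growth_factor m (y : R) : (0 < m)%N -> y * m%:R = 1 / 2 ->
  17 / 16 <= (1 - y) ^+ m * (1 + 9 / 8 / (1 - y)).
Proof.
case: m => // n _ ny.
have n0 : 0 <= n%:R :> R by exact: ler0n.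
have y0 : 0 < y.
  rewrite ltNge; apply/negP => y0; move: ny; rewrite -natr1.
  by move: n0 y0; move: (n%:R) => k k0 y0; nra.
have ny' : n%:R * y = 1 / 2 - y by move: ny; rewrite -natr1; lra.
have y2 : y <= 1 / 2.
  by have := mulr_ge0 n0 (ltW y0); lra.
have a0 : 0 < 1 - y by lra.
have -> : (1 - y) ^+ n.+1 * (1 + 9 / 8 / (1 - y)) = (1 - y) ^+ n * (17 / 8 - y).
  by rewrite exprSr; field; rewrite gt_eqF.
have am : 1 / 2 + y <= (1 - y) ^+ n.
  have := @Bernoulli_le (- y) n; rewrite mulrN ny' => /(_ _)/(le_trans _); apply; lra.
have a9 : 0 <= 17 / 8 - y by lra.
apply: le_trans (ler_wpM2r a9 am).
nra.
Qed.

(* Shrinking the ellipsoid [qform A x <= 1] to one that contains its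
   intersection with the slab [|<x, z>| <= beta] multiplies the determinant by
   a constant factor, because some [x] of the ellipsoid has
   [|<x, z>| >= 3/2 sqrt m beta]. *)
Lemma ellipsoid_potential m N (x z : nat -> 'rV[R]_m) (beta r B M : R) :
  (0 < m)%N -> 0 < beta -> 0 < r -> r^-1 <= M -> B ^+ 2 / beta ^+ 2 <= M ->
  (forall t, (t < N)%N -> dotmx (x t) (x t) <= r) ->
  (forall t, (t < N)%N -> forall i, `|z t ord0 i| <= B) ->
  (forall t u, (u < t < N)%N -> `|dotmx (x t) (z u)| <= beta) ->
  (forall t, (t < N)%N ->
     9 / 4 * m%:R * beta ^+ 2 <= dotmx (x t) (z t) ^+ 2) ->
  (17 / 16) ^+ N * r^-1 ^+ m <= (m%:R * M) ^+ m.
Proof.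
move=> m0 beta0 r0 rM BM xr zB xzu xzt.
(* With [a + b * beta^2 = 1], the choice [y = 1 / (2 m)] keeps [a ^+ m] above one half while the
   gain of the update is still at least [(9/8) / a]. *)
pose y : R := (2 * m%:R)^-1; pose a : R := 1 - y; pose b : R := y / beta ^+ 2.
have m1 : 1 <= m%:R :> R by rewrite ler1n.
have y0 : 0 < y by rewrite /y invr_gt0 mulr_gt0// (lt_le_trans _ m1).
have ym : y * m%:R = 1 / 2.
  by rewrite /y invfM -mulrA mulVf ?gt_eqF ?(lt_le_trans _ m1)// mulr1 div1r.
have y2 : y <= 1 / 2 by rewrite -ym ler_peMr// ltW.
have a0 : 0 < a by rewrite /a; lra.
have bb0 : 0 < beta ^+ 2 by rewrite exprn_gt0.
have b0 : 0 < b by rewrite divr_gt0.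
have bbeta : b * beta ^+ 2 = y by rewrite /b divfK ?gt_eqF.
pose A := fix A t := if t is t'.+1 then slab_update a b (A t') (z t') else r^-1%:M.
have pA t : posdef (A t).
  elim: t => [|t IH] /=; last exact: posdef_slab_update (ltW b0) IH.
  split=> [|v v0]; first by rewrite tr_scalar_mx.
  rewrite /qform mul_mx_scalar -scalemxAl mxE -/(dotmx v v) mulr_gt0 ?invr_gt0//.
  rewrite dotmxE lt0r sumr_ge0 ?andbT; last by move=> i _; rewrite -expr2 sqr_ge0.
  rewrite psumr_eq0; last by move=> i _; rewrite -expr2 sqr_ge0.
  apply: contra v0 => /allP v0; apply/eqP/matrixP => i j; rewrite (ord1 i) mxE.
  by have /implyP/(_ isT) := v0 j (mem_index_enum _); rewrite mulf_eq0 orbb => /eqP.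
(* [x t] lies in the slabs of all earlier rounds, so no update made before round [t] pushes it out
   of the unit ball. *)
have qA t u : (u <= t < N)%N -> qform (A u) (x t) <= 1.
  move=> /andP[ut tN]; elim: u ut => [|u IH] ut /=.
    rewrite /qform mul_mx_scalar -scalemxAl mxE -/(dotmx _ _) mulrC.
    by rewrite ler_pdivrMr// mul1r xr.
  rewrite qform_slab_update.
  have -> : 1 = a * 1 + b * beta ^+ 2 by rewrite bbeta /a; lra.
  apply: lerD; first by rewrite ler_pM2l// IH// ltnW.
  rewrite ler_pM2l// -[leLHS]real_normK ?num_real//.
  by rewrite lerXn2r ?nnegrE ?normr_ge0 ?(ltW beta0)// xzu// ut.
(* As [a + y = 1], an update is a convex combination of matrices with entries at most [M], so the
   determinant is bounded independently of [N]. *)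
have eA t : (t <= N)%N -> forall i j, `|A t i j| <= M.
  elim: t => [_|t IH tN] i j /=.
    rewrite !mxE; case: (i == j); last by rewrite normr0 (le_trans _ rM)// invr_ge0 ltW.
    by rewrite mulr1n gtr0_norm ?invr_gt0.
  rewrite !mxE big_ord_recl big_ord0 addr0 mxE.
  apply: le_trans (ler_normD _ _) _.
  rewrite (normrM a) (normrM b) (gtr0_norm a0) (gtr0_norm b0) normrM.
  have -> : M = a * M + y * M by rewrite /a; lra.
  apply: lerD; first by rewrite ler_pM2l// IH// ltnW.
  apply: le_trans (_ : y * (B ^+ 2 / beta ^+ 2) <= _); last by rewrite ler_pM2l.
  have -> : y * (B ^+ 2 / beta ^+ 2) = b * B ^+ 2 by rewrite mulrA mulrAC.
  by rewrite ler_pM2l// expr2 ler_pM// zB.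
have dA t : (t <= N)%N -> (17 / 16) ^+ t * r^-1 ^+ m <= \det (A t).
  elim: t => [_|t IH tN]; first by rewrite expr0 mul1r det_scalar.
  rewrite /= det_slab_update// exprS -mulrA.
  have d0 : 0 <= \det (A t).
    by apply: le_trans (IH (ltnW tN)); rewrite mulr_ge0 ?exprn_ge0 ?invr_ge0 ?(ltW r0)//; lra.
  (* Since [qform A (x t) <= 1], Cauchy-Schwarz turns the overshoot of [x t] into a lower bound on
     the dual form at [z t], the quantity in [det_slab_update]. *)
  have zz : 9 / 4 * m%:R * beta ^+ 2 <= qform (invmx (A t)) (z t).
    apply: le_trans (xzt t tN) _; apply: le_trans (posdef_CauchySchwarz _ _ (pA t)) _.
    rewrite ler_piMl ?qA ?leqnn//.
    by rewrite -qform_invmx// posdef_ge0.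
  apply: le_trans (_ : 17 / 16 * \det (A t) <= _).
    by apply: ler_wpM2l; [rewrite divr_ge0|exact: IH (ltnW tN)].
  rewrite [leRHS]mulrAC; apply: (ler_wpM2r d0).
  apply: le_trans (growth_factor m0 ym) _; rewrite -/a.
  rewrite ler_pM2l ?exprn_gt0// lerD2l.
  apply: le_trans (_ : b / a * (9 / 4 * m%:R * beta ^+ 2) <= _); last first.
    by apply: ler_wpM2l zz; exact/ltW/divr_gt0.
  have -> : b / a * (9 / 4 * m%:R * beta ^+ 2) = 9 / 4 * (b * beta ^+ 2 * m%:R) / a by ring.
  rewrite bbeta ym ler_pM2r ?invr_gt0//; lra.
apply: le_trans (dA N (leqnn N)) _; apply: le_trans (ler_norm _) _.
exact/det_bound/eA.
Qed.
End potential.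

(** * Hoeffding's inequality *)

Lemma ge0_is_derive_ge (R : realType) (f df : R -> R) :
  (forall x : R, 0 <= x -> is_derive x (1 : R) f (df x)) ->
  (forall x : R, 0 <= x -> 0 <= df x) ->
  forall x : R, 0 <= x -> f 0 <= f x.
Proof.
move=> fdf df0 x x0; have [||c] := @MVT_segment R f df 0 x x0.
- by move=> y; rewrite in_itv/= => /andP[/ltW y0 _]; exact: fdf.
- apply: derivable_within_continuous => y; rewrite in_itv/= => /andP[y0 _].
  by have [] := fdf y y0.
- rewrite in_itv/= subr0 => /andP[c0 _] E.
  by rewrite -subr_ge0 E mulr_ge0// df0.
Qed.

Section hoeffding_scalar.
Variables (R : realType) (p : R).
Hypothesis p01 : 0 <= p <= 1.

Let s (h : R) : R := 1 - p + p * expR h.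

Let s_gt0 h : 0 < s h.
Proof.
have /andP[p0 p1] := p01; rewrite /s; have e0 := expR_gt0 h.
have [->|pn] := eqVneq p 0; first by rewrite mul0r addr0 subr0.
have : 0 < p * expR h by rewrite mulr_gt0// lt0r pn.
lra.
Qed.

Let ds (h : R) : is_derive h (1 : R) s (p * expR h).
Proof.
rewrite (_ : s = (cst (1 - p)) + (p \*: (expR : R -> R))); last exact/funext.
by apply: is_derive_eq; rewrite add0r.
Qed.

Let D (h : R) := h / 4 + p - 1 + (1 - p) * (s h)^-1.

Let dD (h : R) : is_derive h (1 : R) D (1 / 4 - (1 - p) * (p * expR h) / s h ^+ 2).
Proof.
have sn : s h != 0 by rewrite gt_eqF.
have dV := is_deriveV sn (ds h).
rewrite (_ : D = (4^-1 \*: (id : R -> R)) + cst (p - 1) + ((1 - p) \*: (fun x => (s x)^-1))).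
  apply: is_derive_eq; rewrite addr0 /GRing.scale/= mulr1 div1r.
  by congr (_ + _); rewrite mulNr mulrN mulrA mulrAC.
by apply/funext => x; rewrite /D /= mulrC addrA.
Qed.

(** The difference [f] of the logarithms vanishes at 0 together with its derivative [D], and [D'] is
    [1/4 - u v / (u + v)^2] with [u = 1 - p] and [v = p * expR h], hence nonnegative. *)
Lemma hoeffding_exp (h : R) : 0 <= h -> 1 - p + p * expR h <= expR (p * h + h ^+ 2 / 8).
Proof.
have /andP[p0 p1] := p01.
have D0 (x : R) : 0 <= x -> 0 <= D x.
  move=> x0; have <- : D 0 = 0.
    by rewrite /D /s expR0 mulr1 subrK invr1; ring.
  apply: (ge0_is_derive_ge (fun y _ => dD y)) => // y _.
  rewrite subr_ge0 ler_pdivrMr ?exprn_gt0// /s.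
  have := sqr_ge0 (1 - p - p * expR y); rewrite !expr2; nra.
pose f (x : R) := p * x + x ^+ 2 / 8 - ln (s x).
have df (x : R) : 0 <= x -> is_derive x (1 : R) f (D x).
  move=> _; have dl := is_derive1_ln (s_gt0 x).
  have dc := is_derive1_comp dl (ds x).
  rewrite (_ : f = p \*: (id : R -> R) + (8^-1 \*: ((id : R -> R) ^+ 2)) - (@ln R \o s)).
    apply: is_derive_eq; rewrite /GRing.scale/= /D /s; field.
    by rewrite -/(s x) gt_eqF.
  by apply/funext => y; rewrite /f/= [X in _ = _ + X - _]mulrC.
move=> h0; have := ge0_is_derive_ge df D0 h0.
rewrite /f {1}/s expR0 mulr1 subrK ln1 mulr0 expr0n/= mul0r addr0 subr0 subr_ge0.
by rewrite -ler_expR lnK// posrE.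
Qed.
End hoeffding_scalar.

(** * Integration of bounded measurable functions *)

Lemma measurable_le_set d (T : measurableType d) (R : realType) (f g : T -> R) :
  measurable_fun [set: T] f -> measurable_fun [set: T] g ->
  measurable [set x | f x <= g x].
Proof.
move=> mf mg; rewrite -[X in measurable X]setTI.
exact: measurable_fun_le.
Qed.

Section bounded_measurable.
Context d (T : measurableType d) (R : realType).
Implicit Types f g : T -> R.

(** Such functions are stable under the operations below and integrable for every measure of mass
    one, so real-valued integrals are computed without separate integrability conditions. *)
Definition bmeas f := measurable_fun [set: T] f /\ exists C, forall x, `|f x| <= C.

Lemma bmeasW f C : measurable_fun [set: T] f -> (forall x, `|f x| <= C) -> bmeas f.
Proof. by move=> mf fC; split=> //; exists C. Qed.

Lemma bmeas01 f : measurable_fun [set: T] f -> (forall x, 0 <= f x <= 1) -> bmeas f.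
Proof.
move=> mf f01; apply: (@bmeasW _ 1) => // x; have /andP[f0 f1] := f01 x.
by rewrite ger0_norm.
Qed.

Lemma bmeas_cst (c : R) : bmeas (fun=> c).
Proof. by apply: (@bmeasW _ `|c|). Qed.

Lemma bmeasD f g : bmeas f -> bmeas g -> bmeas (fun x => f x + g x).
Proof.
move=> [mf [C fC]] [mg [D gD]]; apply: (@bmeasW _ (C + D)).
  exact: measurable_funD.
by move=> x; apply: le_trans (ler_normD _ _) _; exact: lerD.
Qed.

Lemma bmeasM f g : bmeas f -> bmeas g -> bmeas (fun x => f x * g x).
Proof.
move=> [mf [C fC]] [mg [D gD]]; apply: (@bmeasW _ (C * D)).
  exact: measurable_funM.
by move=> x; rewrite normrM ler_pM.
Qed.

Lemma bmeasZ c f : bmeas f -> bmeas (fun x => c * f x).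
Proof. by move=> bf; apply: bmeasM => //; exact: bmeas_cst. Qed.

Lemma bmeasB f g : bmeas f -> bmeas g -> bmeas (fun x => f x - g x).
Proof.
move=> bf bg; have := bmeasD bf (bmeasZ (-1) bg).
by under [X in bmeas X -> _]eq_fun do rewrite mulN1r.
Qed.

Lemma bmeas_sum (I : Type) (s : seq I) (F : I -> T -> R) :
  (forall i, bmeas (F i)) -> bmeas (fun x => \sum_(i <- s) F i x).
Proof.
move=> bF; elim: s => [|i s IH].
  by under eq_fun do rewrite big_nil; exact: bmeas_cst.
by under eq_fun do rewrite big_cons; exact: bmeasD.
Qed.

Lemma bmeas_comp d' (U : measurableType d') (h : U -> T) f :
  bmeas f -> measurable_fun [set: U] h ->
  measurable_fun [set: U] (f \o h) /\ exists C, forall x, `|(f \o h) x| <= C.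
Proof.
move=> [mf [C fC]] mh; split; last by exists C => x /=.
exact: measurableT_comp.
Qed.
End bounded_measurable.

Section probability_integral.
Context d (T : measurableType d) (R : realType) (mu : {measure set T -> \bar R}).
Hypothesis mu1 : mu [set: T] = 1%E.
Implicit Types f g : T -> R.

Lemma bmeas_integrable f : bmeas f -> mu.-integrable [set: T] (EFin \o f).
Proof.
move=> [mf [C fC]]; apply: measurable_bounded_integrable => //.
  by rewrite mu1 ltry.
exists C; split; first by rewrite num_real.
by move=> M CM x _; exact: le_trans (fC x) (ltW CM).
Qed.

Lemma bmeas_EFin f : bmeas f -> (\int[mu]_x f x)%:E = (\int[mu]_x (f x)%:E)%E.
Proof.
move=> bf; rewrite /Rintegral fineK//.
exact: (integrable_fin_num _ (bmeas_integrable bf)).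
Qed.

Lemma bRintegralD f g : bmeas f -> bmeas g ->
  \int[mu]_x (f x + g x) = \int[mu]_x f x + \int[mu]_x g x.
Proof. by move=> bf bg; rewrite RintegralD//; exact: bmeas_integrable. Qed.

Lemma bRintegralB f g : bmeas f -> bmeas g ->
  \int[mu]_x (f x - g x) = \int[mu]_x f x - \int[mu]_x g x.
Proof. by move=> bf bg; rewrite RintegralB//; exact: bmeas_integrable. Qed.

Lemma bRintegralZ c f : bmeas f -> \int[mu]_x (c * f x) = c * \int[mu]_x f x.
Proof. by move=> bf; rewrite RintegralZl//; exact: bmeas_integrable. Qed.

Lemma bRintegral_cst c : \int[mu]_x (cst c x) = c.
Proof. by rewrite Rintegral_cst// mu1 mulr1. Qed.

Lemma bRintegral_sum (I : Type) (s : seq I) (F : I -> T -> R) :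
  (forall i, bmeas (F i)) ->
  \int[mu]_x (\sum_(i <- s) F i x) = \sum_(i <- s) \int[mu]_x F i x.
Proof.
move=> bF; elim: s => [|i s IH].
  by under eq_Rintegral do rewrite big_nil; rewrite big_nil bRintegral_cst.
under eq_Rintegral do rewrite big_cons.
by rewrite bRintegralD ?big_cons ?IH//; exact: bmeas_sum.
Qed.

Lemma bRintegral_le f g : bmeas f -> bmeas g -> (forall x, f x <= g x) ->
  \int[mu]_x f x <= \int[mu]_x g x.
Proof. by move=> bf bg fg; apply: le_Rintegral => //; exact: bmeas_integrable. Qed.

Lemma bRintegral_itv f a b : measurable_fun [set: T] f ->
  (forall x, a <= f x <= b) -> a <= \int[mu]_x f x <= b.
Proof.
move=> mf fab.
have bf : bmeas f.
  apply: (@bmeasW _ _ _ _ (`|a| + `|b|)) => // x; have /andP[fa fb] := fab x.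
  rewrite ler_norml; apply/andP; split.
    have := ler_norm (- a); have := normr_ge0 b; rewrite normrN; lra.
  have := ler_norm b; have := normr_ge0 a; lra.
rewrite -[X in X <= _ <= _]bRintegral_cst -[X in _ <= _ <= X]bRintegral_cst.
apply/andP; split; apply: bRintegral_le => //; do ?exact: bmeas_cst.
  by move=> x; have /andP[] := fab x.
by move=> x; have /andP[] := fab x.
Qed.

Lemma bRintegral_norm f C : measurable_fun [set: T] f ->
  (forall x, `|f x| <= C) -> `|\int[mu]_x f x| <= C.
Proof.
by move=> mf fC; rewrite ler_norml bRintegral_itv// => x; rewrite -ler_norml.
Qed.
End probability_integral.

Lemma ae_eq_Rintegral d (T : measurableType d) (R : realType)
    (mu : {measure set T -> \bar R}) (f g : T -> R) :
  measurable_fun [set: T] f -> measurable_fun [set: T] g ->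
  {ae mu, forall x, f x = g x} -> \int[mu]_x f x = \int[mu]_x g x.
Proof.
move=> mf mg fg; congr fine; apply: ae_eq_integral => //; do ?exact/measurable_EFinP.
by apply: filterS fg => x + _ /= => ->.
Qed.

(** Integration against compositions and mixtures of kernels is available for nonnegative
    integrands; a constant shift, which every law of mass one integrates to itself, carries it over
    to bounded ones. *)
Lemma bmeas_ge0_shift d' (T : measurableType d') (R : realType) (f : T -> R) : bmeas f ->
  exists C, [/\ bmeas (fun _ : T => C), bmeas (fun x => f x + C) & forall x, 0 <= f x + C].
Proof.
move=> bf; have [_ [C fC]] := bf; exists C; split; first exact: bmeas_cst.
- by apply: bmeasD => //; exact: bmeas_cst.
- by move=> x; have := fC x; rewrite ler_norml => /andP[]; lra.
Qed.

Lemma bmeas_kernel d1 d2 (X : measurableType d1) (Y : measurableType d2)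
  (R : realType) (k : R.-pker X ~> Y) (f : X * Y -> R) :
  bmeas f -> bmeas (fun x => \int[k x]_y f (x, y)).
Proof.
move=> bf.
have bfx x : bmeas (fun y => f (x, y)).
  by apply: bmeas_comp bf _; exact: measurable_pair1.
have [_ [D fD]] := bf; apply: (@bmeasW _ _ _ _ D); last first.
  by move=> x; apply: (bRintegral_norm (@prob_kernel _ _ _ _ _ k x)) => //; case: (bfx x).
have [C [bC bfC fC0]] := bmeas_ge0_shift bf.
rewrite (_ : (fun x => _) = fun x => fine (\int[k x]_y (f (x, y) + C)%:E)%E - C).
  apply: measurable_funB => //; apply: measurableT_comp => //.
  apply: (measurable_fun_integral_finite_kernel (fun z => (f z + C)%:E)).
    by move=> z; rewrite lee_fin.
  by apply/measurable_EFinP; case: bfC.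
apply/funext => x; rewrite -[fine _]/(\int[k x]_y (f (x, y) + C)).
have k1 := @prob_kernel _ _ _ _ _ k x.
rewrite bRintegralD//; last exact: bmeas_cst.
by rewrite (bRintegral_cst k1) addrK.
Qed.

Lemma bmeas_kernel_cst d1 d2 (X : measurableType d1) (Y : measurableType d2)
  (R : realType) (k : R.-pker X ~> Y) (f : Y -> R) :
  bmeas f -> bmeas (fun x => \int[k x]_y f y).
Proof.
move=> bf; apply: (bmeas_kernel k (f := f \o snd)).
by apply: bmeas_comp bf _; exact: measurable_snd.
Qed.

Section kernel_integral.
Context d1 d2 d3 (X : measurableType d1) (Y : measurableType d2)
  (Z : measurableType d3) (R : realType).

Lemma Rintegral_kbind (l : R.-pker X ~> Y) (k : R.-pker (X * Y) ~> Z) x (f : Z -> R) :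
  bmeas f ->
  \int[kbind l k x]_z f z = \int[l x]_y \int[k (x, y)]_z f z.
Proof.
move=> bf; have [C [bC bfC fC0]] := bmeas_ge0_shift bf.
have bki : bmeas (fun y => \int[k (x, y)]_z f z).
  apply: (bmeas_comp (bmeas_kernel_cst k bf)); exact: measurable_pair1.
have k1 z := @prob_kernel _ _ _ _ _ k z; have l1 := @prob_kernel _ _ _ _ _ l x.
have b1 := @prob_kernel _ _ _ _ _ (kbind l k) x.
apply: (@addIr _ C); apply: EFin_inj.
rewrite -[X in _ + X](bRintegral_cst b1) -(bRintegralD b1)// (bmeas_EFin b1 bfC).
rewrite -[X in _ = (_ + X)%:E](bRintegral_cst l1) -(bRintegralD l1)//; last exact: bmeas_cst.
rewrite (bmeas_EFin l1); last by apply: bmeasD => //; exact: bmeas_cst.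
rewrite [LHS]integral_kcomp; last 2 first.
- by move=> z; rewrite lee_fin.
- by apply/measurable_EFinP; case: bfC.
apply: eq_integral => y _; rewrite -(bmeas_EFin (k1 _) bfC) (bRintegralD (k1 _))//.
by rewrite (bRintegral_cst (k1 _)).
Qed.

Lemma Rintegral_dirac (g : X -> Y) (mg : measurable_fun [set: X] g) x (f : Y -> R) :
  measurable_fun [set: Y] f -> \int[(kdirac mg : R.-pker X ~> Y) x]_y f y = f (g x).
Proof.
move=> mf; rewrite /Rintegral /= integral_dirac ?diracT ?mul1e//.
exact/measurable_EFinP.
Qed.
End kernel_integral.

Lemma Rintegral_mix d1 d2 (X : measurableType d1) (Y : measurableType d2)
    (R : realType) n (c : simplex_fun X R n) (k : 'I_n -> R.-pker X ~> Y) x (f : Y -> R) :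
  bmeas f -> \int[mix c k x]_y f y = \sum_i c x i ord0 * \int[k i x]_y f y.
Proof.
move=> bf; have [C [bC bfC fC0]] := bmeas_ge0_shift bf.
have k1 i := @prob_kernel _ _ _ _ _ (k i) x; have m1 := @prob_kernel _ _ _ _ _ (mix c k) x.
apply: (@addIr _ C); apply: EFin_inj.
rewrite -[X in _ + X](bRintegral_cst m1) -(bRintegralD m1)// (bmeas_EFin m1 bfC).
pose m i : {measure set Y -> \bar R} :=
  mscale (NngNum (sfun_ge0 c x i)) (k i x).
rewrite (@eq_measure_integral _ _ _ _
  (msum (fun j => if insub j is Some i then m i else mzero) n)); last first.
  move=> A mA _; rewrite /mix /mix_fun /= /msum; apply: eq_bigr => i _.
  by rewrite valK.
rewrite ge0_integral_measure_sum//; last 2 first.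
- by move=> z _; rewrite lee_fin.
- by apply/measurable_EFinP; case: bfC.
rewrite -[X in _ + X]mul1r -(sfun_sum1 c x) mulr_suml -big_split/= -sumEFin.
apply: eq_bigr => i _; rewrite valK ge0_integral_mscale//; last 2 first.
- by apply/measurable_EFinP; case: bfC.
- by move=> z _; rewrite lee_fin.
by rewrite -mulrDr EFinM -[X in _ + X](bRintegral_cst (k1 i)) -(bRintegralD (k1 i))// (bmeas_EFin (k1 i) bfC).
Qed.

(** True for every [f]: when the integral is infinite or undefined, [fine] returns 0 on both
    sides. *)
Lemma RintegralN d (T : measurableType d) (R : realType) (mu : {measure set T -> \bar R})
    (f : T -> R) : \int[mu]_x (- f x) = - \int[mu]_x f x.
Proof.
have -> : \int[mu]_x (- f x) = fine (\int[mu]_x (- (f x)%:E)%E) by [].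
rewrite /Rintegral [in LHS]integralE [in RHS]integralE.
rewrite (@funeposN _ _ (EFin \o f)) (@funenegN _ _ (EFin \o f)).
move: (integral _ _ _) (integral _ _ _) => x y.
by case: x => [x| |]; case: y => [y| |] /=; rewrite ?oppr0// opprB.
Qed.

(** * Independent draws *)

Section iid_kernel.
Context dO dT (O : measurableType dO) (T : measurableType dT) (R : realType).
Variable q : R.-pker O ~> T.

Definition iid_cons m (x : O * T * m.-tuple T) : m.+1.-tuple T :=
  [tuple of x.1.2 :: x.2].

Lemma measurable_iid_cons m : measurable_fun [set: O * T * m.-tuple T] (@iid_cons m).
Proof.
apply: (@measurable_cons _ _ _ _ (fun x => x.1.2) _ snd); last exact: measurable_snd.
by apply: measurableT_comp => //; exact: measurable_fst.
Qed.

Lemma measurable_tuple_box k (C : 'I_k -> set T) :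
  (forall i, measurable (C i)) -> measurable [set t : k.-tuple T | forall i, C i (tnth t i)].
Proof.
move=> mC; rewrite (_ : [set _ | _] = \bigcap_(i in [set: 'I_k]) ((@tnth _ T ^~ i) @^-1` C i)).
  apply: fin_bigcap_measurable => // i _; rewrite -[X in measurable X]setTI.
  exact: measurable_tnth.
by apply/seteqP; split => t /= h i => [_|]; exact: h.
Qed.

(** Building the product law of [q w] from kernel compositions makes its dependence on [w]
    measurable by construction. *)
Fixpoint iidk m : R.-pker O ~> (m.-tuple T) :=
  match m with
  | 0 => kdirac (@measurable_cst _ _ O (0.-tuple T) setT [tuple])
  | m'.+1 => kbind q (kbind (kpre (iidk m') measurable_fst) (kdirac (@measurable_iid_cons m')))
  end.

Local Open Scope ereal_scope.

Lemma integral_iidkS m w (g : m.+1.-tuple T -> \bar R) :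
  (forall t, 0 <= g t) -> measurable_fun [set: _] g ->
  \int[iidk m.+1 w]_t g t = \int[q w]_x \int[iidk m w]_t g [tuple of x :: t].
Proof.
move=> g0 mg; rewrite [LHS]integral_kcomp//; apply: eq_integral => x _.
rewrite [LHS]integral_kcomp//=; apply: eq_integral => t _.
by rewrite integral_dirac// diracT mul1e.
Qed.

Lemma iidk_prod_le m w (f : T -> R) (c : R) : measurable_fun [set: T] f ->
  (forall x, 0 <= f x)%R -> (0 <= c)%R -> \int[q w]_x (f x)%:E <= c%:E ->
  \int[iidk m w]_t (\prod_(i < m) f (tnth t i))%:E <= (c ^+ m)%:E.
Proof.
move=> mf f0 c0 fc.
have mp k : measurable_fun [set: k.-tuple T] (fun t => (\prod_(i < k) f (tnth t i))%:E).
  apply/measurable_EFinP; apply: measurable_prod => i _.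
  by apply: measurableT_comp => //; exact: measurable_tnth.
elim: m => [|m IH].
  by rewrite integral_dirac//; [rewrite diracT mul1e big_ord0|exact: (mp 0%N)].
rewrite integral_iidkS//; last by move=> t; rewrite lee_fin prodr_ge0.
have -> : \int[q w]_x \int[iidk m w]_t
      (\prod_(i < m.+1) f (tnth [tuple of x :: t] i))%:E =
    \int[q w]_x ((f x)%:E * \int[iidk m w]_t (\prod_(i < m) f (tnth t i))%:E).
  apply: eq_integral => x _; rewrite -ge0_integralZl ?lee_fin//; last 2 first.
  - exact: (mp m).
  - by move=> t _; rewrite lee_fin prodr_ge0.
  apply: eq_integral => t _; rewrite big_ord_recl tnth0 EFinM.
  by under eq_bigr do rewrite tnthS.
rewrite ge0_integralZr//; last 3 first.
- exact/measurable_EFinP.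
- by move=> x _; rewrite lee_fin.
- by apply: integral_ge0 => t _; rewrite lee_fin prodr_ge0.
rewrite exprS EFinM lee_pmul//.
- by apply: integral_ge0 => x _; rewrite lee_fin.
- by apply: integral_ge0 => t _; rewrite lee_fin prodr_ge0.
Qed.

(** Identifies [iidk] with the product formula by which [fresh_draws] describes the samples. *)
Lemma iidk_box m w (B : 'I_m -> set T) : (forall i, measurable (B i)) ->
  iidk m w [set t | forall i, B i (tnth t i)] = (\prod_(i < m) fine (q w (B i)))%:E.
Proof.
elim: m B => [|m IH] B mB.
  by rewrite big_ord0 /= /kdirac diracE mem_set//= => -[].
set U := [set t | _]; have mU : measurable U by exact: measurable_tuple_box.
rewrite -[U]setIT -integral_indic// integral_iidkS; last 2 first.
- by move=> t; rewrite lee_fin.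
- exact/measurable_EFinP.
pose U' := [set t : m.-tuple T | forall i : 'I_m, B (lift ord0 i) (tnth t i)].
have mU' : measurable U' by apply: (@measurable_tuple_box m (fun i => B (lift ord0 i))).
have UE (x : T) (t : m.-tuple T) : \1_U [tuple of x :: t] = (\1_(B ord0) x * \1_U' t)%R :> R.
  rewrite !indicE -natrM mulnb; congr (_%:R); congr nat_of_bool.
  apply/idP/andP; rewrite !inE /U /U' /=.
    by move=> h; split=> [|i]; [exact: (h ord0)|have := h (lift ord0 i); rewrite tnthS].
  by move=> [h0 h] i; case: (unliftP ord0 i) => [j|] ->; rewrite ?tnthS// tnth0.
have step x : \int[iidk m w]_t (\1_U [tuple of x :: t])%:E =
    (\1_(B ord0) x)%:E * (\prod_(i < m) fine (q w (B (lift ord0 i))))%:E.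
  transitivity (\int[iidk m w]_t ((\1_(B ord0) x)%:E * (\1_U' t)%:E)).
    by apply: eq_integral => t _; rewrite UE EFinM.
  rewrite ge0_integralZl; [|exact: measurableT|exact/measurable_EFinP/measurable_indic|
    by move=> t _; rewrite lee_fin|by rewrite lee_fin].
  by rewrite integral_indic// setIT /U' (IH (fun i => B (lift ord0 i))) //.
under eq_integral do rewrite step.
rewrite ge0_integralZr; [|exact: measurableT|exact/measurable_EFinP/measurable_indic|
  by move=> x _; rewrite lee_fin|by rewrite lee_fin prodr_ge0// => i _; rewrite fine_ge0].
rewrite integral_indic// setIT big_ord_recl EFinM fineK//.
exact: (finite_kernel_measure q w).
Qed.
End iid_kernel.

(** * Hoeffding's lemma and the Chernoff bound for independent draws *)

Section hoeffding.
Context d (T : measurableType d) (R : realType) (mu : {measure set T -> \bar R}).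
Hypothesis mu1 : mu [set: T] = 1%E.

(** Below its chord on [[a, b]] the exponential integrates to that of a two-point law with weight
    [p = (m - a) / (b - a)] at [b], which is the case of [hoeffding_exp]. *)
Let hoeffding_bounded (f : T -> R) (a b lam : R) : measurable_fun [set: T] f ->
  (forall x, a <= f x <= b) -> a < b -> 0 <= lam ->
  \int[mu]_x expR (lam * (f x - \int[mu]_x f x)) <=
  expR (lam ^+ 2 * (b - a) ^+ 2 / 8).
Proof.
move=> mf fab ab lam0; set m := \int[mu]_x f x.
have w0 : 0 < b - a by rewrite subr_gt0.
have bf : bmeas f.
  apply: (@bmeasW _ _ _ _ (`|a| + `|b|)) => // x; have /andP[fa fb] := fab x.
  rewrite ler_norml; apply/andP; split.
    have := ler_norm (- a); have := normr_ge0 b; rewrite normrN; lra.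
  have := ler_norm b; have := normr_ge0 a; lra.
have /andP[am mb] : a <= m <= b by exact: bRintegral_itv.
pose p := (m - a) / (b - a).
have p01 : 0 <= p <= 1.
  apply/andP; split; first by rewrite /p divr_ge0//; lra.
  by rewrite /p ler_pdivrMr// mul1r; lra.
pose ea := expR (lam * (a - m)); pose eb := expR (lam * (b - m)).
have convex x : expR (lam * (f x - m)) <=
    (ea * b - eb * a) / (b - a) + (eb - ea) / (b - a) * f x.
  have /andP[fa fb] := fab x.
  set y := lam * (f x - m).
  (* Convexity from tangent lines: the tangent at [y] lies below the exponential at both endpoints,
     and weights [b - f x] and [f x - a] cancel the linear terms. *)
  have ha : expR y * (1 + lam * (a - f x)) <= ea.
    rewrite /ea (_ : lam * (a - m) = y + lam * (a - f x)); last by rewrite /y; ring.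
    by rewrite expRD ler_pM2l ?expR_gt0// expR_ge1Dx.
  have hb : expR y * (1 + lam * (b - f x)) <= eb.
    rewrite /eb (_ : lam * (b - m) = y + lam * (b - f x)); last by rewrite /y; ring.
    by rewrite expRD ler_pM2l ?expR_gt0// expR_ge1Dx.
  rewrite mulrAC -mulrDl ler_pdivlMr//.
  have h1 : (b - f x) * (expR y * (1 + lam * (a - f x))) <= (b - f x) * ea.
    by rewrite ler_wpM2l// subr_ge0.
  have h2 : (f x - a) * (expR y * (1 + lam * (b - f x))) <= (f x - a) * eb.
    by rewrite ler_wpM2l// subr_ge0.
  have := lerD h1 h2; set e := expR y.
  rewrite [X in X <= _ -> _](_ : _ = e * (b - a)); last by ring.
  by rewrite [X in _ <= X -> _](_ : _ = ea * b - eb * a + (eb - ea) * f x)//; ring.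
have mexp : measurable_fun [set: T] (fun x => expR (lam * (f x - m))).
  apply: measurableT_comp => //; apply: measurable_funM => //.
  exact: measurable_funB.
apply: le_trans (_ : \int[mu]_x ((ea * b - eb * a) / (b - a) + (eb - ea) / (b - a) * f x) <= _).
  apply: bRintegral_le => //.
  - apply: (@bmeasW _ _ _ _ (expR (lam * (b - m)))) => // x.
    rewrite ger0_norm ?expR_ge0// ler_expR ler_wpM2l//.
    by have /andP[] := fab x; lra.
  - by apply: bmeasD; [exact: bmeas_cst|exact: bmeasZ].
rewrite (bRintegralD mu1); [|exact: bmeas_cst|exact: bmeasZ].
rewrite (bRintegral_cst mu1) (bRintegralZ mu1)// -/m.
have wn : b - a != 0 by rewrite gt_eqF.
have -> : (ea * b - eb * a) / (b - a) + (eb - ea) / (b - a) * m =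
    ea * (1 - p + p * expR (lam * (b - a))).
  have -> : eb = ea * expR (lam * (b - a)).
    by rewrite /eb /ea -expRD; congr expR; ring.
  by rewrite /p; field.
apply: le_trans (ler_wpM2l (expR_ge0 _) (hoeffding_exp p01 _)) _.
  by rewrite mulr_ge0// ltW.
rewrite -expRD ler_expR /p exprMn le_eqVlt; apply/orP; left; apply/eqP.
by field.
Qed.

(** Rewards are bounded only almost surely; truncating [f] to [[a, b]] changes it on a null set and
    leaves both integrals alone. *)
Lemma hoeffding_lemma (f : T -> R) (a b lam : R) : measurable_fun [set: T] f ->
  {ae mu, forall x, a <= f x <= b} -> a < b -> 0 <= lam ->
  (\int[mu]_x (expR (lam * (f x - \int[mu]_x f x)))%:E <=
  (expR (lam ^+ 2 * (b - a) ^+ 2 / 8))%:E)%E.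
Proof.
move=> mf fab ab lam0.
pose g x := Num.max a (Num.min (f x) b).
have mg : measurable_fun [set: T] g.
  by apply: measurable_maxr => //; exact: measurable_minr.
have gab x : a <= g x <= b.
  by rewrite /g le_max lexx/= ge_max ge_min lexx orbT andbT ltW.
have fg : {ae mu, forall x, f x = g x}.
  apply: filterS fab => x /andP[af fb].
  by rewrite /g min_l// max_r.
have mexp (h : T -> R) c : measurable_fun [set: T] h ->
    measurable_fun [set: T] (fun x => (expR (lam * (h x - c)))%:E).
  move=> mh; apply/measurable_EFinP; apply: measurableT_comp => //.
  apply: measurable_funM => //; exact: measurable_funB.
rewrite (ae_eq_Rintegral mf mg fg).
rewrite (ae_eq_integral (fun x => (expR (lam * (g x - \int[mu]_x g x)))%:E))//.
- rewrite -(bmeas_EFin mu1).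
    by rewrite lee_fin; exact: hoeffding_bounded.
  apply: (@bmeasW _ _ _ _ (expR (lam * (b - \int[mu]_x g x)))).
    by apply/measurable_EFinP; exact: mexp.
  move=> x; rewrite ger0_norm ?expR_ge0// ler_expR ler_wpM2l// lerB//.
  by have /andP[] := gab x.
- exact: mexp.
- exact: mexp.
- by apply: filterS fg => x + _ /= => ->.
Qed.
End hoeffding.

(** [mean] is only an upper bound for the expectation, because the residual of [Wst] has a
    controlled bias rather than a known mean. *)
Lemma iidk_hoeffding dO dT (O : measurableType dO) (T : measurableType dT)
    (R : realType) (q : R.-pker O ~> T) (w : O) m (f : T -> R) (a b mean t : R) :
  measurable_fun [set: T] f -> {ae q w, forall x, a <= f x <= b} -> a < b ->
  0 <= t -> \int[q w]_x f x <= mean ->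
  (iidk q m w [set tau | (m%:R * (mean + t) <= \sum_(i < m) f (tnth tau i))%R] <=
   (expR (- (2 * m%:R * t ^+ 2 / (b - a) ^+ 2)))%:E)%E.
Proof.
move=> mf fab ab t0 fmean; set U := [set tau | _].
have mS : measurable_fun [set: m.-tuple T] (fun tau => \sum_(i < m) f (tnth tau i)).
  apply: measurable_sum => i; apply: measurableT_comp => //; exact: measurable_tnth.
have mU : measurable U by apply: measurable_le_set => //; exact: measurable_cst.
have w0 : 0 < b - a by rewrite subr_gt0.
set m0 := \int[q w]_x f x in fmean.
(* The minimiser of [lam^2 (b - a)^2 / 8 - lam t]. *)
pose lam := 4 * t / (b - a) ^+ 2.
have lam0 : 0 <= lam by rewrite divr_ge0 ?exprn_ge0 ?(ltW w0)// mulr_ge0.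
pose g x := expR (lam * (f x - m0) - lam * t).
have mg : measurable_fun [set: T] g.
  apply: measurableT_comp => //; apply: measurable_funB => //.
  apply: measurable_funM => //; exact: measurable_funB.
pose c := expR (lam ^+ 2 * (b - a) ^+ 2 / 8 - lam * t).
have gc : (\int[q w]_x (g x)%:E <= c%:E)%E.
  under eq_integral do rewrite /g expRD EFinM.
  rewrite ge0_integralZr; [|exact: measurableT| |by move=> x _; rewrite lee_fin expR_ge0|
    by rewrite lee_fin expR_ge0].
    rewrite /c expRD EFinM lee_wpmul2r ?lee_fin ?expR_ge0//.
    apply: hoeffding_lemma => //; exact: prob_kernel.
  apply/measurable_EFinP; apply: measurableT_comp => //.
  apply: measurable_funM => //; exact: measurable_funB.
have := iidk_prod_le m mg (fun x => expR_ge0 _) (expR_ge0 _) gc.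
have -> : c ^+ m = expR (- (2 * m%:R * t ^+ 2 / (b - a) ^+ 2)).
  rewrite /c -expRM_natl; congr expR; rewrite /lam; field.
  by rewrite gt_eqF.
apply: le_trans; rewrite -[U]setIT -integral_indic//.
apply: ge0_le_integral; [exact: measurableT|by move=> x _; rewrite lee_fin|
  exact/measurable_EFinP/measurable_indic| | ].
  apply/measurable_EFinP; apply: measurable_prod => i _.
  by apply: measurableT_comp => //; exact: measurable_tnth.
move=> tau _; rewrite lee_fin indicE.
have [|] := boolP (tau \in U); last by move=> _; rewrite prodr_ge0// => i _; exact: expR_ge0.
rewrite inE /U /= => hU; rewrite /g -expR_sum -[1]expR0 ler_expR.
have -> : \sum_(i < m) (lam * (f (tnth tau i) - m0) - lam * t) =
    lam * (\sum_(i < m) f (tnth tau i) - \sum_(i < m) (m0 + t)).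
  by rewrite -sumrB mulr_sumr; apply: eq_bigr => i _; ring.
rewrite sumr_const card_ord -mulr_natl mulr_ge0// subr_ge0.
by apply: le_trans hU; rewrite ler_wpM2l// lerD2r.
Qed.

(** * From the product formula on boxes to conditional laws *)

Section disintegration.
Context dO dT (Omega : measurableType dO) (T : measurableType dT) (R : realType).
Variables (P : probability Omega R) (F : set (set Omega)) (D : set Omega).
Hypotheses (sF : sigma_algebra setT F) (Fm : F `<=` measurable).
Let O := g_sigma_algebraType F.
Variables (q : R.-pker O ~> T) (m : nat) (tau : 'I_m -> Omega -> T).
Hypothesis mtau : forall i, measurable_fun [set: Omega] (tau i).
Hypothesis fresh : forall (E : set Omega) (B : 'I_m -> set T),
  F E -> E `<=` D -> (forall i, measurable (B i)) ->
  P (E `&` \bigcap_i (tau i @^-1` B i)) =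
  (\int[P]_(w in E) (\prod_(i < m) fine (q w (B i)))%:E)%E.

Lemma measurable_sub_sigma d' (U : measurableType d') (f : Omega -> U) :
  measurable_fun [set: O] (f : O -> U) -> measurable_fun [set: Omega] f.
Proof.
move=> mf _ B mB; apply: Fm; rewrite -(sigma_algebra_id sF).
exact: mf.
Qed.

Let box (E : set Omega) (B : 'I_m -> set T) : set (O * m.-tuple T) :=
  [set z | E z.1 /\ forall i, B i (tnth z.2 i)].
Let boxes := [set C | exists E B,
  [/\ F E, forall i, measurable (B i) & C = box E B]].

Let FO (E : set Omega) : F E -> measurable (E : set O).
Proof. exact: sub_sigma_algebra. Qed.

Let measurable_box E B : F E -> (forall i, measurable (B i)) -> measurable (box E B).
Proof.
move=> FE mB; rewrite (_ : box E B = (fst @^-1` (E : set O)) `&`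
    (snd @^-1` [set t | forall i, B i (tnth t i)]))//.
apply: measurableI; rewrite -[X in measurable X]setTI.
  by apply: measurable_fst => //; exact: FO.
by apply: measurable_snd => //; exact: measurable_tuple_box.
Qed.

Let boxes_generate : measurable = <<s boxes >>.
Proof.
apply/seteqP; split; last first.
  apply: smallest_sub; first exact: sigma_algebra_measurable.
  by move=> _ [E [B [FE mB ->]]]; exact: measurable_box.
have FT : F setT by have [F0 FC _] := sF; have := FC _ F0; rewrite setD0.
have mid : measurable_fun [set: g_sigma_algebraType boxes]
    (id : g_sigma_algebraType boxes -> O * m.-tuple T).
  apply/measurable_fun_pairP; split.
    move=> _ E mE; rewrite setTI; apply: sub_sigma_algebra.
    exists E, (fun=> setT); split => //; first by rewrite -(sigma_algebra_id sF).
    by apply/seteqP; split => z //= [].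
  apply/measurable_fun_tnthP => i _ B mB; rewrite setTI; apply: sub_sigma_algebra.
  exists setT, (fun j => if j == i then B else setT); split => //.
    by move=> j; case: ifP.
  apply/seteqP; split => z /= => [Bz|[_ /(_ i)]]; last by rewrite eqxx.
  by split => // j; case: eqP => // ->.
by move=> C mC; have := mid measurableT C mC; rewrite setTI.
Qed.

Let boxes_setI : setI_closed boxes.
Proof.
move=> _ _ [E [B [FE mB ->]]] [E' [B' [FE' mB' ->]]].
exists (E `&` E'), (fun i => B i `&` B' i); split.
- rewrite -(sigma_algebra_id sF); apply: (@measurableI _ O); exact: FO.
- by move=> i; exact: measurableI.
- apply/seteqP; split => z /=.
    by move=> [[Ez Bz] [E'z B'z]]; split => // i; split.
  by move=> [[Ez E'z] BB']; do 2 split => //; move=> i; have [] := BB' i.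
Qed.

Definition joint (w : Omega) : O * m.-tuple T := (w, [tuple tau i w | i < m]).

Lemma measurable_joint (C : set (O * m.-tuple T)) :
  measurable C -> measurable (joint @^-1` C).
Proof.
suff mj : measurable_fun [set: Omega] joint.
  by move=> mC; rewrite -[X in measurable X]setTI; exact: mj.
apply/measurable_fun_pairP; split.
  by move=> _ E mE; rewrite setTI; apply: Fm; rewrite -(sigma_algebra_id sF).
apply/measurable_fun_tnthP => i; rewrite (_ : _ \o _ = tau i)//.
by apply/funext => w /=; rewrite tnth_mktuple.
Qed.

Let mE (E : set Omega) : F E -> measurable E. Proof. exact: Fm. Qed.

Let msection (E : set Omega) (C : set (O * m.-tuple T)) : measurable C ->
  measurable_fun E (fun w => iidk q m w (xsection C w)).
Proof.
move=> mC; apply: measurable_funTS; apply: measurable_sub_sigma.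
exact: (measurable_fun_xsection_finite_kernel (iidk q m) (mem_set mC)).
Qed.

Let disintegration_boxes (E : set Omega) : F E -> E `<=` D -> boxes `<=`
  [set C | P (E `&` joint @^-1` C) = (\int[P]_(w in E) iidk q m w (xsection C w))%E].
Proof.
move=> FE ED _ [E' [B [FE' mB ->]]] /=.
have -> : E `&` joint @^-1` box E' B = (E `&` E') `&` \bigcap_i (tau i @^-1` B i).
  apply/seteqP; split => w /=.
    by move=> [Ew [E'w Bw]]; split => // i _ /=; have := Bw i; rewrite tnth_mktuple.
  by move=> [[Ew E'w] Bw]; do 2 split => //; move=> i; rewrite tnth_mktuple; exact: Bw.
rewrite fresh//; first last.
- by move=> w [/ED].
- rewrite -(sigma_algebra_id sF); apply: (@measurableI _ O); exact: FO.
rewrite integral_mkcondr; apply: eq_integral => w _; rewrite patchE.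
case: ifPn => wE'.
  rewrite -iidk_box//; congr (iidk q m w _); apply/seteqP; split => t /=.
    by move=> h; apply/xsectionP; split => //=; rewrite inE in wE'.
  by move=> /xsectionP[].
rewrite (_ : xsection _ w = set0) ?measure0//.
by rewrite -subset0 => t /xsectionP[/= ?]; rewrite notin_setE in wE'.
Qed.

(** Boxes generate the product sigma-algebra and are closed under intersection, so Dynkin induction
    extends the freshness formula. The section of [C] at [w] carries the dependence of the tested
    event on the past. *)
Lemma disintegration (E : set Omega) (C : set (O * m.-tuple T)) :
  F E -> E `<=` D -> measurable C ->
  P (E `&` joint @^-1` C) = (\int[P]_(w in E) iidk q m w (xsection C w))%E.
Proof.
move=> FE ED; rewrite boxes_generate; move: C.
have mEE := mE FE.
have iT : P E = (\int[P]_(w in E) iidk q m w setT)%E.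
  by under eq_integral do rewrite prob_kernel; rewrite integral_cst// mul1e.
have fin1 A : measurable A -> P A \is a fin_num by move=> mA; exact: fin_num_measure.
apply: (dynkin_induction boxes_generate boxes_setI).
- rewrite preimage_setT setIT [LHS]iT; apply: eq_integral => w _.
  by congr (iidk q m w _); apply/seteqP; split => // t _; exact/xsectionP.
- exact: disintegration_boxes.
- move=> S mS PS.
  have mJ := measurable_joint mS.
  have PE : (P E = P (E `&` joint @^-1` (~` S)) + P (E `&` joint @^-1` S))%E.
    rewrite -measureU; [|exact/measurableI/measurable_joint/measurableC|exact: measurableI|].
      by rewrite -setIUr -preimage_setU setUC setUv preimage_setT setIT.
    by rewrite setIACA -preimage_setI setICl; rewrite ?preimage_set0 setI0.
  have fS : P (E `&` joint @^-1` S) \is a fin_num by apply: fin1; exact: measurableI.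
  rewrite -[LHS](addeK _ fS) -[RHS](addeK _ fS); congr (_ - _)%E.
  rewrite -PE PS -ge0_integralD//; [|exact/msection/measurableC|exact: msection].
  rewrite iT; apply: eq_integral => w _.
  rewrite -measureU; [|exact/measurable_xsection/measurableC|exact: measurable_xsection|].
    by rewrite xsectionE xsectionE -preimage_setU setUC setUv preimage_setT.
  by rewrite !xsectionE -preimage_setI setICl. 
- move=> C mC tC PC; rewrite preimage_bigcup setI_bigcupr.
  rewrite measure_semi_bigcup; last first.
  + by apply: bigcup_measurable => k _; apply: measurableI => //; exact: measurable_joint.
  + move=> i j _ _ [w [[_ Ci] [_ Cj]]]; apply: (tC i j) => //.
    by exists (joint w).
  + by move=> k; apply: measurableI => //; exact: measurable_joint.
  rewrite (eq_eseriesr (fun k _ => PC k)).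
  rewrite -integral_nneseries//; last by move=> k; exact: msection.
  apply: eq_integral => w _; rewrite xsection_bigcup measure_semi_bigcup//.
  + by move=> k; exact: measurable_xsection.
  + exact: trivIset_xsection.
  + by apply: bigcup_measurable => k _; exact: measurable_xsection.
Qed.
Section fresh_hoeffding.
Variables (f : O * T -> R) (mean : O -> R) (t : R).
Hypotheses (mf : measurable_fun [set: O * T] f) (mmean : measurable_fun [set: O] mean).

Let bad : set (O * m.-tuple T) :=
  [set z | m%:R * (mean z.1 + t) <= \sum_(i < m) f (z.1, tnth z.2 i)].

Let mbad : measurable bad.
Proof.
apply: measurable_le_set.
  apply: measurable_funM => //; apply: measurable_funD => //.
  by apply: measurableT_comp => //; exact: measurable_fst.
apply: measurable_sum => i; apply: measurableT_comp => //.
apply/measurable_fun_pairP; split; first exact: measurable_fst.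
by apply: (measurableT_comp (measurable_tnth i)); exact: measurable_snd.
Qed.

Let badE : [set w : Omega | m%:R * (mean w + t) <= \sum_(i < m) f (w, tau i w)] = joint @^-1` bad.
Proof.
apply/seteqP; split => w /=; rewrite /bad /=;
  by under [X in _ -> _ <= X]eq_bigr do rewrite ?tnth_mktuple;
     under [X in _ <= X -> _]eq_bigr do rewrite ?tnth_mktuple.
Qed.

Lemma measurable_deviation :
  measurable [set w : Omega | m%:R * (mean w + t) <= \sum_(i < m) f (w, tau i w)].
Proof. by rewrite badE; exact: measurable_joint. Qed.

(** In the section at [w], both [f (w, _)] and [mean w] are frozen, so Hoeffding's inequality for a
    fixed function applies with a bound uniform in [w]. *)
Lemma fresh_hoeffding (E : set Omega) (a b : R) : F E -> E `<=` D -> a < b -> 0 <= t ->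
  (forall w, E w -> {ae q w, forall x, a <= f (w, x) <= b}) ->
  (forall w, E w -> \int[q w]_x f (w, x) <= mean w) ->
  (P (E `&` [set w : Omega | (m%:R * (mean w + t) <= \sum_(i < m) f (w, tau i w))%R]) <=
   (expR (- (2 * m%:R * t ^+ 2 / (b - a) ^+ 2)))%:E)%E.
Proof.
move=> FE ED ab t0 fab fmean; rewrite badE disintegration//.
set c := expR _.
apply: (@le_trans _ _ (\int[P]_(w in E) c%:E)%E).
  apply: ge0_le_integral => //; [exact: mE|exact: msection|].
  move=> w Ew.
  rewrite (_ : xsection bad w =
      [set t0 | (m%:R * (mean w + t) <= \sum_(i < m) f (w, tnth t0 i))%R]).
    apply: (@iidk_hoeffding _ _ _ _ _ q w m (fun x => f (w, x))) => //; [|exact: fab|exact: fmean].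
    by apply: measurableT_comp mf _; exact: measurable_pair1.
  by apply/seteqP; split => u hu; [move/xsectionP: hu|apply/xsectionP].
rewrite integral_cst; last exact: mE.
by rewrite -[leRHS]mule1 lee_wpmul2l ?lee_fin ?expR_ge0// probability_le1//; exact: mE.
Qed.
End fresh_hoeffding.
End disintegration.

(** * Trajectories and values *)

(** Rewards lie in [[0, 1]] only almost surely. Clipping makes the integrands bounded everywhere and
    changes no integral against a law of rewards. *)
Definition clip01 (R : realType) (r : R) : R := Num.max 0 (Num.min r 1).

Section clip.
Variable R : realType.
Implicit Type r : R.

Lemma clip01_itv r : 0 <= clip01 r <= 1.
Proof. by rewrite /clip01 le_max lexx/= ge_max ler01 ge_min lexx orbT. Qed.

Lemma clip01_id r : 0 <= r <= 1 -> clip01 r = r.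
Proof. by case/andP=> r0 r1; rewrite /clip01 min_l// max_r. Qed.

Lemma measurable_clip01 d (T : measurableType d) (f : T -> R) :
  measurable_fun [set: T] f -> measurable_fun [set: T] (fun x => clip01 (f x)).
Proof. by move=> mf; apply: measurable_maxr => //; exact: measurable_minr. Qed.

Lemma bmeas_clip01 d (T : measurableType d) (f : T -> R) :
  measurable_fun [set: T] f -> bmeas (fun x => clip01 (f x)).
Proof. by move=> mf; apply: bmeas01 => [|x]; [exact: measurable_clip01|exact: clip01_itv]. Qed.
End clip.

Lemma bmeas_indic d (T : measurableType d) (R : realType) (A : set T) :
  measurable A -> bmeas (\1_A : T -> R).
Proof.
move=> mA; apply: bmeas01; first exact: measurable_indic.
by move=> x; rewrite indicE; case: (x \in A); rewrite ?lexx ler01.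
Qed.

Lemma prob1_ae d (T : measurableType d) (R : realType) (mu : {measure set T -> \bar R})
    (A : set T) : mu [set: T] = 1%E -> measurable A -> \int[mu]_x \1_A x = 1 :> R ->
  {ae mu, forall x, A x}.
Proof.
move=> mu1 mA A1; exists (~` A); split; [exact: measurableC| |by []].
have muA : mu A = 1%E.
  rewrite -[in RHS]A1 (bmeas_EFin mu1); last exact: bmeas_indic.
  by rewrite integral_indic// setIT.
have : mu (A `|` ~` A) = (mu A + mu (~` A))%E.
  by rewrite measureU ?setICr//; exact: measurableC.
rewrite setUCr mu1 muA; case: (mu (~` A)) => [r| |]// [r0].
by congr (_%:E); lra.
Qed.

Lemma measurable_itv01 (R : realType) :
  measurable ([set r | 0 <= r <= 1] : set (measurableTypeR R)).
Proof.
rewrite (_ : [set r | _] = [set r : measurableTypeR R | 0 <= r] `&` [set r | r <= 1]).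
  by apply: measurableI; apply: measurable_le_set => //; exact: measurable_id.
by apply/seteqP; split => z /= /andP.
Qed.

Section trajectories.
Context dS dA (S : measurableType dS) (A : measurableType dA) (R : realType).
Local Notation step := (step S A R).
Implicit Types (M : mdp S A R) (pi : policy S A).

Lemma measurable_reward_of : measurable_fun [set: step] (@reward_of _ _ S A R).
Proof. exact: measurable_snd. Qed.

Definition mean_reward M (x : S * A) : R := \int[rew M x]_r clip01 r.

Lemma mean_reward_itv M x : 0 <= mean_reward M x <= 1.
Proof.
apply: bRintegral_itv; first exact: prob_kernel.
  exact: measurable_clip01 (@measurable_id _ _ _).
by move=> r; exact: clip01_itv.
Qed.

Lemma bmeas_mean_reward M : bmeas (mean_reward M).
Proof. by apply: bmeas_kernel_cst; exact: bmeas_clip01 (@measurable_id _ _ _). Qed.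

Lemma Rintegral_traj M pi m h s (g : m.+1.-tuple step -> R) : bmeas g ->
  \int[traj_from M pi m.+1 h s]_t g t =
  \int[rew M (act pi h s)]_r \int[trans M (act pi h s)]_s'
    \int[traj_from M pi m h.+1 s']_t g [tuple of (act pi h s, r) :: t].
Proof.
move=> bg; rewrite Rintegral_kbind//; apply: eq_Rintegral => r _.
rewrite Rintegral_kbind//; apply: eq_Rintegral => s' _.
rewrite Rintegral_kbind//; apply: eq_Rintegral => t _.
by rewrite Rintegral_dirac//; case: bg.
Qed.

Section additive_cost.
Variables (M : mdp S A R) (pi : policy S A) (c : nat -> step -> R).
Hypothesis bc : forall h, bmeas (c h).

(** The index [h + i] is the absolute step number. Total rewards and residuals are both, almost
    surely, costs of this form, so one recursion [mean_costS] yields the Bellman equation and the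
    telescoping of residuals. *)
Definition cost m h (t : m.-tuple step) : R := \sum_(i < m) c (h + i) (tnth t i).

Definition mean_cost m h (s : S) : R := \int[traj_from M pi m h s]_t cost h t.

Lemma bmeas_cost m h : bmeas (@cost m h).
Proof.
apply: bmeas_sum => i; apply: (bmeas_comp (bc _)); exact: measurable_tnth.
Qed.

Lemma bmeas_mean_cost m h : bmeas (mean_cost m h).
Proof. exact: (bmeas_kernel_cst (traj_from M pi m h) (@bmeas_cost m h)). Qed.

Lemma mean_cost0 h s : mean_cost 0 h s = 0.
Proof.
rewrite /mean_cost /cost; under eq_Rintegral do rewrite big_ord0.
by apply: bRintegral_cst; exact: (@prob_kernel _ _ _ _ _ (traj_from M pi 0 h) s).
Qed.

Lemma mean_costS m h s : mean_cost m.+1 h s =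
  \int[rew M (act pi h s)]_r c h (act pi h s, r) +
  \int[trans M (act pi h s)]_s' mean_cost m h.+1 s'.
Proof.
rewrite /mean_cost Rintegral_traj; last exact: bmeas_cost.
set x := act pi h s.
have brc : bmeas (fun r => c h (x, r)).
  by apply: (bmeas_comp (bc h)); exact: measurable_pair1.
have bm := bmeas_mean_cost m h.+1.
transitivity (\int[rew M x]_r (c h (x, r) + \int[trans M x]_s' mean_cost m h.+1 s')).
  apply: eq_Rintegral => r _.
  transitivity (\int[trans M x]_s' (c h (x, r) + mean_cost m h.+1 s')).
    apply: eq_Rintegral => s' _.
    transitivity (\int[traj_from M pi m h.+1 s']_t (c h (x, r) + cost h.+1 t)).
      apply: eq_Rintegral => t _; rewrite /cost big_ord_recl addn0 tnth0.
      congr (_ + _); apply: eq_bigr => i _; rewrite tnthS.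
      by rewrite /= /bump/= add1n addnS.
    have p1 := @prob_kernel _ _ _ _ _ (traj_from M pi m h.+1) s'.
    rewrite (bRintegralD p1); [|exact: bmeas_cst|exact: bmeas_cost].
    by rewrite (bRintegral_cst p1).
  have p1 := @prob_kernel _ _ _ _ _ (trans M) x.
  by rewrite (bRintegralD p1)//; [rewrite (bRintegral_cst p1)|exact: bmeas_cst].
have p1 := @prob_kernel _ _ _ _ _ (rew M) x.
by rewrite (bRintegralD p1)//; [rewrite (bRintegral_cst p1)|exact: bmeas_cst].
Qed.
End additive_cost.

Definition good_rewards m (t : m.-tuple step) := forall i, 0 <= reward_of (tnth t i) <= 1.

Lemma measurable_good_rewards m : measurable [set t : m.-tuple step | good_rewards t].
Proof.
apply: (measurable_tuple_box (C := fun=> [set z : step | 0 <= reward_of z <= 1])) => _.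
rewrite (_ : [set z | _] = [set z | 0 <= reward_of z] `&` [set z : step | reward_of z <= 1]).
  by apply: measurableI; apply: measurable_le_set => //;
    exact: measurable_reward_of.
by apply/seteqP; split => z /= /andP.
Qed.

(** The indicator is the product of one for the first reward and one for the remaining steps, so the
    iterated integral collapses step by step. *)
Lemma Rintegral_good_rewards M pi m h s :
  \int[traj_from M pi m h s]_t \1_[set t : m.-tuple step | good_rewards t] t = 1.
Proof.
elim: m h s => [|m IH] h s.
  under eq_Rintegral => t _.
    rewrite indicE mem_set; last by case.
    over.
  by apply: bRintegral_cst; exact: (@prob_kernel _ _ _ _ _ (traj_from M pi 0 h) s).
have bI k : bmeas (\1_[set t : k.-tuple step | good_rewards t] : _ -> R).
  by apply: bmeas_indic; exact: measurable_good_rewards.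
rewrite Rintegral_traj//; set x := act pi h s.
have IE r (t : m.-tuple step) : \1_[set t : m.+1.-tuple step | good_rewards t]
    [tuple of (x, r) :: t] =
    \1_[set r : R | 0 <= r <= 1] r * \1_[set t : m.-tuple step | good_rewards t] t :> R.
  rewrite !indicE -natrM mulnb; congr (_%:R); congr nat_of_bool.
  apply/idP/andP; rewrite !inE /=.
    by move=> g; split=> [|i]; [exact: (g ord0)|have := g (lift ord0 i); rewrite tnthS].
  by move=> [g0 g] i; case: (unliftP ord0 i) => [j|] ->; rewrite ?tnthS// tnth0.
transitivity (\int[rew M x]_r \1_[set r : R | 0 <= r <= 1] r : R).
  apply: eq_Rintegral => r _; set i01 := \1__ r.
  transitivity (\int[trans M x]_s' (cst i01 s')); last exact/bRintegral_cst/prob_kernel.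
  apply: eq_Rintegral => s' _ /=; rewrite -[RHS]mulr1 -(IH h.+1 s').
  rewrite -(bRintegralZ (@prob_kernel _ _ _ _ _ (traj_from M pi m h.+1) s') i01 (bI m)).
  by apply: eq_Rintegral => t _; rewrite IE.
rewrite /Rintegral /= integral_indic ?setIT ?rew01//.
exact: measurable_itv01.
Qed.

Lemma good_rewards_ae M pi m h s : {ae traj_from M pi m h s, forall t, good_rewards t}.
Proof.
apply: (prob1_ae (A := [set t : m.-tuple step | good_rewards t])).
- exact: prob_kernel.
- exact: measurable_good_rewards.
- exact: Rintegral_good_rewards.
Qed.

Lemma clip_rew_ae M x : {ae rew M x, forall r, r = clip01 r}.
Proof.
have : {ae rew M x, forall r, [set r : R | 0 <= r <= 1] r}.
  apply: prob1_ae; [exact: prob_kernel|exact: measurable_itv01|].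
  by rewrite /Rintegral integral_indic ?setIT ?rew01//; exact: measurable_itv01.
move=> h; apply: (@filterS _ _ (ae_filter_ringOfSetsType (rew M x)) _ _ _ h) => r /= r01.
by rewrite clip01_id.
Qed.

Section value.
Variables (H : nat) (M : mdp S A R) (pi : policy S A).

Lemma value_fun_cost h s : value_fun H M pi h s =
  mean_cost M pi (fun _ z => clip01 (reward_of z)) (H - h) h s.
Proof.
apply: ae_eq_Rintegral.
- apply: measurable_sum => i; apply: (measurableT_comp measurable_reward_of).
  exact: measurable_tnth.
- by case: (@bmeas_cost (fun _ z => clip01 (reward_of z)) _ (H - h) h) => // h';
    exact: bmeas_clip01 measurable_reward_of.
- apply: filterS (good_rewards_ae M pi (H - h) h s) => t gt.
  by rewrite /cost /total_reward; apply: eq_bigr => i _; rewrite clip01_id.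
Qed.

Lemma bmeas_value_fun h : bmeas (value_fun H M pi h).
Proof.
rewrite (_ : value_fun H M pi h = mean_cost M pi (fun _ z => clip01 (reward_of z)) (H - h) h).
  by apply: bmeas_mean_cost => h'; exact: bmeas_clip01 measurable_reward_of.
by apply/funext => s; exact: value_fun_cost.
Qed.

Lemma value_fun_end h s : (H <= h)%N -> value_fun H M pi h s = 0.
Proof. by move=> Hh; rewrite value_fun_cost (eqP Hh) mean_cost0. Qed.

Lemma Bellman h s : (h < H)%N -> value_fun H M pi h s =
  mean_reward M (act pi h s) + \int[trans M (act pi h s)]_s' value_fun H M pi h.+1 s'.
Proof.
move=> hH; rewrite value_fun_cost -(subnSK hH) mean_costS; last first.
  by move=> h'; exact: bmeas_clip01 measurable_reward_of.
by congr (_ + _); apply: eq_Rintegral => s' _; rewrite value_fun_cost.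
Qed.
End value.
End trajectories.

(** * Trajectories of a policy that depends on the outcome *)

Section parametrized_law.
Context dO dS dA (O : measurableType dO) (S : measurableType dS)
  (A : measurableType dA) (R : realType).
Local Notation step := (step S A R).
Variables (M : mdp S A R) (P1 : probability S R) (H : nat) (pol : O -> policy S A).
Hypothesis mpol : forall h, measurable_fun [set: O * S] (fun x => pol x.1 h x.2).

Definition pact h (x : O * S) : S * A := (x.2, pol x.1 h x.2).

Lemma measurable_pact h : measurable_fun [set: O * S] (pact h).
Proof. by apply/measurable_fun_pairP; split; [exact: measurable_snd|exact: mpol]. Qed.

Lemma measurable_pact_fst h :
  measurable_fun [set: O * S * measurableTypeR R] (pact h \o fst).
Proof. exact: measurableT_comp (measurable_pact h) measurable_fst. Qed.

Definition pnext (x : O * S * measurableTypeR R * S) : O * S := (x.1.1.1, x.2).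

Lemma measurable_pnext : measurable_fun [set: O * S * measurableTypeR R * S] pnext.
Proof.
apply/measurable_fun_pairP; split; last exact: measurable_snd.
rewrite (_ : fst \o pnext = fst \o (fst \o fst))//.
apply: (measurableT_comp (@measurable_fst _ _ O S)).
exact: measurableT_comp measurable_fst measurable_fst.
Qed.

Definition pfirst h m (x : O * S * measurableTypeR R * S * m.-tuple step) :
  m.+1.-tuple step := [tuple of (pact h x.1.1.1, x.1.1.2) :: x.2].

Lemma measurable_pfirst h m :
  measurable_fun [set: O * S * measurableTypeR R * S * m.-tuple step] (@pfirst h m).
Proof.
apply: (@measurable_cons _ _ _ step _ _ snd); last exact: measurable_snd.
apply/measurable_fun_pairP; split.
  apply: (measurableT_comp (measurable_pact_fst h)).
  exact: measurableT_comp measurable_fst measurable_fst.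
apply: (measurableT_comp (@measurable_snd _ _ (O * S)%type (measurableTypeR R))).
exact: measurableT_comp measurable_fst measurable_fst.
Qed.

(** [traj_from] is one kernel for each fixed policy and says nothing about measurability in [w];
    here the outcome is carried along as part of the kernel's argument. *)
Fixpoint ptraj (m h : nat) : R.-pker (O * S) ~> (m.-tuple step) :=
  match m with
  | 0 => kdirac (@measurable_cst _ _ (O * S)%type (0.-tuple step) setT [tuple])
  | m'.+1 =>
    kbind (kpre (rew M) (measurable_pact h))
      (kbind (kpre (trans M) (measurable_pact_fst h))
        (kbind (kpre (ptraj m' h.+1) measurable_pnext)
          (kdirac (@measurable_pfirst h m'))))
  end.

Lemma ptrajE m h w s U : ptraj m h (w, s) U = traj_from M (pol w) m h s U.
Proof.
elim: m h s U => [//|m IH] h s U /=.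
rewrite /kbind /mkcomp /= /kcomp /=; apply: eq_integral => r _.
rewrite /mkcomp /= /kcomp /=; apply: eq_integral => s' _.
rewrite /mkcomp /= /kcomp /=; apply: eq_measure_integral => V mV _.
exact: IH.
Qed.

Lemma measurable_cst_probability :
  measurable_fun [set: O] (fun _ : O => P1 : pprobability S R).
Proof. exact: measurable_cst. Qed.

Definition plaw : R.-pker O ~> (H.-tuple step) :=
  kbind (kprobability measurable_cst_probability) (ptraj H 0).

Lemma plawE w U : plaw w U = traj_law P1 M (pol w) U.
Proof. by apply: eq_integral => s _; rewrite ptrajE. Qed.

Lemma Rintegral_plaw w (g : H.-tuple step -> R) : bmeas g ->
  \int[plaw w]_t g t = \int[P1]_s \int[traj_from M (pol w) H 0 s]_t g t.
Proof.
move=> bg; rewrite Rintegral_kbind//; apply: eq_Rintegral => s _.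
by congr fine; apply: eq_measure_integral => V mV _; rewrite ptrajE.
Qed.

Lemma good_rewards_plaw w : {ae plaw w, forall t, good_rewards t}.
Proof.
apply: (prob1_ae (A := [set t : H.-tuple step | good_rewards t])).
- exact: prob_kernel.
- exact: measurable_good_rewards.
rewrite Rintegral_plaw; last by apply: bmeas_indic; exact: measurable_good_rewards.
under eq_Rintegral do rewrite Rintegral_good_rewards.
by apply: bRintegral_cst; exact: probability_setT.
Qed.

Lemma total_reward_plaw w : bounded_rewards H P1 M ->
  {ae plaw w, forall t, 0 <= total_reward t <= 1}.
Proof.
move=> /(_ (pol w))[t1 _].
have mA : measurable [set t : H.-tuple step | 0 <= total_reward t <= 1].
  have mt : measurable_fun [set: H.-tuple step] (@total_reward _ _ S A R H).
    apply: measurable_sum => i; apply: (measurableT_comp (@measurable_reward_of _ _ S A R)).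
    exact: measurable_tnth.
  rewrite (_ : [set t | _] = [set t | 0 <= total_reward t] `&` [set t | total_reward t <= 1]).
    by apply: measurableI; apply: measurable_le_set.
  by apply/seteqP; split => z /= /andP.
apply: (prob1_ae (A := [set t | 0 <= total_reward t <= 1])) => //; first exact: prob_kernel.
by rewrite /Rintegral integral_indic// setIT plawE t1.
Qed.

Lemma Rintegral_plaw_total w : \int[plaw w]_t total_reward t = value H P1 M (pol w).
Proof.
have br : bmeas (fun z : step => clip01 (reward_of z)).
  exact: bmeas_clip01 (@measurable_reward_of _ _ S A R).
have bc : bmeas (cost (fun _ (z : step) => clip01 (reward_of z)) 0 : H.-tuple step -> R).
  by apply: bmeas_cost => h'.
transitivity (\int[plaw w]_t cost (fun _ z => clip01 (reward_of z)) 0 t).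
  apply: ae_eq_Rintegral.
  - apply: measurable_sum => i; apply: (measurableT_comp (@measurable_reward_of _ _ S A R)).
    exact: measurable_tnth.
  - by have [] := bc.
  - apply: filterS (good_rewards_plaw w) => t gt.
    by apply: eq_bigr => i _; rewrite clip01_id.
rewrite Rintegral_plaw//.
by apply: eq_Rintegral => s _; rewrite value_fun_cost subn0.
Qed.

End parametrized_law.

(** * Simulation lemma and residuals *)

Section total_variation.
Context d (T : measurableType d) (R : realType) (mu nu : {measure set T -> \bar R}).
Hypotheses (mu1 : mu [set: T] = 1%E) (nu1 : nu [set: T] = 1%E).

Let slice (n : nat) (f : T -> R) (i : nat) : set T :=
  [set x | i%:R <= n%:R * f x] `&` ~` [set x | i.+1%:R <= n%:R * f x].

Let mslice n f i : measurable_fun [set: T] f -> measurable (slice n f i).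
Proof.
move=> mf; apply: measurableI; first by apply: measurable_le_set => //; exact: measurable_funM.
by apply: measurableC; apply: measurable_le_set => //; exact: measurable_funM.
Qed.

Let staircase (n : nat) (f : T -> R) (x : T) : R :=
  \sum_(i < n.+1) i%:R / n%:R * \1_(slice n f i) x.

Let sliceP n f i x : 0 <= f x -> slice n f i x <-> Num.truncn (n%:R * f x) = i.
Proof.
move=> f0; have h0 : 0 <= n%:R * f x by rewrite mulr_ge0.
have /andP[h1 h2] := truncn_itv h0; rewrite /slice /=; split.
  move=> [i1 /negP]; rewrite -ltNge => i2; apply/eqP; rewrite eqn_leq.
  by rewrite -ltnS -(ltr_nat R) (le_lt_trans h1 i2)/= -ltnS -(ltr_nat R) (le_lt_trans i1 h2).
by move=> <-; split => //; apply/negP; rewrite -ltNge.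
Qed.

Let staircase_approx n (f : T -> R) x : (0 < n)%N -> 0 <= f x <= 1 ->
  staircase n f x <= f x <= staircase n f x + n%:R^-1.
Proof.
move=> n0 /andP[f0 f1]; have n0' : 0 < n%:R :> R by rewrite ltr0n.
have h0 : 0 <= n%:R * f x by rewrite mulr_ge0.
have /andP[h1 h2] := truncn_itv h0.
have jn : (Num.truncn (n%:R * f x) < n.+1)%N.
  by rewrite ltnS -(ler_nat R) (le_trans h1)// ler_piMr// ltW.
have -> : staircase n f x = (Num.truncn (n%:R * f x))%:R / n%:R.
  rewrite /staircase (bigD1 (Ordinal jn))//= big1 ?addr0.
    by rewrite indicE mem_set ?mulr1//; exact/sliceP.
  move=> i ij; rewrite indicE memNset ?mulr0// => /(sliceP n i f0) E.
  by move/eqP: ij; apply; exact/val_inj.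
rewrite ler_pdivrMr// [f x * _]mulrC h1/=.
set j := Num.truncn _ in h2 *.
have -> : j%:R / n%:R + n%:R^-1 = j.+1%:R / n%:R :> R by rewrite -natr1 mulrDl mul1r.
by rewrite ler_pdivlMr// [f x * _]mulrC ltW.
Qed.

Let bmeas_staircase n f : measurable_fun [set: T] f -> bmeas (staircase n f).
Proof.
move=> mf; apply: bmeas_sum => i; apply: bmeasZ; apply: bmeas_indic.
exact: mslice.
Qed.

(** The level sets of [n * f] form a disjoint family as in the supremum defining [l1_dist], and the
    weights [i / n] are at most 1. So the staircase below [f] obeys the bound for every [n], with
    error [1 / n]. *)
Lemma l1_dist_Rintegral (f : T -> R) (D : R) : measurable_fun [set: T] f ->
  (forall x, 0 <= f x <= 1) -> (l1_dist mu nu <= D%:E)%E ->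
  `|\int[mu]_x f x - \int[nu]_x f x| <= D.
Proof.
move=> mf f01 muD; have bf := bmeas01 mf f01.
have stepE (m : {measure set T -> \bar R}) n : m [set: T] = 1%E ->
    \int[m]_x staircase n f x = \sum_(i < n.+1) i%:R / n%:R * fine (m (slice n f i)).
  move=> m1; rewrite (bRintegral_sum m1); last first.
    by move=> i; apply: bmeasZ; apply: bmeas_indic; exact: mslice.
  apply: eq_bigr => i _; rewrite (bRintegralZ m1); last by apply: bmeas_indic; exact: mslice.
  by rewrite /Rintegral integral_indic ?setIT//; exact: mslice.
have approx (m : {measure set T -> \bar R}) n : (0 < n)%N -> m [set: T] = 1%E ->
    \int[m]_x staircase n f x <= \int[m]_x f x <= \int[m]_x staircase n f x + n%:R^-1.
  move=> n0 m1; have bs := bmeas_staircase n mf.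
  apply/andP; split.
    by apply: (bRintegral_le m1) => // x; have /andP[] := staircase_approx n0 (f01 x).
  rewrite -[X in _ <= _ + X](bRintegral_cst m1) -(bRintegralD m1)//; last exact: bmeas_cst.
  apply: (bRintegral_le m1) => //; first by apply: bmeasD => //; exact: bmeas_cst.
  by move=> x; have /andP[] := staircase_approx n0 (f01 x).
have fin (m : {measure set T -> \bar R}) n i : m [set: T] = 1%E ->
    m (slice n f i) \is a fin_num.
  move=> m1; rewrite ge0_fin_numE// (@le_lt_trans _ _ 1%E) ?ltry// -m1.
  by apply: le_measure; rewrite ?inE//; exact: mslice.
have stairs n : (0 < n)%N ->
    `|\int[mu]_x staircase n f x - \int[nu]_x staircase n f x| <= D.
  move=> n0; rewrite !stepE// -sumrB.
  apply: le_trans (ler_norm_sum _ _ _) _; rewrite -lee_fin; apply: le_trans muD.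
  apply: (@le_trans _ _ (\sum_(i < n.+1) `|mu (slice n f i) - nu (slice n f i)|)%E).
    rewrite -sumEFin; apply: lee_sum => i _.
    rewrite -(fineK (fin mu n i mu1)) -(fineK (fin nu n i nu1)) -EFinB abse_EFin lee_fin.
    rewrite -mulrBr normrM ler_piMl// ger0_norm ?divr_ge0//.
    by rewrite ler_pdivrMr ?ltr0n// mul1r ler_nat -ltnS.
  apply: ereal_sup_ubound; exists n.+1, (fun i : 'I_n.+1 => slice n f i); split => //.
    by move=> i; exact: mslice.
  move=> i j _ _ [x [si sj]]; apply/val_inj => /=.
  have f0 : 0 <= f x by have /andP[] := f01 x.
  by rewrite -((sliceP n i f0).1 si) -((sliceP n j f0).1 sj).
apply/ler_addgt0Pr => e e0.
pose n := (Num.truncn e^-1).+1.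
have ne : n%:R^-1 <= e.
  have ei : 0 <= e^-1 by rewrite invr_ge0 ltW.
  rewrite -[e]invrK lef_pV2 ?posrE ?invr_gt0// ?ltr0n//.
  by have /andP[_ /ltW] := truncn_itv ei.
have := stairs n isT; have /andP[] := approx mu n isT mu1; have /andP[] := approx nu n isT nu1.
rewrite !ler_norml; lra.
Qed.
End total_variation.

Section one_step.
Context dS dA (S : measurableType dS) (A : measurableType dA) (R : realType).
Implicit Types (M : mdp S A R) (U : S -> R) (x : S * A).

(** The Bellman operator of [M] at a prescribed action. *)
Definition lookahead M U x : R := mean_reward M x + \int[trans M x]_s' U s'.

Lemma bmeas_lookahead M U : bmeas U -> bmeas (lookahead M U).
Proof.
move=> bU; apply: bmeasD; [exact: bmeas_mean_reward|exact: bmeas_kernel_cst].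
Qed.

Lemma lookahead_itv M U x : measurable_fun [set: S] U -> (forall s, 0 <= U s <= 1) ->
  0 <= lookahead M U x <= 2.
Proof.
move=> mU U01; have /andP[r0 r1] := mean_reward_itv M x.
have /andP[i0 i1] := bRintegral_itv (@prob_kernel _ _ _ _ _ (trans M) x) mU U01.
by rewrite /lookahead; apply/andP; split; lra.
Qed.

Lemma Rintegral_rew_trans M U x : bmeas U ->
  \int[rew M x]_r \int[trans M x]_s' (r + U s') = lookahead M U x.
Proof.
move=> bU; have t1 := @prob_kernel _ _ _ _ _ (trans M) x.
have r1 := @prob_kernel _ _ _ _ _ (rew M) x.
set c := \int[trans M x]_s' U s'.
transitivity (\int[rew M x]_r (r + c)).
  apply: eq_Rintegral => r _; rewrite (bRintegralD t1)//; last exact: bmeas_cst.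
  by rewrite (bRintegral_cst t1).
transitivity (\int[rew M x]_r (clip01 r + c)); last first.
  rewrite (bRintegralD r1); [|exact: bmeas_clip01 (@measurable_id _ _ _)|exact: bmeas_cst].
  by rewrite (bRintegral_cst r1).
apply: ae_eq_Rintegral.
- exact: measurable_funD.
- by apply: measurable_funD => //; exact: measurable_clip01 (@measurable_id _ _ _).
- apply: (@filterS _ _ (ae_filter_ringOfSetsType (rew M x)) _ _ _ (clip_rew_ae M x)) => r /= rE.
  by rewrite -rE.
Qed.

Lemma l1_dist_ge0 d (T : measurableType d) (mu nu : {measure set T -> \bar R}) :
  (0 <= l1_dist mu nu)%E.
Proof.
apply: ereal_sup_ubound; exists 0%N, (fun=> set0); split => //; last by rewrite big_ord0.
by case.
Qed.

(** The two test functions, [clip01] for the reward and [U] for the next state, both take values in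
    [[0, 1]], so the two distances together spend the budget [theta] without any extra factor. *)
Lemma lookahead_dist M M' U x (theta : R) : measurable_fun [set: S] U ->
  (forall s, 0 <= U s <= 1) ->
  (l1_dist (trans M x) (trans M' x) + l1_dist (rew M x) (rew M' x) <= theta%:E)%E ->
  `|lookahead M U x - lookahead M' U x| <= theta.
Proof.
move=> mU U01 l1th.
have t0 := l1_dist_ge0 (trans M x) (trans M' x).
have r0 := l1_dist_ge0 (rew M x) (rew M' x).
have tfin : l1_dist (trans M x) (trans M' x) \is a fin_num.
  by rewrite ge0_fin_numE// (le_lt_trans _ (ltry theta))// (le_trans _ l1th)// leeDl.
have rfin : l1_dist (rew M x) (rew M' x) \is a fin_num.
  by rewrite ge0_fin_numE// (le_lt_trans _ (ltry theta))// (le_trans _ l1th)// leeDr.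
have := @l1_dist_Rintegral _ _ _ (trans M x) (trans M' x)
  (@prob_kernel _ _ _ _ _ (trans M) x) (@prob_kernel _ _ _ _ _ (trans M') x) U _ mU U01.
move/(_ (fine (l1_dist (trans M x) (trans M' x)))); rewrite fineK// => /(_ (lexx _)) ht.
have := @l1_dist_Rintegral _ _ _ (rew M x) (rew M' x)
  (@prob_kernel _ _ _ _ _ (rew M) x) (@prob_kernel _ _ _ _ _ (rew M') x) (@clip01 R) _
  (measurable_clip01 (@measurable_id _ _ _)) (@clip01_itv R).
move/(_ (fine (l1_dist (rew M x) (rew M' x)))); rewrite fineK// => /(_ (lexx _)) hr.
move: l1th; rewrite -(fineK tfin) -(fineK rfin) -EFinD lee_fin.
move: ht hr; rewrite /lookahead /mean_reward !ler_norml; lra.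
Qed.
End one_step.

(** * Temporal-difference residuals in the linear class *)

Section linear_model.
Context dS dA (S : measurableType dS) (A : measurableType dA) (R : realType).
Variables (H : nat) (P1 : probability S R).
Variables (K d : nat) (base : 'I_K -> mdp S A R).
Variable phi : simplex_fun (S * A)%type R d.
Implicit Types (V W : weights R K d) (U : S -> R) (x : S * A).
Local Notation mixed := (mixed_mdp base phi).
Local Notation step := (step S A R).

Lemma lookahead_mixed V U x : bmeas U ->
  lookahead (mixed V) U x = \sum_k (V *m phi x) k ord0 * lookahead (base k) U x.
Proof.
move=> bU; rewrite /lookahead /mean_reward.
rewrite !Rintegral_mix//; last exact: bmeas_clip01 (@measurable_id _ _ _).
by rewrite -big_split; apply: eq_bigr => k _; rewrite mulrDr.
Qed.

Variable piW : weights R K d -> policy S A.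
Local Notation VW := (VW H base phi piW).
Local Notation V_bar := (V_bar H base phi piW).

Lemma bmeas_VW W h : bmeas (VW W h).
Proof. exact: bmeas_value_fun. Qed.

Lemma V_barE W h x k : V_bar W h x k ord0 = lookahead (base k) (VW W h.+1) x.
Proof. by rewrite mxE Rintegral_rew_trans//; exact: bmeas_VW. Qed.

(** Pairing [V] with a rank-one matrix gives the dot product of [V *m phi x] with the lookaheads of
    the base models, which is the mixture in [lookahead_mixed]. *)
Lemma trace_V_bar V W h x :
  \tr (V^T *m (V_bar W h x *m (phi x)^T)) = lookahead (mixed V) (VW W h.+1) x.
Proof.
rewrite lookahead_mixed; last exact: bmeas_VW.
rewrite mxtrace_mulC -mulmxA mxtrace_mulC.
rewrite /mxtrace big_ord_recl big_ord0 addr0 mxE.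
rewrite -[(phi x)^T *m V^T]trmx_mul.
by apply: eq_bigr => k _; rewrite -V_barE [X in X * _]mxE.
Qed.

(** The summed temporal-difference error of a trajectory: predictions from the model of [V],
    next-state values from [W]. *)
Definition residual V W (t : H.-tuple step) : R :=
  \sum_(h < H) (reward_of (tnth t h) + next_value base phi piW W t h
    - lookahead (mixed V) (VW W h.+1) (tnth t h).1).

Lemma y_hat_sub_trace V W n (X : 'I_n -> H.-tuple step) :
  y_hat base phi piW W X - \tr (V^T *m Z_hat base phi piW W X) =
  n%:R^-1 * \sum_(i < n) residual V W (X i).
Proof.
rewrite /y_hat /Z_hat -scalemxAr mxtraceZ -mulrBr; congr (_ * _).
rewrite mulmx_sumr (raddf_sum (@mxtrace R d)) -sumrB; apply: eq_bigr => i _.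
rewrite mulmx_sumr (raddf_sum (@mxtrace R d)) -sumrB; apply: eq_bigr => h _.
by congr (_ - _); exact: trace_V_bar.
Qed.

(* The value of the state reached by a step is charged to the following step,
   which makes [residual] an additive cost along the trajectory. *)
Definition residual_cost V W (h : nat) (z : step) : R :=
  clip01 (reward_of z) + (0 < h)%N%:R * VW W h z.1.1
  - lookahead (mixed V) (VW W h.+1) z.1.

Lemma bmeas_residual_cost V W h : bmeas (residual_cost V W h).
Proof.
apply: bmeasB; last first.
  apply: (bmeas_comp (bmeas_lookahead (mixed V) (bmeas_VW W h.+1))).
  exact: measurable_fst.
apply: bmeasD; first exact: bmeas_clip01 (@measurable_reward_of _ _ S A R).
apply: bmeasZ; apply: (bmeas_comp (bmeas_VW W h)).
exact: (measurableT_comp measurable_fst measurable_fst).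
Qed.

Lemma sum_next_value W (t : H.-tuple step) :
  \sum_(h < H) next_value base phi piW W t h =
  \sum_(h < H) (0 < h)%N%:R * VW W h (tnth t h).1.1.
Proof.
rewrite /next_value; case: H t => [|H'] t; first by rewrite !big_ord0.
rewrite [RHS]big_ord_recl mul0r add0r big_ord_recr/=.
rewrite insubF ?ltnn//= addr0; apply: eq_bigr => i _.
rewrite insubT; first by rewrite /= ltnS.
move=> ij; rewrite mul1r.
have -> : (Sub i.+1 ij : 'I_H'.+1) = lift ord0 i by exact: val_inj.
by [].
Qed.

Lemma residual_good V W (t : H.-tuple step) : good_rewards t ->
  residual V W t = cost (residual_cost V W) 0 t.
Proof.
move=> gt; rewrite /residual /cost sumrB big_split/= sum_next_value -big_split -sumrB.
by apply: eq_bigr => i _; rewrite /residual_cost clip01_id// add0n.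
Qed.

Hypothesis VW01 : forall W h s, 0 <= VW W h s <= 1.

(** Rewards add up to at most 1, the values after the first state to at most [H - 1], and each of
    the [H] lookaheads is at most 2. The width [3 H] is squared in the exponent of the residual
    deviations. *)
Lemma residual_itv V W (t : H.-tuple step) : (0 < H)%N -> 0 <= total_reward t <= 1 ->
  - (2 * H%:R) <= residual V W t <= H%:R.
Proof.
move=> H0 /andP[t0 t1]; rewrite /residual sumrB big_split/= sum_next_value -/(total_reward t).
have bL h x : 0 <= lookahead (mixed V) (VW W h) x <= 2.
  by apply: lookahead_itv => //; case: (bmeas_VW W h).
have /andP[l0 l2] : 0 <= \sum_(h < H) lookahead (mixed V) (VW W h.+1) (tnth t h).1 <= 2 * H%:R.
  rewrite sumr_ge0 => [|h _]/=; last by have /andP[] := bL h.+1 (tnth t h).1.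
  have -> : 2 * H%:R = \sum_(h < H) 2 :> R by rewrite sumr_const card_ord mulr_natr.
  by apply: ler_sum => h _; have /andP[] := bL h.+1 (tnth t h).1.
have v0 : 0 <= \sum_(h < H) (0 < h)%N%:R * VW W h (tnth t h).1.1.
  by apply: sumr_ge0 => h _; rewrite mulr_ge0//; have /andP[] := VW01 W h (tnth t h).1.1.
have v1 : \sum_(h < H) (0 < h)%N%:R * VW W h (tnth t h).1.1 <= H%:R - 1.
  have -> : H%:R - 1 = \sum_(h < H) (0 < h)%N%:R :> R.
    case: (H) H0 => // n _; rewrite big_ord_recl add0r sumr_const card_ord.
    by rewrite -natr1 addrK.
  apply: ler_sum => h _; rewrite ler_piMr//.
  by have /andP[] := VW01 W h (tnth t h).1.1.
by apply/andP; split; lra.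
Qed.
End linear_model.

Section simulation.
Context dS dA (S : measurableType dS) (A : measurableType dA) (R : realType).
Variables (H : nat) (P1 : probability S R) (M M' : mdp S A R) (theta : R).
Hypothesis MM' : forall x,
  (l1_dist (trans M x) (trans M' x) + l1_dist (rew M x) (rew M' x) <= theta%:E)%E.

(** Backward induction: the one-step error is measured at the value function of [M'], so only [M']
    needs values in [[0, 1]], and the accumulated difference is propagated by the transitions of
    [M]. *)
Lemma simulation_fun pi h s : (forall h s, 0 <= value_fun H M' pi h s <= 1) ->
  `|value_fun H M pi h s - value_fun H M' pi h s| <= (H - h)%:R * theta.
Proof.
move=> v01; suff gen m : (H - h)%N = m ->
    `|value_fun H M pi h s - value_fun H M' pi h s| <= m%:R * theta by exact: gen.
elim: m h s => [|m IH] h s Hh.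
  have Hh0 : (H <= h)%N by rewrite -subn_eq0 Hh.
  by rewrite !value_fun_end// subrr normr0 mul0r.
have hH : (h < H)%N by rewrite -subn_gt0 Hh.
have bM := bmeas_value_fun H M pi h.+1; have bM' := bmeas_value_fun H M' pi h.+1.
have t1 := @prob_kernel _ _ _ _ _ (trans M) (act pi h s).
rewrite !Bellman//.
have l1 := @lookahead_dist _ _ S A R M M' (value_fun H M' pi h.+1) (act pi h s) theta
  bM'.1 (v01 h.+1) (MM' _).
have l2 : `|\int[trans M (act pi h s)]_s' (value_fun H M pi h.+1 s' - value_fun H M' pi h.+1 s')|
    <= m%:R * theta.
  apply: (bRintegral_norm t1) => [|s'].
    by apply: measurable_funB; [exact: bM.1|exact: bM'.1].
  by apply: IH; rewrite subnS Hh.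
move: l1 l2; rewrite (bRintegralB t1)// /lookahead -natr1 mulrDl mul1r.
move: (m%:R * theta) (mean_reward M _) (mean_reward M' _)
  (\int[trans M _]_s' value_fun H M pi h.+1 s')
  (\int[trans M _]_s' value_fun H M' pi h.+1 s')
  (\int[trans M' _]_s' value_fun H M' pi h.+1 s') => mt r r' i1 i2 i3.
rewrite !ler_norml; lra.
Qed.

Lemma simulation pi : (forall h s, 0 <= value_fun H M' pi h s <= 1) ->
  `|value H P1 M pi - value H P1 M' pi| <= H%:R * theta.
Proof.
move=> v01; have bM := bmeas_value_fun H M pi 0; have bM' := bmeas_value_fun H M' pi 0.
rewrite /value -(bRintegralB (@probability_setT _ _ _ P1))//.
apply: (bRintegral_norm (@probability_setT _ _ _ P1)) => [|s].
  by apply: measurable_funB; [exact: bM.1|exact: bM'.1].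
by have := simulation_fun 0 s v01; rewrite subn0.
Qed.
End simulation.

Section residual_mean.
Context dS dA (S : measurableType dS) (A : measurableType dA) (R : realType).
Variables (H : nat) (P1 : probability S R).
Variables (K d : nat) (base : 'I_K -> mdp S A R).
Variable phi : simplex_fun (S * A)%type R d.
Variable piW : weights R K d -> policy S A.
Variable Mstar : mdp S A R.
Implicit Types (V W : weights R K d) (pi : policy S A).
Local Notation mixed := (mixed_mdp base phi).
Local Notation VW := (VW H base phi piW).
Local Notation rcost := (residual_cost H base phi piW).

Lemma mean_residual_costS V W pi m h s :
  mean_cost Mstar pi (rcost V W) m.+1 h s =
  mean_reward Mstar (act pi h s) + (0 < h)%N%:R * VW W h s
  - lookahead (mixed V) (VW W h.+1) (act pi h s)
  + \int[trans Mstar (act pi h s)]_s' mean_cost Mstar pi (rcost V W) m h.+1 s'.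
Proof.
rewrite mean_costS; last exact: bmeas_residual_cost.
have r1 := @prob_kernel _ _ _ _ _ (rew Mstar) (act pi h s).
congr (_ + _); rewrite -addrA.
rewrite -[X in _ = _ + X](bRintegral_cst r1) -(bRintegralD r1); last 2 first.
- exact: bmeas_clip01 (@measurable_id _ _ _).
- exact: bmeas_cst.
by apply: eq_Rintegral => r _; rewrite /residual_cost addrA.
Qed.

(** Each step replaces a lookahead of [M(V)] by the true one at cost [theta], after which the values
    of [W] cancel between consecutive steps. Only the value charged to step [h] itself remains, and
    it is absent at [h = 0]. *)
Lemma residual_bias V W pi (theta : R) m h s :
  (forall h s, 0 <= VW W h s <= 1) ->
  (forall x, (l1_dist (trans Mstar x) (trans (mixed V) x) +
              l1_dist (rew Mstar x) (rew (mixed V) x) <= theta%:E)%E) ->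
  (m + h = H)%N ->
  `|mean_cost Mstar pi (rcost V W) m h s - (0 < h)%N%:R * VW W h s| <= m%:R * theta.
Proof.
move=> v01 MV; elim: m h s => [|m IH] h s mh.
  by rewrite mean_cost0 /Defs.VW value_fun_end ?mulr0 ?subrr ?normr0 ?mul0r// -mh.
have bV := bmeas_VW H base phi piW W h.+1.
have bc : bmeas (mean_cost Mstar pi (rcost V W) m h.+1).
  by apply: bmeas_mean_cost => h'; exact: bmeas_residual_cost.
have t1 := @prob_kernel _ _ _ _ _ (trans Mstar) (act pi h s).
rewrite mean_residual_costS.
have l1 := @lookahead_dist _ _ S A R Mstar (mixed V) (VW W h.+1) (act pi h s) theta
  bV.1 (v01 h.+1) (MV _).
have l2 : `|\int[trans Mstar (act pi h s)]_s'
    (mean_cost Mstar pi (rcost V W) m h.+1 s' - VW W h.+1 s')| <= m%:R * theta.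
  apply: (bRintegral_norm t1) => [|s'].
    by apply: measurable_funB; [exact: bc.1|exact: bV.1].
  by rewrite -[X in _ - X]mul1r; apply: (IH h.+1); rewrite addnS -addSn.
move: l1 l2; rewrite (bRintegralB t1)// /lookahead -natr1 mulrDl mul1r.
move: (m%:R * theta) (mean_reward Mstar _) (mean_reward (mixed V) _)
  (_ * VW W h s)
  (\int[trans Mstar _]_s' mean_cost Mstar pi (rcost V W) m h.+1 s')
  (\int[trans Mstar _]_s' VW W h.+1 s')
  (\int[trans (mixed V) _]_s' VW W h.+1 s') => mt r r' v i1 i2 i3.
rewrite !ler_norml; lra.
Qed.

(** Along the policy of [W], the lookahead of [M(W)] equals [VW W h] exactly, so the telescoping
    leaves no error; at [h = 0] the result is true value minus model value. *)
Lemma residual_self W m h s : (m + h = H)%N ->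
  mean_cost Mstar (piW W) (rcost W W) m h s =
  (0 < h)%N%:R * VW W h s + value_fun H Mstar (piW W) h s - VW W h s.
Proof.
elim: m h s => [|m IH] h s mh.
  by rewrite mean_cost0 /Defs.VW !value_fun_end ?mulr0 ?addr0 ?subr0// -mh.
have hH : (h < H)%N by rewrite -mh addSn ltnS leq_addl.
rewrite mean_residual_costS (Bellman _ _ _ hH).
have -> : VW W h s = lookahead (mixed W) (VW W h.+1) (act (piW W) h s) by rewrite [LHS]Bellman.
set l := lookahead _ _ _.
have -> : \int[trans Mstar (act (piW W) h s)]_s' mean_cost Mstar (piW W) (rcost W W) m h.+1 s' =
    \int[trans Mstar (act (piW W) h s)]_s' value_fun H Mstar (piW W) h.+1 s'.
  apply: eq_Rintegral => s' _; rewrite IH; last by rewrite addnS -addSn.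
  by rewrite mul1r addrAC subrr add0r.
move: (mean_reward _ _) (\int[_]_s' value_fun H Mstar (piW W) h.+1 s') (_ * l) => r i v; clearbody l.
ring.
Qed.
End residual_mean.

(** * Measurable dependence on random weights *)

Section parametrized_measurability.
Context dO dS dA (O : measurableType dO) (S : measurableType dS)
  (A : measurableType dA) (R : realType).
Variables (H : nat) (P1 : probability S R).
Variables (K d : nat) (base : 'I_K -> mdp S A R).
Variable phi : simplex_fun (S * A)%type R d.
Variable piW : weights R K d -> policy S A.
Local Notation step := (step S A R).
Local Notation mixed := (mixed_mdp base phi).
Local Notation VW := (VW H base phi piW).

Lemma bmeas_lookahead_param (M : mdp S A R) (U : O -> S -> R) :
  bmeas (fun z : O * S => U z.1 z.2) ->
  bmeas (fun z : O * (S * A) => lookahead M (U z.1) z.2).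
Proof.
move=> bU; apply: bmeasD.
  by apply: (bmeas_comp (bmeas_mean_reward M)); exact: measurable_snd.
pose k : R.-pker (O * (S * A)) ~> S := kpre (trans M) (@measurable_snd _ _ O (S * A)%type).
apply: (@bmeas_kernel _ _ _ _ _ k (fun z => U z.1.1 z.2)).
apply: (bmeas_comp bU (h := fun z : O * (S * A) * S => (z.1.1, z.2))).
apply/measurable_fun_pairP; split; last exact: measurable_snd.
exact: (measurableT_comp measurable_fst measurable_fst).
Qed.

Definition weights_measurable (Vt : O -> weights R K d) :=
  forall i j, measurable_fun [set: O] (fun w => Vt w i j).

Lemma simplex_le1 (x : S * A) j : 0 <= phi x j ord0 <= 1.
Proof.
rewrite sfun_ge0/= -(sfun_sum1 phi x) (bigD1 j)//= lerDl.
by apply: sumr_ge0 => i _; exact: sfun_ge0.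
Qed.

Lemma bmeas_weighted_param (Vt : O -> weights R K d) k : weights_measurable Vt ->
  bmeas (fun z : O * (S * A) => (Vt z.1 *m phi z.2) k ord0).
Proof.
move=> mV; under eq_fun do rewrite mxE; apply: bmeas_sum => j; apply: bmeasM.
  have bV : bmeas (fun w => Vt w k j) by apply: bmeas01 => // w; exact: w01.
  by apply: (bmeas_comp bV); exact: measurable_fst.
have bp : bmeas (fun x => phi x j ord0).
  by apply: bmeas01 => [|x]; [exact: sfun_meas|exact: simplex_le1].
by apply: (bmeas_comp bp); exact: measurable_snd.
Qed.

Lemma bmeas_lookahead_mixed_param (Vt : O -> weights R K d) (U : O -> S -> R) :
  weights_measurable Vt -> bmeas (fun z : O * S => U z.1 z.2) ->
  bmeas (fun z : O * (S * A) => lookahead (mixed (Vt z.1)) (U z.1) z.2).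
Proof.
move=> mV bU.
have bUw w : bmeas (U w).
  by apply: (bmeas_comp bU (h := fun s => (w, s))); exact: measurable_pair1.
under eq_fun do rewrite lookahead_mixed//.
by apply: bmeas_sum => k; apply: bmeasM; [exact: bmeas_weighted_param|exact: bmeas_lookahead_param].
Qed.

Variable Wt : O -> weights R K d.
Hypothesis mW : weights_measurable Wt.
Hypothesis mpi : forall h, measurable_fun [set: O * S] (fun x => piW (Wt x.1) h x.2).

(** The model varies with [w], but only through its weights: in the backward induction
    [lookahead_mixed] writes each Bellman step as a finite sum of measurable coefficients times
    integrals against the fixed base kernels. *)
Lemma bmeas_VW_param h : bmeas (fun z : O * S => VW (Wt z.1) h z.2).
Proof.
suff gen m : (H - h)%N = m -> bmeas (fun z : O * S => VW (Wt z.1) h z.2) by exact: gen.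
elim: m h => [|m IH] h Hh.
  have Hh0 : (H <= h)%N by rewrite -subn_eq0 Hh.
  under eq_fun do rewrite /Defs.VW value_fun_end//.
  exact: bmeas_cst.
have hH : (h < H)%N by rewrite -subn_gt0 Hh.
under eq_fun do rewrite /Defs.VW Bellman//.
have bV : bmeas (fun z : O * S => VW (Wt z.1) h.+1 z.2) by apply: IH; rewrite subnS Hh.
suff mh : measurable_fun [set: O * S] (fun z : O * S => (z.1, act (piW (Wt z.1)) h z.2)).
  exact: (bmeas_comp (bmeas_lookahead_mixed_param (U := fun w => VW (Wt w) h.+1) mW bV) mh).
apply/measurable_fun_pairP; split; first exact: measurable_fst.
by apply/measurable_fun_pairP; split; [exact: measurable_snd|exact: mpi].
Qed.

Lemma measurable_vW : measurable_fun [set: O] (fun w => vW H P1 base phi piW (Wt w)).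
Proof.
have [+ _] := bmeas_kernel (kprobability (@measurable_cst_probability _ _ O S R P1))
  (bmeas_VW_param 0).
by [].
Qed.

Lemma measurable_step_fst (h : 'I_H) :
  measurable_fun [set: O * H.-tuple step] (fun z => (z.1, (tnth z.2 h).1)).
Proof.
apply/measurable_fun_pairP; split; first exact: measurable_fst.
apply: (measurableT_comp (@measurable_fst _ _ (S * A)%type (measurableTypeR R))).
by apply: (measurableT_comp (measurable_tnth h)); exact: measurable_snd.
Qed.

Lemma measurable_residual (Vt : O -> weights R K d) : weights_measurable Vt ->
  measurable_fun [set: O * H.-tuple step]
    (fun z => residual base phi piW (Vt z.1) (Wt z.1) z.2).
Proof.
move=> mV; apply: measurable_sum => h; apply: measurable_funB; last first.
  have [mL _] :=
    bmeas_lookahead_mixed_param (U := fun w => VW (Wt w) h.+1) mV (bmeas_VW_param h.+1).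
  exact: (measurableT_comp mL (measurable_step_fst h)).
apply: measurable_funD.
  apply: (measurableT_comp (@measurable_reward_of _ _ S A R)).
  by apply: (measurableT_comp (measurable_tnth h)); exact: measurable_snd.
rewrite /next_value; case: insub => [j|]; last exact: measurable_cst.
have [mV' _] := bmeas_VW_param j.
suff mh : measurable_fun [set: O * H.-tuple step]
    (fun z : O * H.-tuple step => (z.1, (tnth z.2 j).1.1)).
  exact: (measurableT_comp mV' mh).
apply/measurable_fun_pairP; split; first exact: measurable_fst.
apply: (measurableT_comp (@measurable_fst _ _ S A)).
have := measurable_step_fst j; move/measurable_fun_pairP => [_ ms].
exact: ms.
Qed.

Variable Mstar : mdp S A R.
Local Notation law := (plaw (pol := fun w => piW (Wt w)) Mstar P1 H mpi).

Lemma measurable_value_param :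
  measurable_fun [set: O] (fun w => value H P1 Mstar (piW (Wt w))).
Proof.
have bc : bmeas (cost (fun _ (z : step) => clip01 (reward_of z)) 0 : H.-tuple step -> R).
  by apply: bmeas_cost => h'; exact: bmeas_clip01 (@measurable_reward_of _ _ S A R).
have [mc _] := bmeas_kernel_cst law bc.
rewrite (_ : (fun w => _) = fun w => \int[law w]_t cost (fun _ z => clip01 (reward_of z)) 0 t)//.
apply/funext => w; rewrite -(Rintegral_plaw_total (pol := fun w => piW (Wt w)) Mstar P1 H mpi w).
apply: ae_eq_Rintegral.
- apply: measurable_sum => i; apply: (measurableT_comp (@measurable_reward_of _ _ S A R)).
  exact: measurable_tnth.
- by case: bc.
- apply: filterS (good_rewards_plaw (pol := fun w => piW (Wt w)) Mstar P1 H mpi w) => t gt.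
  by apply: eq_bigr => i _; rewrite clip01_id.
Qed.

Lemma law_residual V w : \int[law w]_t residual base phi piW V (Wt w) t =
  \int[P1]_s mean_cost Mstar (piW (Wt w)) (residual_cost H base phi piW V (Wt w)) H 0 s.
Proof.
have bc : bmeas (cost (residual_cost H base phi piW V (Wt w)) 0 : H.-tuple step -> R).
  by apply: bmeas_cost => h; exact: bmeas_residual_cost.
transitivity (\int[law w]_t cost (residual_cost H base phi piW V (Wt w)) 0 t).
  apply: ae_eq_Rintegral; last 1 first.
  - apply: filterS (good_rewards_plaw (pol := fun w => piW (Wt w)) Mstar P1 H mpi w) => t.
    exact: residual_good.
  - have mV : weights_measurable (fun=> V) by move=> i j; exact: measurable_cst.
    have mp : measurable_fun [set: H.-tuple step] (fun t : H.-tuple step => (w, t)).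
      exact: measurable_pair1.
    exact: (measurableT_comp (measurable_residual mV) mp).
  - by case: bc.
by rewrite Rintegral_plaw.
Qed.

Lemma law_residual_bias V w (theta : R) :
  (forall h s, 0 <= VW (Wt w) h s <= 1) ->
  (forall x, (l1_dist (trans Mstar x) (trans (mixed V) x) +
              l1_dist (rew Mstar x) (rew (mixed V) x) <= theta%:E)%E) ->
  `|\int[law w]_t residual base phi piW V (Wt w) t| <= H%:R * theta.
Proof.
move=> v01 MV; rewrite law_residual; apply: (bRintegral_norm (@probability_setT _ _ _ P1)) => [|s].
  have [] // := @bmeas_mean_cost _ _ _ _ R Mstar (piW (Wt w)) (residual_cost H base phi piW V (Wt w)) _ H 0.
  by move=> h; exact: bmeas_residual_cost.
by have := residual_bias (piW (Wt w)) s v01 MV (addn0 H); rewrite mul0r subr0.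
Qed.

Lemma law_residual_self w :
  \int[law w]_t residual base phi piW (Wt w) (Wt w) t =
  value H P1 Mstar (piW (Wt w)) - vW H P1 base phi piW (Wt w).
Proof.
rewrite law_residual /value /vW -(bRintegralB (@probability_setT _ _ _ P1)); last 2 first.
- exact: bmeas_value_fun.
- exact: bmeas_value_fun.
by apply: eq_Rintegral => s _; rewrite residual_self ?addn0// mul0r add0r.
Qed.
End parametrized_measurability.

(** * Sample sizes *)

Section numeric.
Variables (R : realType) (d K H : nat) (eps delta : R).
Hypotheses (H0 : (0 < H)%N) (K0 : (0 < K)%N) (d0 : (0 < d)%N).
Hypotheses (eps01 : 0 < eps < 1) (delta01 : 0 < delta < 1).
Local Notation m := ((d * K)%:R : R).
Local Notation h := (H%:R : R).
Local Notation T := (rounds d K H eps).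
Local Notation lHe := (ln (h / eps)).

Let e0 : 0 < eps. Proof. by case/andP: eps01. Qed.
Let e1 : eps < 1. Proof. by case/andP: eps01. Qed.
Let dl0 : 0 < delta. Proof. by case/andP: delta01. Qed.
Let dl1 : delta < 1. Proof. by case/andP: delta01. Qed.
Let m1 : 1 <= m. Proof. by rewrite ler1n muln_gt0 d0. Qed.
Let m0 : 0 < m. Proof. exact: lt_le_trans m1. Qed.
Let h1 : 1 <= h. Proof. by rewrite ler1n. Qed.
Let h0 : 0 < h. Proof. exact: lt_le_trans h1. Qed.
Let k1 : 1 <= K%:R :> R. Proof. by rewrite ler1n. Qed.
Let km : K%:R <= m. Proof. by rewrite ler_nat leq_pmull. Qed.
Let he0 : 0 < h / eps. Proof. exact: divr_gt0. Qed.
Let he1 : 1 <= h / eps. Proof. by rewrite ler_pdivlMr// mul1r (le_trans (ltW e1)). Qed.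
Let lHe0 : 0 <= lHe. Proof. exact: ln_ge0. Qed.

Lemma ln_le_sub1 (x : R) : 0 < x -> ln x <= x - 1.
Proof.
by move=> x0; have := @le_ln1Dx R (x - 1); rewrite [1 + _]addrC subrK; apply; lra.
Qed.

Lemma ln_ge_1subV (x : R) : 0 < x -> 1 - x^-1 <= ln x.
Proof.
move=> x0; have := @ln_le_sub1 x^-1; rewrite invr_gt0 x0 => /(_ isT).
by rewrite lnV ?posrE//; lra.
Qed.

Let ln53_ge : 2 / 5 <= ln (5 / 3) :> R.
Proof. by have := @ln_ge_1subV (5 / 3); rewrite invf_div => /(_ _); lra. Qed.

Let ln53_le : ln (5 / 3) <= 2 / 3 :> R.
Proof. by have := @ln_le_sub1 (5 / 3); lra. Qed.

Let ln53_gt0 : 0 < ln (5 / 3) :> R. Proof. by have := ln53_ge; lra. Qed.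

Let ln2_le n : ln (2 ^+ n) <= n%:R :> R.
Proof.
rewrite lnXn// -[leLHS]mulr_natl ler_piMr//; have := @ln_le_sub1 2; lra.
Qed.

Definition round_arg : R := 2 * Num.sqrt (2 * K%:R) * h / eps.

(** [25 / 18] is just below [sqrt 2], and twice it is [(5 / 3)^2]; this turns the logarithm in
    [rounds] into [2 * ln (5 / 3)] plus [ln (H / eps)]. *)
Let sqrt2K_ge : 25 / 18 <= Num.sqrt (2 * K%:R) :> R.
Proof.
rewrite -[25 / 18]ger0_norm; last by lra.
rewrite -sqrtr_sqr ler_sqrt ?mulr_ge0// expr2.
by move: (K%:R) k1 => k kk; lra.
Qed.

Let sqrt2K_le : Num.sqrt (2 * K%:R) <= 2 * K%:R :> R.
Proof.
rewrite -[leRHS]ger0_norm ?mulr_ge0// -sqrtr_sqr ler_sqrt ?sqr_ge0//.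
by move: (K%:R) k1 => k kk; nra.
Qed.

Let ln_round_arg_ge : 2 * ln (5 / 3) + lHe <= ln round_arg.
Proof.
have -> : 2 * ln (5 / 3) + lHe = ln (25 / 9 * (h / eps)) :> R.
  rewrite [RHS]lnM ?posrE ?divr_gt0//.
  congr (_ + _); rewrite (_ : 25 / 9 = (5 / 3) ^+ 2); last by field.
  by rewrite lnXn ?mulr_natl// divr_gt0.
have s0 : 0 < Num.sqrt (2 * K%:R) :> R by apply: lt_le_trans sqrt2K_ge; rewrite divr_gt0.
rewrite /round_arg -[X in _ <= ln X]mulrA ler_ln ?posrE ?mulr_gt0 ?invr_gt0//.
by rewrite ler_pM2r//; have := sqrt2K_ge; lra.
Qed.

Let T_ge : m * (2 + 3 / 2 * lHe) <= T.
Proof.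
rewrite /rounds -/round_arg -[leRHS]mulrA ler_pM2l// ler_pdivlMr//.
apply: le_trans ln_round_arg_ge; rewrite mulrDl lerD2l.
have := ler_wpM2l lHe0 ln53_le; lra.
Qed.

Let T_gt0 : 0 < T.
Proof. by apply: lt_le_trans T_ge; rewrite mulr_gt0//; have := lHe0; lra. Qed.

Let T_ge2 : 2 * m <= T.
Proof.
apply: le_trans T_ge; rewrite mulrC ler_pM2l//; have := lHe0; lra.
Qed.

(** This is [m * M * r] of [ellipsoid_potential], with [M = 144 m H^2 / eps^2] and the initial
    squared radius [r = 2 d] enlarged to [2 m]. *)
Definition potential : R := 288 * m ^+ 3 * h ^+ 2 / eps ^+ 2.

Let potential_gt0 : 0 < potential.
Proof.
apply: divr_gt0; last exact: exprn_gt0.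
apply: mulr_gt0; last exact: exprn_gt0.
by apply: mulr_gt0; [exact: ltr0n|exact: exprn_gt0].
Qed.

Let ln_potential : ln potential <= 9 + 3 * ln m + 2 * lHe.
Proof.
have -> : potential = 288 * (m ^+ 3 * (h / eps) ^+ 2).
  by rewrite /potential; field; rewrite gt_eqF.
rewrite [ln (288 * _)]lnM; last 2 first.
- by rewrite posrE; exact: ltr0n.
- by rewrite posrE; apply: mulr_gt0; exact: exprn_gt0.
rewrite [ln (m ^+ 3 * _)]lnM ?posrE ?exprn_gt0 ?divr_gt0// !lnXn ?divr_gt0// !mulr_natl.
have : ln 288 <= 9 :> R.
  apply: le_trans (ln2_le 9); rewrite ler_ln ?posrE; last 2 first.
  - exact: ltr0n.
  - exact: exprn_gt0.
  by rewrite -natrX ler_nat.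
rewrite addrA; lra.
Qed.

(* A cruder bound on the number of rounds than [rounds d K H eps]. The union
   bound over this many rounds still holds because the sample sizes make each
   failure much less likely than [delta / rounds d K H eps]. *)
Definition max_rounds : nat := (Num.truncn (17 * m * ln potential)).+1.

Lemma potential_lt : potential ^+ (d * K) < (17 / 16) ^+ max_rounds.
Proof.
have pl : 17 * m * ln potential < max_rounds%:R.
  have [l0|l0] := leP 0 (17 * m * ln potential).
    by have /andP[] := truncn_itv l0.
  exact: lt_le_trans l0 _.
(* From [ln x >= 1 - 1 / x]; hence the factor 17 in [max_rounds]. *)
have l16 : 1 / 17 <= ln (17 / 16) :> R.
  by have := @ln_ge_1subV (17 / 16); rewrite invf_div => /(_ _); lra.
rewrite -ltr_ln ?posrE ?exprn_gt0// ?divr_gt0// !lnXn// ?divr_gt0//.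
rewrite -[ltLHS]mulr_natl -[ltRHS]mulr_natl.
apply: (@lt_le_trans _ _ (max_rounds%:R * (1 / 17))); first by lra.
by rewrite ler_wpM2l.
Qed.

Let max_rounds_le : max_rounds%:R <= 17 * m * (9 + 3 * ln m + 2 * lHe) + 1.
Proof.
have lm : 0 <= ln m by exact: ln_ge0.
rewrite /max_rounds -natr1 lerD2r.
have [l0|l0] := leP 0 (17 * m * ln potential).
  have /andP[+ _] := truncn_itv l0; move/le_trans; apply.
  by rewrite ler_pM2l ?mulr_gt0.
have -> : Num.truncn (17 * m * ln potential) = 0%N.
  by apply/eqP; rewrite -leqn0 truncn_le_nat; lra.
by rewrite !mulr_ge0 ?addr_ge0 ?mulr_ge0.
Qed.

Lemma nat_ceil_itv (x : R) : 0 <= x -> x <= (`|Num.ceil x|%N)%:R <= x + 1.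
Proof.
move=> x0; have c0 : 0 <= Num.ceil x by rewrite -(ceil0 R); exact: le_ceil.
rewrite natr_absz ger0_norm//; apply/andP; split; first exact: ceil_ge.
by have := ceil_itv x; rewrite intrB => /andP[]; lra.
Qed.

Let L1 : R := ln (4 * T / delta).
Let L2 : R := ln (8 * d%:R * K%:R * T / delta).
Local Notation neval := (n_eval_of d K H eps delta).
Local Notation n := (n_of d K H eps delta).

Let q : R := delta / T.
Let q0 : 0 < q. Proof. exact: divr_gt0. Qed.
Let q_le : q * (2 * m) <= 1.
Proof.
rewrite /q mulrAC ler_pdivrMr// mul1r (le_trans _ T_ge2)// ler_piMl ?mulr_ge0//.
exact: ltW.
Qed.

Let mE : d%:R * K%:R = m. Proof. by rewrite natrM. Qed.

Let arg1E : 4 * T / delta = (q / 4)^-1.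
Proof. by rewrite /q; field; rewrite !gt_eqF. Qed.

Let arg2E : 8 * d%:R * K%:R * T / delta = (q / (8 * m))^-1.
Proof. by rewrite -[8 * _ * _]mulrA mE /q; field; rewrite !gt_eqF ?ltr0n. Qed.

Let expL1 : expR (- L1) = q / 4.
Proof. by rewrite expRN /L1 lnK arg1E ?invrK// posrE invr_gt0 divr_gt0. Qed.

Let expL2 : expR (- L2) = q / (8 * m).
Proof. by rewrite expRN /L2 lnK arg2E ?invrK// posrE invr_gt0 divr_gt0// mulr_gt0. Qed.

Let q8m : q / (8 * m) <= 1 / 16.
Proof.
rewrite ler_pdivrMr ?mulr_gt0//; have := m1.
have := q_le; move: (m) (q) q0 => a b b0 ba a1; nra.
Qed.

Let L2_ge : 2 * ln 4 <= L2.
Proof.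
rewrite (_ : 2 * ln 4 = ln 16); last first.
  by rewrite (_ : 16 = 4 ^+ 2) ?lnXn ?mulr_natl//; ring.
have qm0 : 0 < q / (8 * m) by apply: divr_gt0 => //; exact: mulr_gt0.
rewrite /L2 arg2E ler_ln ?posrE ?invr_gt0//.
rewrite -[leLHS]invrK lef_pV2 ?posrE// ?invr_gt0//.
by have := q8m; lra.
Qed.

Let L1_ge0 : 0 <= L1.
Proof.
apply: ln_ge0; rewrite ler_pdivlMr// mul1r; have := T_ge2; have := m1; have := dl1; lra.
Qed.

Let ln4_ge0 : 0 <= ln 4 :> R. Proof. by apply: ln_ge0; lra. Qed.
Let L2_ge0 : 0 <= L2. Proof. by apply: le_trans L2_ge; rewrite mulr_ge0. Qed.

Let neval_itv : 32 * h ^+ 2 / eps ^+ 2 * L1 <= neval%:R <= 32 * h ^+ 2 / eps ^+ 2 * L1 + 1.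
Proof.
by apply: nat_ceil_itv; rewrite mulr_ge0// divr_ge0 ?mulr_ge0 ?exprn_ge0// ltW.
Qed.

Let n_itv : 1800 * d%:R ^+ 2 * K%:R * h ^+ 2 / eps ^+ 2 * L2 <= n%:R <=
  1800 * d%:R ^+ 2 * K%:R * h ^+ 2 / eps ^+ 2 * L2 + 1.
Proof.
rewrite /n_of -/L2; apply: nat_ceil_itv.
apply: mulr_ge0; last exact: L2_ge0.
apply: divr_ge0; last exact/exprn_ge0/ltW.
apply: mulr_ge0; last exact/exprn_ge0/ltW.
apply: mulr_ge0; last exact: ler0n.
by apply: mulr_ge0; [exact: ler0n|exact/exprn_ge0/ler0n].
Qed.

Definition eval_failure : R := expR (- (2 * neval%:R * (eps / 4) ^+ 2 / (1 - 0) ^+ 2)).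
Definition residual_failure : R :=
  expR (- (2 * n%:R * (eps / (12 * Num.sqrt m)) ^+ 2 / (h - - (2 * h)) ^+ 2)).

(** The exponent is at least [4 * H^2 * L1], and [expR (- L1) = q / 4]; this is the source of the
    fourth power. *)
Let eval_failure_le : eval_failure <= (q / 4) ^+ 4.
Proof.
rewrite -expL1 -expRM_natl ler_expR mulrN lerN2 subr0 expr1n divr1.
have /andP[nl _] := neval_itv.
have -> : 2 * neval%:R * (eps / 4) ^+ 2 = neval%:R * (eps ^+ 2 / 8) by field.
apply: le_trans (ler_wpM2r _ nl); last by rewrite divr_ge0 ?exprn_ge0// ltW.
have -> : 32 * h ^+ 2 / eps ^+ 2 * L1 * (eps ^+ 2 / 8) = 4 * (h ^+ 2 * L1).
  by field; rewrite gt_eqF.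
by rewrite ler_pM2l// ler_peMl// exprn_ege1.
Qed.

(** The exponent is at least [1800 / 648 * d * L2 = 25 / 9 * d * L2]. Two copies of [L2] give the
    square, and the excess [7 / 9 * L2] pays for [ln 4]. *)
Let residual_failure_le : residual_failure <= (q / (8 * m)) ^+ 2 / 4.
Proof.
have -> : (q / (8 * m)) ^+ 2 / 4 = expR (- (2 * L2)) * expR (- ln 4).
  by rewrite -mulrN expRM_natl expL2 expRN lnK// posrE.
rewrite -expRD ler_expR -opprD lerN2.
have /andP[nl _] := n_itv.
have -> : 2 * n%:R * (eps / (12 * Num.sqrt m)) ^+ 2 / (h - - (2 * h)) ^+ 2 =
    n%:R * (eps ^+ 2 / (648 * m * h ^+ 2)).
  have -> : (eps / (12 * Num.sqrt m)) ^+ 2 = eps ^+ 2 / (144 * m).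
    by rewrite expr_div_n exprMn sqr_sqrtr ?ler0n//; congr (_ / (_ * _)); ring.
  rewrite (_ : h - - (2 * h) = 3 * h); last by ring.
  by field; rewrite !gt_eqF ?ltr0n.
apply: le_trans (ler_wpM2r _ nl); last first.
  apply: divr_ge0; first exact/exprn_ge0/ltW.
  by apply: mulr_ge0; [apply: mulr_ge0; exact: ler0n|exact/exprn_ge0/ler0n].
have -> : 1800 * d%:R ^+ 2 * K%:R * h ^+ 2 / eps ^+ 2 * L2 *
    (eps ^+ 2 / (648 * m * h ^+ 2)) = 25 / 9 * (d%:R * L2).
  rewrite -mE; field.
  by rewrite !gt_eqF ?ltr0n.
have : L2 <= d%:R * L2 by rewrite ler_peMl// ler1n.
have := L2_ge; have := L2_ge0; lra.
Qed.

Lemma union_bound : max_rounds%:R * (2 * eval_failure + 3 * residual_failure) <= delta.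
Proof.
have Tn : T != 0 by rewrite gt_eqF.
have -> : delta = T * q by rewrite /q mulrC divfK.
have ef := eval_failure_le; have rf := residual_failure_le.
have lm : ln m <= m - 1 by exact: ln_le_sub1.
(* All powers of [q] but one are traded for powers of [1 / m] through [q <= 1 / (2 m)]. *)
have fail : 2 * eval_failure + 3 * residual_failure <= q * (7 / 1024 / m ^+ 3).
  have qm : q <= (2 * m)^-1 by rewrite -[leRHS]mul1r ler_pdivlMr ?mulr_gt0.
  have q3 : q ^+ 3 <= (2 * m)^-1 ^+ 3.
    by rewrite lerXn2r ?nnegrE ?(ltW q0) ?invr_ge0 ?mulr_ge0// ltW.
  have h1' : 2 * (q / 4) ^+ 4 <= q * (1 / 1024 / m ^+ 3).
    have -> : 2 * (q / 4) ^+ 4 = q * (q ^+ 3 / 128) by field.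
    rewrite ler_pM2l// ler_pdivrMr//; apply: le_trans q3 _.
    rewrite le_eqVlt; apply/orP; left; apply/eqP; field.
    by rewrite !gt_eqF ?ltr0n.
  have h2' : 3 * ((q / (8 * m)) ^+ 2 / 4) <= q * (6 / 1024 / m ^+ 3).
    have -> : 3 * ((q / (8 * m)) ^+ 2 / 4) = q * (q * (3 / 256 / m ^+ 2)).
      by field; rewrite !gt_eqF ?ltr0n.
    rewrite ler_pM2l//; apply: le_trans (ler_wpM2r _ qm) _.
      apply: divr_ge0; last exact/exprn_ge0/ltW.
      by apply: divr_ge0; exact: ler0n.
    rewrite le_eqVlt; apply/orP; left; apply/eqP; field.
    by rewrite !gt_eqF ?ltr0n.
  have -> : q * (7 / 1024 / m ^+ 3) = q * (1 / 1024 / m ^+ 3) + q * (6 / 1024 / m ^+ 3).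
    by field; rewrite !gt_eqF ?ltr0n.
  lra.
(* [ln (H / eps)] occurs in [T] as well, while [ln m <= m - 1] and the constants are absorbed by the
   spare [m ^+ 3 * 1024]. *)
have key : max_rounds%:R * 7 <= T * (m ^+ 3 * 1024).
  apply: le_trans (_ : (17 * m * (9 + 3 * ln m + 2 * lHe) + 1) * 7 <= _).
    by apply: ler_wpM2r; [exact: ler0n|exact: max_rounds_le].
  apply: le_trans (_ : m * (2 + 3 / 2 * lHe) * (m ^+ 3 * 1024) <= _); last first.
    apply: ler_wpM2r; last exact: T_ge.
    by apply: mulr_ge0; [exact/exprn_ge0/ltW|exact: ler0n].
  have m3 : 1 <= m ^+ 3 by exact: exprn_ege1.
  have mm3 : m <= m * m ^+ 3 by rewrite ler_peMr// ltW.
  have m2 : m * m <= m * m ^+ 3.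
    by rewrite ler_pM2l// exprS -[leLHS]mulr1 ler_pM2l//; exact: exprn_ege1.
  have lml : m * ln m <= m * (m - 1) by rewrite ler_pM2l.
  have ml : m * lHe <= m * m ^+ 3 * lHe by rewrite ler_wpM2r.
  have mp : 0 <= m * lHe by apply: mulr_ge0 => //; exact: ltW.
  move: lml ml mp mm3 m2 m1 lHe0.
  move: (m ^+ 3) (lHe) (ln m) => c l b.
  move: (m) => a; lra.
apply: le_trans (ler_wpM2l (ler0n _ _) fail) _.
have qm0 : 0 <= q / (m ^+ 3 * 1024).
  by apply: divr_ge0; [exact: ltW|apply: mulr_ge0; [exact/exprn_ge0/ltW|exact: ler0n]].
have := ler_wpM2r qm0 key.
rewrite (_ : max_rounds%:R * 7 * _ = max_rounds%:R * (q * (7 / 1024 / m ^+ 3))); last first.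
  by move: (max_rounds) (q) => N q'; field; rewrite !gt_eqF ?ltr0n.
rewrite (_ : T * (m ^+ 3 * 1024) * _ = T * q); first by [].
by move: (T) (q) => T' q'; field; rewrite !gt_eqF ?ltr0n.
Qed.

Let lam : R := Defs.ln1 ((d * K * H)%:R / eps).
Let mu : R := Defs.ln1 ((d * K * H)%:R / delta).
Let lam1 : 1 <= lam. Proof. by rewrite /lam /Defs.ln1 le_max lexx. Qed.
Let mu1 : 1 <= mu. Proof. by rewrite /mu /Defs.ln1 le_max lexx. Qed.
Let lam0 : 0 < lam. Proof. exact: lt_le_trans lam1. Qed.
Let mu0 : 0 < mu. Proof. exact: lt_le_trans mu1. Qed.
Let lam_ge : ln m + lHe <= lam.
Proof. by rewrite /lam /Defs.ln1 le_max -lnM ?posrE// mulrA -natrM lexx orbT. Qed.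

Let mu_ge : ln m - ln delta <= mu.
Proof.
rewrite /mu /Defs.ln1 le_max -ln_div ?posrE//; apply/orP; right.
rewrite ler_ln ?posrE ?divr_gt0 ?ltr0n ?muln_gt0 ?d0 ?K0 ?H0//.
by rewrite ler_pM2r ?invr_gt0// ler_nat leq_pmulr.
Qed.

Let lndelta_le0 : ln delta <= 0. Proof. by apply: ln_le0; exact: ltW. Qed.

Let T_le : T <= 15 / 2 * m * lam.
Proof.
have s0 : 0 < Num.sqrt (2 * K%:R) :> R by apply: lt_le_trans sqrt2K_ge; rewrite divr_gt0.
have ra : ln round_arg <= 3 * lam.
  apply: (@le_trans _ _ (ln (2 ^+ 2 * m * (h / eps)))).
    rewrite /round_arg -[X in ln X <= _]mulrA ler_ln ?posrE; last 2 first.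
    - by apply: mulr_gt0 => //; exact: mulr_gt0.
    - by apply: mulr_gt0 => //; apply: mulr_gt0 => //; exact: exprn_gt0.
    rewrite ler_pM2r// expr2 -mulrA ler_pM2l//.
    by have := sqrt2K_le; have := km; lra.
  rewrite lnM ?posrE//; last by apply: mulr_gt0 => //; exact: exprn_gt0.
  rewrite lnM ?posrE ?exprn_gt0//.
  have := ln2_le 2; have := lam_ge; have := lam1; lra.
rewrite /rounds -/round_arg ler_pdivrMr//.
have r0 : 0 <= lam * m by rewrite mulr_ge0// ltW.
apply: (@le_trans _ _ (m * (3 * lam))); first by rewrite ler_pM2l.
have := ler_wpM2l r0 ln53_ge; lra.
Qed.

Let L2_le : L2 <= 9 * (lam * mu).
Proof.
have ineq : 8 * d%:R * K%:R * T / delta <= 2 ^+ 6 * m * (m / delta) * lam.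
  rewrite -[8 * _ * _]mulrA mE.
  have -> : 2 ^+ 6 * m * (m / delta) * lam = 64 * m * (m * lam) / delta by ring.
  rewrite ler_pM2r ?invr_gt0//.
  have := ler_wpM2l (ltW m0) T_le.
  have : 0 <= m * (m * lam) by rewrite mulr_ge0 ?mulr_ge0 ?(ltW lam0).
  lra.
have a0 : 0 < 8 * d%:R * K%:R * T / delta.
  by rewrite arg2E invr_gt0; apply: divr_gt0 => //; exact: mulr_gt0.
have md0 : 0 < m / delta by exact: divr_gt0.
have p6 : (0 : R) < 2 ^+ 6 by exact: exprn_gt0.
rewrite /L2; apply: le_trans (_ : ln (2 ^+ 6 * m * (m / delta) * lam) <= _).
  by rewrite ler_ln// posrE; exact: lt_le_trans ineq.
rewrite lnM ?posrE//; last by apply: mulr_gt0 => //; exact: mulr_gt0.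
rewrite lnM ?posrE//; last exact: mulr_gt0.
rewrite lnM ?posrE// ln_div ?posrE//.
have ll : ln lam <= lam - 1 by exact: ln_le_sub1.
have lmu : 1 <= lam * mu by rewrite -[1]mulr1; apply: ler_pM.
have l1 : lam <= lam * mu by rewrite ler_peMr// ltW.
have l2 : mu <= lam * mu by rewrite ler_peMl// ltW.
have := ln2_le 6; have := mu_ge; have := lndelta_le0; lra.
Qed.

Let L1_le : L1 <= L2.
Proof.
rewrite /L1 /L2 -[8 * _ * _]mulrA mE ler_ln ?posrE.
- rewrite ler_pM2r ?invr_gt0// ler_pM2r//; have := m1; lra.
- by rewrite arg1E invr_gt0; exact: divr_gt0.
- by rewrite -mE [8 * _]mulrA arg2E invr_gt0; apply: divr_gt0 => //; exact: mulr_gt0.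
Qed.

(** The stopping round draws no estimation sample, hence [t.+1] against [t]. One factor [lam] comes
    from the number of rounds and one from [L2 <= 9 * (lam * mu)], whence the exponent 2. *)
Lemma samples_le t : (t < max_rounds)%N ->
  (t.+1 * neval + t * n)%:R <= sample_bound (205 * 180 * 100) 2 d K H eps delta.
Proof.
move=> tN.
pose G : R := d%:R ^+ 2 * K%:R * h ^+ 2 / eps ^+ 2.
have he2 : 1 <= h ^+ 2 / eps ^+ 2 by rewrite -expr_div_n exprn_ege1.
have dK1 : 1 <= d%:R ^+ 2 * K%:R :> R.
  by rewrite -natrX -natrM ler1n muln_gt0 expn_gt0 d0.
have GE : G = d%:R ^+ 2 * K%:R * (h ^+ 2 / eps ^+ 2) by rewrite /G !mulrA.
have heG : h ^+ 2 / eps ^+ 2 <= G.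
  by rewrite GE ler_peMl// (le_trans ler01).
have G1 : 1 <= G by exact: le_trans heG.
have lmu : 1 <= lam * mu by rewrite -[1]mulr1; apply: ler_pM.
have Glm : 1 <= G * (lam * mu) by rewrite -[1]mulr1; apply: ler_pM.
(* [9 * (32 + 1800) = 16488], plus 2 for the two roundings, is below 18000. *)
have nle : neval%:R + n%:R <= 180 * 100 * (G * (lam * mu)).
  have /andP[_ nv] := neval_itv; have /andP[_ nn] := n_itv.
  have b1 : 32 * h ^+ 2 / eps ^+ 2 * L1 <= 32 * (G * (9 * (lam * mu))).
    rewrite -[32 * _ / _]mulrA -mulrA ler_pM2l//; apply: ler_pM => //.
      exact: le_trans ler01 he2.
    exact: le_trans L1_le L2_le.
  have b2 : 1800 * d%:R ^+ 2 * K%:R * h ^+ 2 / eps ^+ 2 * L2 <= 1800 * (G * (9 * (lam * mu))).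
    have -> : 1800 * d%:R ^+ 2 * K%:R * h ^+ 2 / eps ^+ 2 * L2 = 1800 * (G * L2).
      by rewrite /G !mulrA.
    apply: ler_wpM2l; first exact: ler0n.
    by apply: ler_wpM2l; [exact: le_trans ler01 G1|exact: L2_le].
  move: b1 b2 nv nn Glm; move: (L1) (L2) => l1 l2.
  have -> : G * (9 * (lam * mu)) = 9 * (G * (lam * mu)) by ring.
  lra.
(* [17 * 12 + 1 = 205]. *)
have Nle : max_rounds%:R <= 205 * (m * lam).
  apply: le_trans max_rounds_le _.
  have b : 9 + 3 * ln m + 2 * lHe <= 12 * lam.
    have := lam_ge; have := lam1; have := lHe0; lra.
  have := ler_wpM2l (ltW m0) b.
  have ml1 : 1 <= m * lam.
    by apply: le_trans lam1 _; rewrite ler_peMl//; exact: ltW.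
  lra.
apply: (@le_trans _ _ (max_rounds%:R * (neval%:R + n%:R))).
  rewrite -natrD -natrM ler_nat mulnDr leq_add// leq_mul2r ?tN ?orbT//.
  by rewrite ltnW ?orbT.
apply: le_trans (ler_pM (ler0n _ _) (addr_ge0 (ler0n _ _) (ler0n _ _)) Nle nle) _.
rewrite le_eqVlt; apply/orP; left; apply/eqP.
rewrite /sample_bound -/lam -/mu /G -mE !natrM.
move: (lam) (mu) (h) => l u hh; move: (205%:R) (180%:R) (100%:R) => a b c.
by ring.
Qed.
End numeric.

(** * Number of rounds *)

Lemma dotmx_mxvec (R : realFieldType) K d (A B : 'M[R]_(K, d)) :
  dotmx (mxvec A) (mxvec B) = \tr (A^T *m B).
Proof.
rewrite dotmxE (reindex _ (curry_mxvec_bij _ _)) /=.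
transitivity (\sum_i \sum_j A i j * B i j).
  by rewrite pair_big /=; apply: eq_bigr => -[i j] _ /=; rewrite !mxvecE.
rewrite exchange_big; apply: eq_bigr => j _; rewrite mxE; apply: eq_bigr => i _.
by rewrite mxE.
Qed.

Section deterministic.
Context dS dA (S : measurableType dS) (A : measurableType dA) (R : realType).
Variables (H : nat) (K d : nat) (base : 'I_K -> mdp S A R).
Variable phi : simplex_fun (S * A)%type R d.
Variable piW : weights R K d -> policy S A.
Local Notation traj := (H.-tuple (step S A R)).
Local Notation m := ((d * K)%:R : R).
Local Notation yhat := (y_hat base phi piW).
Local Notation Zhat := (Z_hat base phi piW).
Hypothesis VW01 : forall W h s, 0 <= VW H base phi piW W h s <= 1.

(** [(v - w)^2 <= v + w] for entries in [[0, 1]], so every column contributes at most 2. *)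
Lemma weights_dist (V W : weights R K d) :
  dotmx (mxvec (wmx V - wmx W)) (mxvec (wmx V - wmx W)) <= 2 * d%:R.
Proof.
rewrite dotmx_mxvec /mxtrace.
have -> : 2 * d%:R = \sum_(j < d) 2 :> R by rewrite sumr_const card_ord mulr_natr.
apply: ler_sum => j _; rewrite mxE.
apply: le_trans (_ : \sum_i (V i j + W i j) <= _); last by rewrite big_split/= !wsum1.
apply: ler_sum => i _; rewrite !mxE.
have /andP[] := w01 V i j; have /andP[] := w01 W i j.
move: (wmx V i j) (wmx W i j) => a b; nra.
Qed.

Lemma Z_hat_norm n W (X : 'I_n -> traj) k j : `|Zhat W X k j| <= 2 * H%:R.
Proof.
rewrite mxE summxE.
have term i (h : 'I_H) : 0 <= (V_bar H base phi piW W h (tnth (X i) h).1 *m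
    (phi (tnth (X i) h).1)^T) k j <= 2.
  rewrite mxE big_ord_recl big_ord0 addr0 V_barE mxE.
  have bV := bmeas_VW H base phi piW W h.+1.
  have /andP[l0 l2] := lookahead_itv (base k) (tnth (X i) h).1 bV.1 (VW01 W h.+1).
  have /andP[p0 p1] := simplex_le1 phi (tnth (X i) h).1 j.
  by rewrite mulr_ge0//= -[2]mulr1 ler_pM.
have sum_i i : 0 <= (\sum_(h < H) V_bar H base phi piW W h (tnth (X i) h).1 *m
    (phi (tnth (X i) h).1)^T) k j <= 2 * H%:R.
  rewrite summxE sumr_ge0 => [|h _]; last by have /andP[] := term i h.
  have -> : 2 * H%:R = \sum_(h < H) 2 :> R by rewrite sumr_const card_ord mulr_natr.
  by apply: ler_sum => h _; have /andP[] := term i h.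
rewrite ger0_norm; last first.
  by rewrite mulr_ge0 ?invr_ge0// sumr_ge0// => i _; have /andP[] := sum_i i.
have [n0|n0] := posnP n.
  by rewrite (_ : n%:R^-1 = 0) ?mul0r ?mulr_ge0// n0 invr0.
rewrite mulrC ler_pdivrMr ?ltr0n//.
have -> : 2 * H%:R * n%:R = \sum_(i < n) (2 * H%:R) :> R by rewrite sumr_const card_ord mulr_natr.
by apply: ler_sum => i _; have /andP[] := sum_i i.
Qed.

Lemma trace_sub (V W : weights R K d) (Z : 'M[R]_(K, d)) (y : R) :
  dotmx (mxvec (wmx V - wmx W)) (mxvec Z) =
  (y - \tr (W^T *m Z)) - (y - \tr (V^T *m Z)).
Proof.
rewrite dotmx_mxvec.
have -> : (wmx V - wmx W)^T = V^T - W^T by exact: linearB.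
have -> : \tr ((V^T - W^T) *m Z) = \tr (V^T *m Z) - \tr (W^T *m Z).
  by rewrite mulmxBl; exact: raddfB.
by move: (\tr (V^T *m Z)) (\tr (W^T *m Z)) => a b; ring.
Qed.

Variables (eps theta : R).
Hypotheses (H0 : (0 < H)%N) (K0 : (0 < K)%N) (d0 : (0 < d)%N).
Hypotheses (eps01 : 0 < eps < 1) (theta0 : 0 <= theta).
Local Notation rad := (eps / (12 * Num.sqrt m) + H%:R * theta).

(** [trace_sub] writes [<x t, z u>] as the round-[u] residual of [Wst] minus that of [Wq t]. The
    first two hypotheses give the slabs; the third, the overestimation of the candidate's own value,
    gives the overshoot. *)
Lemma rounds_contradiction n (Wq : nat -> weights R K d) (Xq : nat -> 'I_n -> traj)
    (Wst : weights R K d) :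
  let N := max_rounds d K H eps in
  (forall t u, (u < t < N)%N ->
    `|yhat (Wq u) (Xq u) - \tr ((Wq t)^T *m Zhat (Wq u) (Xq u))| <= rad) ->
  (forall t, (t < N)%N ->
    `|yhat (Wq t) (Xq t) - \tr (Wst^T *m Zhat (Wq t) (Xq t))| <= rad) ->
  (forall t, (t < N)%N ->
    yhat (Wq t) (Xq t) - \tr ((Wq t)^T *m Zhat (Wq t) (Xq t)) <=
    eps / (12 * Num.sqrt m) - (eps / 2 + (3 * Num.sqrt m + 1) * H%:R * theta)) ->
  False.
Proof.
move=> N hconf hst hself.
have /andP[e0 e1] := eps01.
have m1 : 1 <= m by rewrite ler1n muln_gt0 d0.
have m0 : 0 < m by exact: lt_le_trans m1.
have s1 : 1 <= Num.sqrt m by rewrite -{1}sqrtr1 ler_sqrt ?(ltW m0).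
have s0 : 0 < Num.sqrt m by exact: lt_le_trans s1.
have h1 : 1 <= H%:R :> R by rewrite ler1n.
have h0 : 0 < H%:R :> R by exact: lt_le_trans h1.
have d1 : 1 <= d%:R :> R by rewrite ler1n.
have dm : d%:R <= m by rewrite ler_nat leq_pmulr.
have ht0 : 0 <= H%:R * theta by rewrite mulr_ge0.
set s := Num.sqrt m in s0 s1 hconf hst hself *.
have ss : s ^+ 2 = m by rewrite sqr_sqrtr// ltW.
pose e' := eps / (12 * s).
have e's : e' * s = eps / 12 by rewrite /e'; field; rewrite gt_eqF.
have e'0 : 0 < e' by rewrite divr_gt0// mulr_gt0.
have e'e : e' <= eps / 12.
  by rewrite -e's ler_peMr// ltW.
(* Twice the confidence radius, since the inner product is a difference of two residuals. *)
pose beta := 2 * (e' + H%:R * theta).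
have b0 : 0 < beta by rewrite mulr_gt0// ltr_pwDl.
have be : 2 * e' <= beta by rewrite ler_pM2l// lerDl.
(* The value of [B^2 / beta^2] at [theta = 0], an upper bound for every [theta]; the round count is
   thereby independent of [theta]. *)
pose M : R := 144 * m * H%:R ^+ 2 / eps ^+ 2.
have MB : (2 * H%:R) ^+ 2 / beta ^+ 2 <= M.
  have -> : M = (2 * H%:R) ^+ 2 / (2 * e') ^+ 2.
    rewrite /M /e' -ss; field; rewrite !gt_eqF//.
  have e'2 : 0 < 2 * e' by exact: mulr_gt0.
  apply: ler_wpM2l; first exact: sqr_ge0.
  rewrite lef_pV2 ?posrE; [|exact: exprn_gt0|exact: exprn_gt0].
  by rewrite lerXn2r// nnegrE ltW.
have Mr : (2 * d%:R)^-1 <= M.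
  apply: (@le_trans _ _ 1); first by rewrite invf_le1 ?mulr_gt0//; lra.
  rewrite /M ler_pdivlMr ?exprn_gt0// mul1r.
  apply: (@le_trans _ _ 1); first by rewrite exprn_ile1// ltW.
  have : 1 <= H%:R ^+ 2 :> R by exact: exprn_ege1.
  move: (H%:R ^+ 2) (m) m1 => a b b1 a1; nra.
pose x t := mxvec (wmx (Wq t) - wmx Wst).
pose z t := mxvec (Zhat (Wq t) (Xq t)).
have xz t u : (t < N)%N -> (u < N)%N -> dotmx (x t) (z u) =
    (yhat (Wq u) (Xq u) - \tr (Wst^T *m Zhat (Wq u) (Xq u)))
    - (yhat (Wq u) (Xq u) - \tr ((Wq t)^T *m Zhat (Wq u) (Xq u))).
  by move=> _ _; exact: trace_sub.
have := @ellipsoid_potential R (K * d) N x z beta (2 * d%:R) (2 * H%:R) M.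
have -> : (0 < K * d)%N by rewrite muln_gt0 K0.
have -> : 0 < 2 * d%:R :> R by rewrite mulr_gt0 ?ltr0n.
rewrite b0 Mr MB => /(_ isT isT isT isT isT).
have xr t : (t < N)%N -> dotmx (x t) (x t) <= 2 * d%:R by move=> _; exact: weights_dist.
have zB t : (t < N)%N -> forall i, `|z t ord0 i| <= 2 * H%:R.
  move=> _ i; case/mxvec_indexP: i => k j.
  by rewrite mxvecE; exact: Z_hat_norm.
have xzu t u : (u < t < N)%N -> `|dotmx (x t) (z u)| <= beta.
  move=> /andP[ut tN]; have uN := ltn_trans ut tN.
  rewrite xz//; apply: le_trans (ler_normB _ _) _; rewrite /beta mulr_natl mulr2n.
  by apply: lerD; [exact: hst|apply: hconf; rewrite ut].
have xzt t : (t < N)%N -> 9 / 4 * (K * d)%:R * beta ^+ 2 <= dotmx (x t) (z t) ^+ 2.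
  move=> tN; have l1 := hst t tN; have l2 := hself t tN.
  (* The residual difference is at least [eps / 2 - 2 e' + 3 s H theta], and [e' <= eps / 12]. The
     term [3 sqrt (d K) H theta] of the stopping threshold is what matches the [theta] part of
     [3 / 2 * s * beta]. *)
  have gap : 3 / 2 * s * beta <= dotmx (x t) (z t).
    rewrite xz//; move: l1 l2; rewrite ler_norml => /andP[l1 _] l2.
    have -> : 3 / 2 * s * beta = eps / 4 + 3 * s * (H%:R * theta).
      by rewrite /beta; have := e's; lra.
    move: l1 l2; rewrite -/e' -[(_ * H%:R) * theta]mulrA mulrDl mul1r; lra.
  have -> : 9 / 4 * (K * d)%:R * beta ^+ 2 = (3 / 2 * s * beta) ^+ 2.
    have -> : (K * d)%:R = s ^+ 2 :> R by rewrite ss mulnC.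
    by move: (s) (beta) => a b; field.
  have g0 : 0 <= 3 / 2 * s * beta.
    apply: mulr_ge0 (ltW b0); apply: mulr_ge0 (ltW s0); lra.
  by rewrite lerXn2r// nnegrE// (le_trans g0).
move=> /(_ xr zB xzu xzt).
have dd0 : 0 < (2 * d%:R) ^+ (K * d) :> R by rewrite exprn_gt0// mulr_gt0 ?ltr0n.
rewrite exprVn ler_pdivrMr// -exprMn.
have := potential_lt H0 K0 d0 eps01; rewrite -/N => pN.
apply/negP; rewrite -ltNge; apply: le_lt_trans pN.
have M0 : 0 <= M by apply: le_trans Mr; rewrite invr_ge0 mulr_ge0.
rewrite [(K * d)%N]mulnC.
have -> : potential d K H eps = m * M * (2 * m).
  by rewrite /potential /M; move: (m) (H%:R) => a b; field; rewrite gt_eqF.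
have mM0 : 0 <= m * M by apply: mulr_ge0 M0; exact: ltW.
apply: lerXn2r; rewrite ?nnegrE.
- by apply: mulr_ge0 => //; apply: mulr_ge0 => //; exact: ler0n.
- by apply: mulr_ge0 => //; apply: mulr_ge0 => //; exact: ltW.
- by apply: ler_wpM2l => //; rewrite ler_pM2l.
Qed.
End deterministic.

(** * Runs of the algorithm *)

Section sub_sigma.
Context dO (Omega : measurableType dO) (F1 F2 : set (set Omega)).
Hypothesis F12 : F1 `<=` F2.

Lemma measurable_id_sub_sigma :
  measurable_fun [set: g_sigma_algebraType F2]
    (id : g_sigma_algebraType F2 -> g_sigma_algebraType F1).
Proof. by move=> _ B mB; rewrite setTI preimage_id; exact: (sub_sigma_algebra2 F12 mB). Qed.

Lemma measurable_fun_sub_sigma d (U : measurableType d) (f : Omega -> U) :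
  measurable_fun [set: g_sigma_algebraType F1] (f : g_sigma_algebraType F1 -> U) ->
  measurable_fun [set: g_sigma_algebraType F2] (f : g_sigma_algebraType F2 -> U).
Proof. by move=> mf; exact: (measurableT_comp mf measurable_id_sub_sigma). Qed.

Lemma measurable_fun_sub_sigma_prod dS (S : measurableType dS) d (U : measurableType d)
    (f : Omega * S -> U) :
  measurable_fun [set: g_sigma_algebraType F1 * S] (f : g_sigma_algebraType F1 * S -> U) ->
  measurable_fun [set: g_sigma_algebraType F2 * S] (f : g_sigma_algebraType F2 * S -> U).
Proof.
move=> mf.
have mi : measurable_fun [set: g_sigma_algebraType F2 * S]
    ((fun z => (z.1, z.2)) : g_sigma_algebraType F2 * S -> g_sigma_algebraType F1 * S).
  apply/measurable_fun_pairP; split; last exact: measurable_snd.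
  exact: (measurableT_comp measurable_id_sub_sigma measurable_fst).
rewrite (_ : f = f \o (fun z => (z.1, z.2))); first exact: (measurableT_comp mf mi).
by apply/funext => -[].
Qed.
End sub_sigma.


(** For [m = 0] the hypothesis reads [0 < 0], so a zero sample size needs no separate treatment. *)
Lemma mean_lt (R : realType) m (f : 'I_m -> R) (c : R) :
  \sum_(i < m) f i < m%:R * c -> m%:R^-1 * \sum_(i < m) f i < c.
Proof.
case: m f => [|m] f; first by rewrite big_ord0 mul0r ltxx.
by rewrite ltr_pdivrMl// ltr0n.
Qed.

Lemma conf_set_le dS dA (S : measurableType dS) (A : measurableType dA) (R : realType)
    H K d (base : 'I_K -> mdp S A R) (phi : simplex_fun (S * A)%type R d) piW eps theta n
    dO (Omega : measurableType dO) (W : nat -> Omega -> weights R K d)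
    (X : nat -> 'I_n -> Omega -> H.-tuple (step S A R)) t w V u :
  conf_set base phi piW eps theta W X t w V -> (u < t)%N ->
  `| y_hat base phi piW (W u w) (X u ^~ w) -
     \tr (V^T *m Z_hat base phi piW (W u w) (X u ^~ w)) |
    <= eps / (12 * Num.sqrt (d * K)%:R) + H%:R * theta.
Proof.
elim: t => [//|t IH] /= [ct ht]; rewrite ltnS leq_eqVlt => /predU1P[->//|].
exact: IH.
Qed.

Section run.
Context dS dA (S : measurableType dS) (A : measurableType dA) (R : realType).
Variables (H : nat) (P1 : probability S R) (K d : nat) (Mstar : mdp S A R).
Variables (base : 'I_K -> mdp S A R) (phi : simplex_fun (S * A)%type R d).
Variables (piW : weights R K d -> policy S A) (eps theta : R) (neval n : nat).
Context dO (Omega : measurableType dO) (P : probability Omega R).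
Variable W : nat -> Omega -> weights R K d.
Local Notation traj := (H.-tuple (step S A R)).
Variables (Y : nat -> 'I_neval -> Omega -> traj) (X : nat -> 'I_n -> Omega -> traj).
Variables (F G : nat -> set (set Omega)).
Hypothesis run : algorithm_run P1 base phi piW eps theta P W Y X Mstar F G.
Local Notation started := (started P1 base phi piW eps theta W Y X).
Local Notation stopped := (stopped P1 base phi piW eps theta W Y).
Local Notation conf_set := (conf_set base phi piW eps theta W X).
Local Notation residual := (residual base phi piW).
Local Notation vW := (vW H P1 base phi piW).

Let FG t : F t `<=` G t. Proof. exact: (F_sub_G run). Qed.
Let GF t : G t `<=` F t.+1. Proof. exact: (G_sub_F run). Qed.
Let Gm t : G t `<=` measurable. Proof. exact: (G_measurable run). Qed.
Let Fm t : F t `<=` measurable. Proof. exact: subset_trans (@FG t) (@Gm t). Qed.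

Let measurable_F t (B : set Omega) : measurable (B : set (g_sigma_algebraType (F t))) -> F t B.
Proof. by move=> mB; rewrite -(sigma_algebra_id (F_sigma_algebra run t)). Qed.
Let measurable_G t (B : set Omega) : measurable (B : set (g_sigma_algebraType (G t))) -> G t B.
Proof. by move=> mB; rewrite -(sigma_algebra_id (G_sigma_algebra run t)). Qed.

Let W_measurable t (F' : set (set Omega)) : F t `<=` F' ->
  weights_measurable (W t : g_sigma_algebraType F' -> weights R K d).
Proof.
by move=> FF' i j; apply: (measurable_fun_sub_sigma FF'); exact: (W_adapted run).
Qed.

Let pi_measurable t (F' : set (set Omega)) : F t `<=` F' -> forall h,
  measurable_fun [set: g_sigma_algebraType F' * S]
    (fun x : g_sigma_algebraType F' * S => piW (W t x.1) h x.2).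
Proof.
move=> FF' h; apply: (measurable_fun_sub_sigma_prod FF' (f := fun x => piW (W t x.1) h x.2)).
exact: (pi_adapted run).
Qed.

Definition value_at t (w : Omega) : R := value H P1 Mstar (piW (W t w)).

Let value_at_measurable t (F' : set (set Omega)) : F t `<=` F' ->
  measurable_fun [set: g_sigma_algebraType F'] (value_at t : g_sigma_algebraType F' -> R).
Proof. by move=> FF'; exact: (measurable_value_param H P1 (pi_measurable FF') Mstar). Qed.

Let vW_measurable t (F' : set (set Omega)) : F t `<=` F' ->
  measurable_fun [set: g_sigma_algebraType F'] ((fun w => vW (W t w)) : g_sigma_algebraType F' -> R).
Proof.
by move=> FF'; exact: (measurable_vW H P1 base phi (W_measurable FF') (pi_measurable FF')).
Qed.

Let total_measurable : measurable_fun [set: traj] (@total_reward _ _ S A R H).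
Proof.
apply: measurable_sum => i; apply: (measurableT_comp (@measurable_reward_of _ _ S A R)).
exact: measurable_tnth.
Qed.

Lemma stopped_G t : G t [set w | stopped t w].
Proof.
apply: measurable_G; apply: measurable_le_set; last exact: measurable_cst.
apply: measurable_funB; first exact: (vW_measurable (@FG t)).
apply: measurable_funM; first exact: measurable_cst.
apply: measurable_sum => i; apply: (measurableT_comp total_measurable).
exact: (Y_adapted run).
Qed.

Variable Wst : weights R K d.
Local Notation margin := (eps / (12 * Num.sqrt (d * K)%:R)).
Local Notation rad := (margin + H%:R * theta).

Let mean_residual t w : R := n%:R^-1 * \sum_(i < n) residual Wst (W t w) (X t i w).

(* [alive t] implies that round number [t.+1] takes place and that [Wst] is
   still a candidate; unlike [started], it is defined by finitely
   many measurable conditions. *)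
Fixpoint alive (t : nat) : set Omega :=
  match t with
  | 0 => setT
  | t'.+1 => alive t' `&` ~` [set w | stopped t' w] `&` [set w | `|mean_residual t' w| <= rad]
  end.

Lemma alive_started t w : alive t w ->
  (forall u, (u < t)%N -> ~ stopped u w) /\ conf_set t w Wst.
Proof.
elim: t => [//|t IH] /= [[/IH[h1 h2] h3] h4]; split.
  by move=> u; rewrite ltnS leq_eqVlt => /predU1P[->//|]; exact: h1.
by split => //=; rewrite y_hat_sub_trace.
Qed.

Lemma alive_F t : F t (alive t).
Proof.
elim: t => [|t IH] /=.
  by apply: measurable_F; exact: measurableT.
apply: measurable_F; apply: measurableI; first apply: measurableI.
- by apply: sub_sigma_algebra; apply: GF; exact: FG.
- by apply: measurableC; apply: sub_sigma_algebra; apply: GF; exact: stopped_G.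
apply: measurable_le_set; last exact: measurable_cst.
apply: (measurableT_comp (@normr_measurable R setT)).
apply: measurable_funM; first exact: measurable_cst.
apply: measurable_sum => i.
have FF : F t `<=` F t.+1 by apply: subset_trans (@FG t) (@GF t).
have mV : weights_measurable (fun _ : g_sigma_algebraType (F t.+1) => Wst).
  by move=> k j; exact: measurable_cst.
have mr := measurable_residual base phi (W_measurable FF) (pi_measurable FF) mV.
have mp : measurable_fun [set: g_sigma_algebraType (F t.+1)]
    ((fun w => (w, X t i w)) : g_sigma_algebraType (F t.+1) -> g_sigma_algebraType (F t.+1) * traj).
  by apply/measurable_fun_pairP; split; [exact: measurable_id|exact: (X_adapted run)].
exact: (measurableT_comp (mr H) mp).
Qed.

Hypotheses (H0 : (0 < H)%N) (eps0 : 0 < eps).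
Hypothesis VW01 : forall V h s, 0 <= Defs.VW H base phi piW V h s <= 1.
Hypothesis Mstar_bounded : bounded_rewards H P1 Mstar.
Hypothesis Wst_close : forall x,
  (l1_dist (trans Mstar x) (trans (mixed_mdp base phi Wst) x) +
   l1_dist (rew Mstar x) (rew (mixed_mdp base phi Wst) x) <= theta%:E)%E.

Let margin0 : 0 <= margin.
Proof. by apply: divr_ge0; [exact: ltW|apply: mulr_ge0; [exact: ler0n|exact: sqrtr_ge0]]. Qed.

Let aliveD t : alive t `<=` started t.
Proof. by move=> w /alive_started[h1 h2]; split => //; exists Wst. Qed.

Definition continuing t : set Omega := alive t `&` ~` [set w | stopped t w].

Lemma continuing_G t : G t (continuing t).
Proof.
apply: measurable_G; apply: measurableI.
  by apply: sub_sigma_algebra; apply: FG; exact: alive_F.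
by apply: measurableC; apply: sub_sigma_algebra; exact: stopped_G.
Qed.

Let continuingD t : continuing t `<=` started t `&` ~` [set w | stopped t w].
Proof. by move=> w [aw sw]; split => //; exact: aliveD. Qed.

Let mY t i : measurable_fun [set: Omega] (Y t i).
Proof.
have mY' := Y_adapted run (t:=t) i.
exact: (measurable_sub_sigma (G_sigma_algebra run t) (@Gm t) mY').
Qed.

Let mX t i : measurable_fun [set: Omega] (X t i).
Proof.
have mX' := X_adapted run (t:=t) i.
exact: (measurable_sub_sigma (F_sigma_algebra run t.+1) (@Fm t.+1) mX').
Qed.

(** The same law as a kernel over two sigma-algebras: evaluation draws are fresh given [F t],
    estimation draws given [G t]. *)
Local Notation lawF t := (plaw (O := g_sigma_algebraType (F t)) (pol := fun w => piW (W t w)) Mstar P1 H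
  (pi_measurable (fun A (h : F t A) => h))).
Local Notation lawG t := (plaw (O := g_sigma_algebraType (G t)) (pol := fun w => piW (W t w)) Mstar P1 H
  (pi_measurable (@FG t))).

Let fresh_Y t (E : set Omega) (B : 'I_neval -> set traj) :
  F t E -> E `<=` started t -> (forall i, measurable (B i)) ->
  P (E `&` \bigcap_i (Y t i @^-1` B i)) =
  (\int[P]_(w in E) (\prod_(i < neval) fine (lawF t w (B i)))%:E)%E.
Proof.
move=> FE ED mB; apply: (etrans (Y_fresh run FE ED mB)).
congr (integral _ _ _); apply/funext => w; congr (_%:E); apply: eq_bigr => i _.
congr fine; apply/esym; exact: plawE.
Qed.

Let fresh_X t (E : set Omega) (B : 'I_n -> set traj) :
  G t E -> E `<=` started t `&` ~` [set w | stopped t w] -> (forall i, measurable (B i)) ->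
  P (E `&` \bigcap_i (X t i @^-1` B i)) =
  (\int[P]_(w in E) (\prod_(i < n) fine (lawG t w (B i)))%:E)%E.
Proof.
move=> FE ED mB; apply: (etrans (X_fresh run FE ED mB)).
congr (integral _ _ _); apply/funext => w; congr (_%:E); apply: eq_bigr => i _.
congr fine; apply/esym; exact: plawE.
Qed.

Definition eval_high t : set Omega := [set w |
  neval%:R * (value_at t w + eps / 4) <= \sum_(i < neval) total_reward (Y t i w)].
Definition eval_low t : set Omega := [set w |
  neval%:R * (- value_at t w + eps / 4) <= \sum_(i < neval) - total_reward (Y t i w)].
Definition res_high t : set Omega := [set w |
  n%:R * (H%:R * theta + margin) <= \sum_(i < n) residual Wst (W t w) (X t i w)].
Definition res_low t : set Omega := [set w |
  n%:R * (H%:R * theta + margin) <= \sum_(i < n) - residual Wst (W t w) (X t i w)].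
Definition self_high t : set Omega := [set w |
  n%:R * (value_at t w - vW (W t w) + margin) <=
  \sum_(i < n) residual (W t w) (W t w) (X t i w)].

Let mtot (O : set (set Omega)) :
  measurable_fun [set: g_sigma_algebraType O * traj] (fun z => total_reward z.2).
Proof. exact: (measurableT_comp total_measurable measurable_snd). Qed.

Let mtotN (O : set (set Omega)) :
  measurable_fun [set: g_sigma_algebraType O * traj] (fun z => - total_reward z.2).
Proof. exact: measurable_funN (@mtot O). Qed.

Let mvalN t : measurable_fun [set: g_sigma_algebraType (F t)]
  ((fun w => - value_at t w) : g_sigma_algebraType (F t) -> R).
Proof. exact: (measurableT_comp (@oppr_measurable R setT) (value_at_measurable (fun A h => h))). Qed.

Lemma measurable_eval_high t : measurable (eval_high t).
Proof.
exact: (measurable_deviation (F_sigma_algebra run t) (@Fm t) (@mY t) (eps / 4)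
  (@mtot (F t)) (value_at_measurable (fun A h => h))).
Qed.

Lemma measurable_eval_low t : measurable (eval_low t).
Proof.
exact: (measurable_deviation (F_sigma_algebra run t) (@Fm t) (@mY t) (eps / 4)
  (@mtotN (F t)) (@mvalN t)).
Qed.

Lemma eval_high_le t : (P (alive t `&` eval_high t) <=
  (expR (- (2 * neval%:R * (eps / 4) ^+ 2 / (1 - 0) ^+ 2)))%:E)%E.
Proof.
apply: (fresh_hoeffding (F_sigma_algebra run t) (@Fm t) (@mY t) (@fresh_Y t)
  (@mtot (F t)) (value_at_measurable (fun A h => h))) => //.
- exact: alive_F.
- by apply: divr_ge0; [exact: ltW|exact: ler0n].
- by move=> w _; exact: total_reward_plaw.
- by move=> w _; rewrite Rintegral_plaw_total.
Qed.

Lemma eval_low_le t : (P (alive t `&` eval_low t) <=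
  (expR (- (2 * neval%:R * (eps / 4) ^+ 2 / (1 - 0) ^+ 2)))%:E)%E.
Proof.
have -> : (1 - 0 : R) = 0 - -1 by rewrite opprK subr0 add0r.
apply: (fresh_hoeffding (F_sigma_algebra run t) (@Fm t) (@mY t) (@fresh_Y t)
  (@mtotN (F t)) (@mvalN t)) => //.
- exact: alive_F.
- by apply: divr_ge0; [exact: ltW|exact: ler0n].
- move=> w _.
  apply: filterS (total_reward_plaw (pi_measurable (fun A (h : F t A) => h)) w Mstar_bounded)
    => tau /andP[t0 t1].
  by rewrite lerN2 t1/= oppr_le0.
- by move=> w _; rewrite RintegralN Rintegral_plaw_total.
Qed.

Let mWst t : weights_measurable (fun _ : g_sigma_algebraType (G t) => Wst).
Proof. by move=> k j; exact: measurable_cst. Qed.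

Let mres t : measurable_fun [set: g_sigma_algebraType (G t) * traj]
  (fun z => residual Wst (W t z.1) z.2).
Proof. exact: (measurable_residual base phi (W_measurable (@FG t)) (pi_measurable (@FG t)) (@mWst t)). Qed.

Let mself t : measurable_fun [set: g_sigma_algebraType (G t) * traj]
  (fun z => residual (W t z.1) (W t z.1) z.2).
Proof.
exact: (measurable_residual base phi (W_measurable (@FG t)) (pi_measurable (@FG t))
  (W_measurable (@FG t))).
Qed.

Let mgap t : measurable_fun [set: g_sigma_algebraType (G t)]
  ((fun w => value_at t w - vW (W t w)) : g_sigma_algebraType (G t) -> R).
Proof.
by apply: measurable_funB; [exact: value_at_measurable (@FG t)|exact: vW_measurable (@FG t)].
Qed.

Let residual_ae t w V : {ae lawG t w, forall tau : traj,
  - (2 * H%:R) <= residual V (W t w) tau <= H%:R}.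
Proof.
apply: filterS (total_reward_plaw (pi_measurable (@FG t)) w Mstar_bounded) => tau.
exact: residual_itv.
Qed.

Let res_bias t w : `|\int[lawG t w]_tau residual Wst (W t w) tau| <= H%:R * theta.
Proof.
by apply: (law_residual_bias P1 (W_measurable (@FG t)) (pi_measurable (@FG t))).
Qed.

Let H2 : - (2 * H%:R) < H%:R :> R.
Proof. by rewrite (@lt_trans _ _ 0) ?ltr0n// oppr_lt0 mulr_gt0 ?ltr0n. Qed.

Lemma res_high_le t : (P (continuing t `&` res_high t) <=
  (expR (- (2 * n%:R * margin ^+ 2 / (H%:R - - (2 * H%:R)) ^+ 2)))%:E)%E.
Proof.
apply: (fresh_hoeffding (G_sigma_algebra run t) (@Gm t) (@mX t) (@fresh_X t)
  (@mres t) (mean := fun _ => H%:R * theta)) => //.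
- exact: continuing_G.
- by move=> w _; apply: le_trans (ler_norm _) _; exact: res_bias.
Qed.

Lemma self_high_le t : (P (continuing t `&` self_high t) <=
  (expR (- (2 * n%:R * margin ^+ 2 / (H%:R - - (2 * H%:R)) ^+ 2)))%:E)%E.
Proof.
apply: (fresh_hoeffding (G_sigma_algebra run t) (@Gm t) (@mX t) (@fresh_X t)
  (@mself t) (@mgap t)) => //.
- exact: continuing_G.
- by move=> w _; exact: (@residual_ae t w (W t w)).
- move=> w _; rewrite le_eqVlt; apply/orP; left; apply/eqP.
  exact: (law_residual_self H P1 base phi (W_measurable (@FG t)) (pi_measurable (@FG t)) Mstar w).
Qed.

Lemma res_low_le t : (P (continuing t `&` res_low t) <=
  (expR (- (2 * n%:R * margin ^+ 2 / (H%:R - - (2 * H%:R)) ^+ 2)))%:E)%E.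
Proof.
have -> : H%:R - - (2 * H%:R) = 2 * H%:R - - H%:R :> R by rewrite !opprK addrC.
have mN := measurable_funN (@mres t).
apply: (fresh_hoeffding (G_sigma_algebra run t) (@Gm t) (@mX t) (@fresh_X t)
  mN (mean := fun _ => H%:R * theta)) => //.
- exact: continuing_G.
- by rewrite -ltrN2 opprK.
- move=> w _; apply: filterS (@residual_ae t w Wst) => tau /= /andP[r1 r2].
  by rewrite lerN2 r2/= -[leRHS]opprK lerN2.
- move=> w _; rewrite RintegralN; apply: le_trans (ler_norm _) _.
  by rewrite normrN; exact: res_bias.
Qed.

Lemma measurable_res_high t : measurable (res_high t).
Proof.
exact: (measurable_deviation (G_sigma_algebra run t) (@Gm t) (@mX t) margin
  (@mres t) (@measurable_cst _ _ _ _ _ (H%:R * theta))).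
Qed.

Lemma measurable_res_low t : measurable (res_low t).
Proof.
exact: (measurable_deviation (G_sigma_algebra run t) (@Gm t) (@mX t) margin
  (measurable_funN (@mres t)) (@measurable_cst _ _ _ _ _ (H%:R * theta))).
Qed.

Lemma measurable_self_high t : measurable (self_high t).
Proof.
exact: (measurable_deviation (G_sigma_algebra run t) (@Gm t) (@mX t) margin
  (@mself t) (@mgap t)).
Qed.

(** Deviations count only on outcomes where the round is alive, and for the estimation sample also
    continues: the freshness formula speaks only of rounds that take place. *)
Definition failure t : set Omega :=
  (alive t `&` eval_high t `|` alive t `&` eval_low t) `|`
  (continuing t `&` res_high t `|` continuing t `&` res_low t `|`
   continuing t `&` self_high t).

Lemma measurable_alive t : measurable (alive t).
Proof. by apply: (@Fm t); exact: alive_F. Qed.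

Lemma measurable_continuing t : measurable (continuing t).
Proof. by apply: (@Gm t); exact: continuing_G. Qed.

Lemma measurable_failure t : measurable (failure t).
Proof.
have ma := measurable_alive t; have mc := measurable_continuing t.
by apply: measurableU; [apply: measurableU|apply: measurableU; first apply: measurableU];
  apply: measurableI => //; [exact: measurable_eval_high|exact: measurable_eval_low|
    exact: measurable_res_high|exact: measurable_res_low|exact: measurable_self_high].
Qed.

Lemma failure_le t : (P (failure t) <=
  (2 * expR (- (2 * neval%:R * (eps / 4) ^+ 2 / (1 - 0) ^+ 2)) +
   3 * expR (- (2 * n%:R * margin ^+ 2 / (H%:R - - (2 * H%:R)) ^+ 2)))%:E)%E.
Proof.
have ma := measurable_alive t; have mc := measurable_continuing t.
have m1 := measurableI _ _ ma (measurable_eval_high t).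
have m2 := measurableI _ _ ma (measurable_eval_low t).
have m3 := measurableI _ _ mc (measurable_res_high t).
have m4 := measurableI _ _ mc (measurable_res_low t).
have m5 := measurableI _ _ mc (measurable_self_high t).
have l1 := eval_high_le t; have l2 := eval_low_le t.
have l3 := res_high_le t; have l4 := res_low_le t; have l5 := self_high_le t.
rewrite EFinD; move: (expR _) (expR _) l1 l2 l3 l4 l5 => a b l1 l2 l3 l4 l5.
apply: (le_trans (measureU2 _ (measurableU _ _ m1 m2) (measurableU _ _ (measurableU _ _ m3 m4) m5))).
apply: leeD.
  apply: (le_trans (measureU2 _ m1 m2)).
  by rewrite mulr_natl mulr2n EFinD; exact: leeD.
apply: (le_trans (measureU2 _ (measurableU _ _ m3 m4) m5)).
rewrite mulr_natl mulrSr EFinD; apply: leeD l5.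
apply: (le_trans (measureU2 _ m3 m4)).
by rewrite mulr2n EFinD; exact: leeD.
Qed.

Lemma alive_next t w : alive t w -> ~ stopped t w -> ~ failure t w -> alive t.+1 w.
Proof.
move=> aw sw fw; split=> //=.
have /negP : ~ res_high t w by move=> h; apply: fw; right; left; left.
have /negP : ~ res_low t w by move=> h; apply: fw; right; left; right.
rewrite /res_low /res_high/= -!ltNge => /mean_lt l1 /mean_lt l2.
move: l1; rewrite sumrN mulrN => l1.
by rewrite ler_norml [margin + _]addrC (ltW l2) andbT lerNl ltW.
Qed.

Hypotheses (K0 : (0 < K)%N) (d0 : (0 < d)%N) (eps1 : eps < 1) (theta0 : 0 <= theta).
Local Notation N := (max_rounds d K H eps).

(** If no round stopped, all [N] rounds would be alive and continuing, and [rounds_contradiction]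
    would apply to this outcome. *)
Lemma stopping_round w : (forall t, (t < N)%N -> ~ failure t w) ->
  exists t, [/\ (t < N)%N, alive t w & stopped t w].
Proof.
move=> nf; apply: contrapT => ns.
have cont t : (t < N)%N -> alive t w -> ~ stopped t w.
  by move=> tN aw sw; apply: ns; exists t.
have al t : (t <= N)%N -> alive t w.
  elim: t => [//|t IH] tN; have aw := IH (ltnW tN).
  by apply: alive_next => //; [exact: cont|exact: nf].
have eps01 : 0 < eps < 1 by rewrite eps0.
have := @rounds_contradiction _ _ _ _ _ _ _ _ base phi _ VW01 _ _ H0 K0 d0 eps01 theta0
  n (W ^~ w) (fun t => X t ^~ w) Wst.
apply.
- move=> t u /andP[ut tN]; apply: conf_set_le ut.
  by have [] := W_argmax run (aliveD (al t (ltnW tN))).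
- move=> t tN; have [_ /= ha] := al t.+1 tN.
  by rewrite y_hat_sub_trace.
(* The stopping test is missed by more than [3 eps / 4], of which the evaluation error takes
   [eps / 4]; the remaining [eps / 2] is the required overestimate. *)
- move=> t tN; rewrite y_hat_sub_trace.
  have aw := al t (ltnW tN); have sw := cont t tN aw; have fw := nf t tN.
  have /negP : ~ self_high t w by move=> h; apply: fw; right; right.
  have /negP : ~ eval_low t w by move=> h; apply: fw; left; right.
  rewrite /eval_low /self_high/= -!ltNge => /mean_lt l1 /mean_lt l2.
  move: l1; rewrite sumrN mulrN -/(v_hat _) => l1.
  move/negP: sw; rewrite /Defs.stopped /stop -ltNge.
  move: l1 l2; move: (value_at t w) (vW (W t w)) (v_hat _) (margin) (n%:R^-1 * _)
    (Num.sqrt _) (H%:R) => a b c e f g i; move: eps0 => _.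
  move: (_ * theta) => j; lra.
Qed.

Variable pistar : policy S A.
Hypothesis piW_optimal : forall V, optimal H P1 (mixed_mdp base phi V) (piW V).
Hypothesis bounded_mixed : forall V, bounded_rewards H P1 (mixed_mdp base phi V).

(** The stopping test loses [3 eps / 4 + (3 sqrt (d K) + 1) H theta], the evaluation error
    [eps / 4]. Comparing [pistar] in the model of [Wst] and in [Mstar] loses one more [H theta]. *)
Lemma value_at_stop t w : alive t w -> stopped t w -> ~ failure t w ->
  value H P1 Mstar pistar - eps - (3 * Num.sqrt (d * K)%:R + 2) * H%:R * theta <= value_at t w.
Proof.
move=> aw sw fw.
have /negP : ~ eval_high t w by move=> h; apply: fw; left; left.
rewrite /eval_high/= -ltNge => /mean_lt; rewrite -/(v_hat _) => l1.
have [_ /(_ Wst) l2] := W_argmax run (aliveD aw).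
have {}l2 := l2 (alive_started aw).2.
have l3 := piW_optimal Wst pistar.
have := simulation P1 Wst_close (fun h s => (bounded_mixed Wst pistar).2 h s).
rewrite ler_norml => /andP[_ l4].
move: sw l1 l2 l3 l4; rewrite /Defs.stopped /stop -/(vW Wst).
move: (value_at t w) (vW (W t w)) (vW Wst) (v_hat _) (value H P1 (mixed_mdp base phi Wst) pistar)
  (value H P1 Mstar pistar) => a b c e f i.
rewrite -!mulrA; move: (H%:R * theta) (Num.sqrt _) => x s.
have -> : (3 * s + 2) * x = 3 * s * x + 2 * x by rewrite mulrDl.
have -> : (3 * s + 1) * x = 3 * s * x + x by rewrite mulrDl mul1r.
lra.
Qed.
End run.

Theorem theorem4p1 :
  exists C p : nat,
  forall (R : realType)
    (dS dA : measure_display) (S : measurableType dS) (A : measurableType dA)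
    (H : nat) (P1 : probability S R)
    (K d : nat) (Mstar : mdp S A R) (base : 'I_K -> mdp S A R)
    (phi : simplex_fun (S * A)%type R d)
    (pistar : policy S A) (piW : weights R K d -> policy S A)
    (eps delta theta : R),
  let neval := n_eval_of d K H eps delta in
  let n := n_of d K H eps delta in
  forall (dO : measure_display) (Omega : measurableType dO)
    (P : probability Omega R)
    (W : nat -> Omega -> weights R K d)
    (Y : nat -> 'I_neval -> Omega -> H.-tuple (step S A R))
    (X : nat -> 'I_n -> Omega -> H.-tuple (step S A R))
    (F G : nat -> set (set Omega)),
  (0 < H)%N -> (0 < K)%N -> (0 < d)%N ->
  0 < eps < 1 -> 0 < delta < 1 ->
  is_approx_error base phi Mstar theta ->
  bounded_rewards H P1 Mstar ->
  (forall k, bounded_rewards H P1 (base k)) ->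
  (forall V : weights R K d, bounded_rewards H P1 (mixed_mdp base phi V)) ->
  optimal H P1 Mstar pistar ->
  (forall V : weights R K d, optimal H P1 (mixed_mdp base phi V) (piW V)) ->
  algorithm_run P1 base phi piW eps theta P W Y X Mstar F G ->
  exists E : set Omega,
    [/\ measurable E, ((1 - delta)%:E <= P E)%E &
     forall w, E w -> exists t : nat,
       [/\ started P1 base phi piW eps theta W Y X t w,
           stopped P1 base phi piW eps theta W Y t w,
           (t.+1 * neval + t * n)%:R <= sample_bound C p d K H eps delta &
           value H P1 Mstar pistar - eps
             - (3 * Num.sqrt (d * K)%:R + 2) * H%:R * theta
           <= value H P1 Mstar (piW (W t w))]].
Proof.
(* The factor 205 bounds the rounds and [180 * 100] the trajectories per round, up to logarithms and
   powers of the parameters. *)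
exists (205 * 180 * 100)%N, 2%N => R dS dA S A H P1 K d Mstar base phi pistar piW eps delta theta.
move=> neval n dO Omega P W Y X F G H0 K0 d0 eps01 delta01 [[Wst WstE] _].
move=> Mstar_bounded _ mixed_bounded _ piW_optimal run.
have /andP[eps0 eps1] := eps01.
have VW01 V h s : 0 <= VW H base phi piW V h s <= 1 by exact: (mixed_bounded V (piW V)).2.
have Wst_close x : (l1_dist (trans Mstar x) (trans (mixed_mdp base phi Wst) x) +
    l1_dist (rew Mstar x) (rew (mixed_mdp base phi Wst) x) <= theta%:E)%E.
  by rewrite -WstE; apply: ereal_sup_ubound; exists x.
have theta0 : 0 <= theta.
  rewrite -lee_fin; apply: le_trans (Wst_close point).
  by apply: adde_ge0; exact: l1_dist_ge0.
pose N := max_rounds d K H eps.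
pose bad t := failure P1 Mstar base phi piW eps theta W Y X Wst t.
have mbad t : measurable (bad t) by exact: (measurable_failure run).
have mB : measurable (\big[setU/set0]_(t < N) bad t) by exact: bigsetU_measurable.
exists (~` \big[setU/set0]_(t < N) bad t); split.
- exact: measurableC.
- rewrite probability_setC// EFinB leeB//.
  apply: (le_trans (Boole_inequality P (fun t _ => mbad t))).
  apply: (@le_trans _ _ (\sum_(t < N) (2 * eval_failure d K H eps delta +
      3 * residual_failure d K H eps delta)%:E)%E).
    apply: lee_sum => t _.
    exact: (failure_le run H0 eps0 VW01 Mstar_bounded Wst_close).
  rewrite sumEFin lee_fin sumr_const card_ord -[leLHS]mulr_natl.
  exact: union_bound.
- move=> w nbad.
  have nb t : (t < N)%N -> ~ bad t w.
    by move=> tN bt; apply: nbad; rewrite -bigcup_mkord; exists t.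
  have [t [tN aw sw]] := stopping_round run H0 eps0 VW01 K0 d0 eps1 theta0 nb.
  exists t; split => //.
  + split; first by case: (alive_started aw).
    by exists Wst; case: (alive_started aw).
  + exact: samples_le.
  + exact: (value_at_stop run Wst_close pistar piW_optimal mixed_bounded aw sw (nb t tN)).
Qed.
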